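(* Let $\bm{\beta}=(\beta^{(0)},\beta^{(1)},\beta^{(2)})$ be a 3-tuple of skew shapes such that each $\beta^{(i)}$ contains no $2\times 2$ square, and let $\lambda$ be a partition. The corresponding new variant $q$-Littlewood-Richardson coefficients are given by $$\mathfrak{c}_{\bm{\beta}}^\lambda(q)=\sum_{\substack{T\in\mathrm{RSST}_\lambda\\ \mathrm{sqread}(T)\in \mathrm{W}_3'(\bm{\beta})}}q^{\mathrm{inv}_3'(\mathrm{sqread}(T))}.$$
   Context: **Shapes.** Cells $(r,c)\in\mathbb{Z}_{\ge1}\times\mathbb{Z}_{\ge1}$: row $r$ numbered from north to south, column $c$ from west to east; the content (diagonal) of $(r,c)$ is $c-r$. $(r,c)\le_{\searrow}(r',c')$ iff $r\le r'$ and $c\le c'$. For a $k$-tuple $\bm{\beta}=(\beta^{(0)},\dots,\beta^{(k-1)})$ of skew shapes, the shifted content of a cell $z$ of $\beta^{(i)}$ is $\tilde c(z)=k\cdot c(z)+i$, with $c(z)$ the usual content in $\beta^{(i)}$. **Words.** For $\bm\beta$ such that no $\beta^{(i)}$ contains a $2\times2$ square, $\mathrm{W}_k'(\bm{\beta})$ is the set of words $\mathsf{v}$ such that (1) $\mathsf{v}$ is a rearrangement of the shifted contents of the cells of $\bm{\beta}$, and (2) for each $i$ and each pair $z,z'$ of cells of $\beta^{(i)}$ such that $z'$ lies immediately east or south of $z$, the letter $\tilde c(z)$ occurs before $\tilde c(z')$ in $\mathsf{v}$. For a word $\mathsf{v}$ in the alphabet $\mathbb{Z}$, $\mathrm{inv}_k'(\mathsf{v})=|\{(i,j):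 i<j,\ 0<\mathsf{v}_i-\mathsf{v}_j<k\}|$. **LLT polynomials.** Let $\bm\beta$ be a $k$-tuple of skew shapes with $n$ cells in total. Its content vector $c=(c_1\le\dots\le c_n)$ is the weakly increasing sequence of all shifted contents of its cells (with repetition). Let $\tilde c^{\mathrm{st}}$ be the bijection from cells to $[n]$ numbering the cells by increasing shifted content, with cells of equal shifted content numbered increasingly in the $\searrow$ direction. Let $D$ be the set of pairs $(\tilde c^{\mathrm{st}}(z'),\tilde c^{\mathrm{st}}(z))$ with $z,z'$ cells (of the same $\beta^{(i)}$) such that $\tilde c(z)=\tilde c(z')+k$ and $z<_{\searrow}z'$. For a word $w=w_1\cdots w_n$ of positive integers let $\mathrm{Des}_k(w,c)=\{(i,j): i<j,\ w_i>w_j,\ c_j-c_i=k\}$ and $\mathrm{inv}_k(w,c)=|\{(i,j): i<j,\ w_i>w_j,\ 0<c_j-c_i<k\}|$. A $k$-ribbon word is a pair $(w,c)$ such that whenever $c_i=c_{i+1}$ there exist $h,j$ with $(h,i),(i+1,j)\in\mathrm{Des}_k(w,c)$ and $(i,j),(h,i+1)\notin\mathrm{Des}_k(w,c)$. $\mathrm{WRib}_k(c,D)$ is the set of $k$-ribbon words $(w,c)$ with $\mathrm{Des}_k(w,c)=D$. For a word $v=v_1\cdots v_n$, $\mathrm{Des}(v)=\{i\in[n-1]: v_i>v_{i+1}\}$, and $Q_{\mathrm{Des}(v)}(\mathbf{x})=\sum x_{i_1}\cdots x_{i_n}$ over $1\le i_1\le\cdots\le i_n$ with $i_j<i_{j+1}$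 whenever $j\in\mathrm{Des}(v)$. The (new variant combinatorial) LLT polynomial is $$\mathcal{G}_{\bm\beta}(\mathbf{x};q)=\sum_{(w,c)\in\mathrm{WRib}_k(c,D),\ w\text{ a permutation}}q^{\mathrm{inv}_k(w,c)}Q_{\mathrm{Des}(w^{-1})}(\mathbf{x}).$$ It is a symmetric function, and the coefficients $\mathfrak{c}^\lambda_{\bm\beta}(q)$ are defined by $\mathcal{G}_{\bm\beta}(\mathbf{x};q)=\sum_\lambda\mathfrak{c}^\lambda_{\bm\beta}(q)s_\lambda(\mathbf{x})$, with $s_\lambda$ the Schur functions. **Tableaux.** $\mathrm{RSST}_\lambda$ is the set of fillings $T$ of the shape $\{(r,c):1\le c\le\lambda_r\}$ with integers that strictly increase from west to east in rows, strictly increase from north to south in columns, and satisfy $T_{r,c}+3\le T_{r',c'}$ whenever $r<r'$ and $c<c'$. For each pair of cells $(r,c),(r+1,c+1)$ of $T$ with $T_{r+1,c+1}=T_{r,c}+3$ there is one arrow: if $T_{r+1,c}=T_{r,c}+2$, a $\nwarrow$ arrow with tail $(r+1,c+1)$ and head $(r,c)$; if $T_{r+1,c}=T_{r,c}+1$, a $\searrow$ arrow with tail $(r,c)$ and head $(r+1,c+1)$. Let $D^1,\dots,D^t$ be the diagonals of $T$ from southwest to northeast and let $\mathsf{w}^i$ be the word obtained by reading, in the $\nwarrow$ direction, the entries of $D^i$ that are tails of $\nwarrow$ arrows, followed by the remaining entries of $D^i$ read in the $\searrow$ direction. Then $\mathrm{sqread}(T)=\mathsf{w}^1\mathsf{w}^2\cdots\mathsf{w}^t$.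 *)

(* Defs.v *)
From HB Require Import structures.
From mathcomp Require Import all_boot all_order all_algebra all_fingroup.
From mathcomp Require Import finmap mpoly.
From mathcomp Require Import classical_sets fsbigop.

Set Implicit Arguments.
Unset Strict Implicit.
Unset Printing Implicit Defensive.

Import Order.TTheory GRing.Theory Num.Theory.
Local Open Scope ring_scope.

(* Cells are pairs (row, column) numbered from (0, 0) instead of (1, 1);
   contents and the relative positions of cells do not see the shift. *)
Definition cell : Type := (nat * nat)%type.

Definition content (z : cell) : int := z.2%:Z - z.1%:Z.

Definition le_se (z z' : cell) : bool := (z.1 <= z'.1)%N && (z.2 <= z'.2)%N.

Definition row_lt (z z' : cell) : bool := (z.1 == z'.1) && (z.2 < z'.2)%N.
Definition col_lt (z z' : cell) : bool := (z.1 < z'.1)%N && (z.2 == z'.2).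
Definition lt_se (z z' : cell) : bool := (z.1 < z'.1)%N && (z.2 < z'.2)%N.

Definition east (z z' : cell) : bool := z' == (z.1, z.2.+1).
Definition south (z z' : cell) : bool := z' == (z.1.+1, z.2).

Definition is_part (s : seq nat) : bool := sorted geq s && (0%N \notin s).

Definition intpart : Type := {s : seq nat | is_part s}.

Definition diagram (p : intpart) : seq cell :=
  [seq (r, c) | r <- iota 0 (size (val p)), c <- iota 0 (nth 0%N (val p) r)].

Record skew_shape := SkewShape {
  outer : intpart;
  inner : intpart;
  skew_sub : {subset diagram inner <= diagram outer}
}.

Definition cells (b : skew_shape) : seq cell :=
  [seq z <- diagram (outer b) | z \notin diagram (inner b)].

Definition no_square (b : skew_shape) : Prop :=
  forall r c : nat,
    ~~ [&& (r, c) \in cells b, (r, c.+1) \in cells b,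
           (r.+1, c) \in cells b & (r.+1, c.+1) \in cells b].

Section ShapeTuples.

Variables (k : nat) (beta : 'I_k -> skew_shape).

Definition tcells : seq ('I_k * cell) :=
  [seq (i, z) | i <- enum 'I_k, z <- cells (beta i)].

Definition scontent (z : 'I_k * cell) : int := k%:Z * content z.2 + (z.1 : nat)%:Z.

Definition ncells : nat := size tcells.

Definition content_vector (i : 'I_ncells) : int :=
  nth 0 (sort <=%R [seq scontent z | z <- tcells]) i.

(* Two cells of the same shifted content lie on one diagonal of one component,
   so this is a total order on tcells. *)
Definition st_le (z z' : 'I_k * cell) : bool :=
  (scontent z < scontent z') || (scontent z == scontent z') && le_se z.2 z'.2.

Definition st (z : 'I_k * cell) : nat := index z (sort st_le tcells).

Definition descent_data : {set 'I_ncells * 'I_ncells} :=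
  [set ij : 'I_ncells * 'I_ncells | has (fun z => has (fun z' =>
     [&& ij.1 == st z' :> nat, ij.2 == st z :> nat, z.1 == z'.1,
         scontent z == scontent z' + k%:Z, z.2 != z'.2 & le_se z.2 z'.2])
     tcells) tcells].

(* When no beta i contains a 2 x 2 square, the shifted contents of distinct
   cells are distinct, so each letter of v has exactly one position. *)
Definition Wprime (v : seq int) : Prop :=
  perm_eq v [seq scontent z | z <- tcells] /\
  forall (i : 'I_k) (z z' : cell), z \in cells (beta i) -> z' \in cells (beta i) ->
    east z z' || south z z' ->
    (index (scontent (i, z)) v < index (scontent (i, z')) v)%N.

End ShapeTuples.

Definition inv_prime (k : nat) (v : seq int) : nat :=
  #|[set ij : 'I_(size v) * 'I_(size v) |
      (ij.1 < ij.2)%N && (0 < nth 0 v ij.1 - nth 0 v ij.2 < k%:Z)]|.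

Section RibbonWords.

Variables (k n : nat) (w : 'I_n -> nat) (c : 'I_n -> int).

Definition Des_k : {set 'I_n * 'I_n} :=
  [set ij : 'I_n * 'I_n |
      [&& (ij.1 < ij.2)%N, (w ij.2 < w ij.1)%N & c ij.2 - c ij.1 == k%:Z]].

Definition inv_k : nat :=
  #|[set ij : 'I_n * 'I_n |
      [&& (ij.1 < ij.2)%N, (w ij.2 < w ij.1)%N & 0 < c ij.2 - c ij.1 < k%:Z]]|.

Definition ribbon_word : bool :=
  [forall i : 'I_n, forall i' : 'I_n, (i' == i.+1 :> nat) && (c i == c i') ==>
     [exists h : 'I_n, exists j : 'I_n,
        [&& (h, i) \in Des_k, (i', j) \in Des_k,
            (i, j) \notin Des_k & (h, i') \notin Des_k]]].

End RibbonWords.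

Definition Des (n : nat) (v : 'I_n -> nat) : {set 'I_n} :=
  [set i : 'I_n | [exists j : 'I_n, (j == i.+1 :> nat) && (v j < v i)%N]].

(* A symmetric function is represented by the family of its restrictions to
   x_0, ..., x_(N-1), for all N; its coefficients are polynomials in q, the
   indeterminate of {poly int}. *)
Definition symfun : Type := forall N : nat, {mpoly {poly int}[N]}.

Definition Qsym (n : nat) (D : {set 'I_n}) : symfun := fun N =>
  \sum_(a : {ffun 'I_n -> 'I_N} |
        [forall j : 'I_n, forall j' : 'I_n, (j' == j.+1 :> nat) ==>
           (a j <= a j')%N && ((j \in D) ==> (a j < a j')%N)])
    \prod_(j < n) 'X_(a j).

Definition LLT (k : nat) (beta : 'I_k -> skew_shape) : symfun := fun N =>
  let c := content_vector (beta := beta) in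
  \sum_(w : 'S_(ncells beta) |
        ribbon_word k (fun i => w i) c && (Des_k k (fun i => w i) c == descent_data beta))
    'X ^+ inv_k k (fun i => w i) c *: Qsym (Des (fun i => (w^-1)%g i)) N.

Definition schur (p : intpart) : symfun := fun N =>
  \sum_(T : {ffun seq_sub (diagram p) -> 'I_N} |
        [forall z, forall z', (row_lt (val z) (val z') ==> (T z <= T z')%N) &&
                              (col_lt (val z) (val z') ==> (T z < T z')%N)])
    \prod_z 'X_(T z).

(* fsfun values are finitely supported, so the sum over the support is the sum
   over all partitions.  Such an expansion exists because LLT beta is symmetric,
   and it is unique because the Schur functions are linearly independent. *)
Definition LLT_coef (k : nat) (beta : 'I_k -> skew_shape) :
    {fsfun intpart -> {poly int} with 0} :=
  xget [fsfun] [set f | forall N : nat,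
    LLT beta N = \sum_(mu <- finsupp f) f mu *: schur mu N]%classic.

Section Tableaux.

Variables (p : intpart) (T : {ffun seq_sub (diagram p) -> int}).

Definition RSST : bool :=
  [forall z, forall z',
     [&& row_lt (val z) (val z') ==> (T z < T z'),
         col_lt (val z) (val z') ==> (T z < T z') &
         lt_se (val z) (val z') ==> (T z + 3 <= T z')]].

(* Here x, y, z are the cells (r,c), (r+1,c), (r+1,c+1); only the tails of the
   northwest arrows matter for the reading word. *)
Definition nw_tail (z : seq_sub (diagram p)) : bool :=
  [exists x, exists y,
     [&& south (val x) (val y), east (val y) (val z),
         T z == T x + 3 & T y == T x + 2]].

Definition diagonal (d : int) : seq (seq_sub (diagram p)) :=
  sort (fun z z' => le_se (val z) (val z'))
    (enum [pred z : seq_sub (diagram p) | content (val z) == d]).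

Definition diagonal_word (d : int) : seq int :=
  [seq T z | z <- rev (diagonal d) & nw_tail z] ++
  [seq T z | z <- diagonal d & ~~ nw_tail z].

(* The contents of the diagonals run from 1 - (number of rows) to
   (number of columns) - 1. *)
Definition sqread : seq int :=
  flatten [seq diagonal_word (j%:Z - (size (val p))%:Z)
          | j <- iota 1 (size (val p) + head 0%N (val p)).-1].

End Tableaux.

(* Main.v *)
(* Since no component contains a 2 x 2 square, the shifted contents are distinct, and
   LLT beta is a sum over colourings c of the sorted letters, weighted by a power of q for
   the inverted pairs at distance 1 or 2, with a prescribed orientation for the pairs at
   distance 3.  Multiply it by the Vandermonde determinant and regard each colouring as a walk
   from delta in Z^N.  A step that leaves the Weyl chamber contributes 0 by symmetry in two
   adjacent variables, unless the last three letters remember which of the two rows they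
   lie in.  This only happens when t - 2 lies right above t - 1 and t would be put next
   to t - 1, in the lower row; the leftover terms then turn the orientation of
   (t - 2, t + 1) around exactly for the tableaux in which these two letters are joined by
   a southeast arrow.  What remains is a sum over standard tableaux, whose weights are those
   of their reading words sqread T, of the alternants of their shapes; dividing by the
   Vandermonde determinant turns the alternants into Schur functions. *)

Require Import Defs.
From HB Require Import structures.
From mathcomp Require Import all_boot all_order all_algebra all_fingroup.
From mathcomp Require Import finmap mpoly.
From mathcomp Require Import boolp classical_sets fsbigop.
From mathcomp Require Import ring zify.

Set Implicit Arguments.
Unset Strict Implicit.
Unset Printing Implicit Defensive.

Import Order.TTheory GRing.Theory Num.Theory.
Local Open Scope ring_scope.

(** * Two-colour symmetry *)

(** For adjacent rows a and b = a + 1, the comparisons c < a and c < b agree for every colour c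
    other than a. So only an earlier letter of colour a distinguishes x_a from x_b, and a step onto
    the wall between the two rows gives 0 unless a is among the last three colours. Along a chain of
    partitions this leaves only the memory a, b, b for t - 2, t - 1, t. From there t + 1 in a third
    row gives 0, while rows a and b together give w - z times a single alternating sum, where w and
    z are the weights of (t - 2, t + 1) without and with inversion. The same sum continues the
    legitimate walk a, b, a, b, whose four cells form a 2 x 2 square, and both walks carry the same
    power of q. So the weight z of the legitimate walk becomes z + (w - z) = w. The obstacle is that
    this exchange spans two letters: half way through the square the two sides differ, and the
    induction must carry the difference explicitly. The weights w and z stay arbitrary ring elements
    throughout; only at the end are they specialised to the 0-1 indicators that enforce the
    prescribed descents. *)

Section Colourings.

Variables (R : comNzRingType) (q : R) (N : nat).

(** Weight of the pair (t - 3, t): [z] if the colour strictly increases, which is an inversion once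
    the colours are reversed, and [w] otherwise. *)
Definition link (w z : R) (m j : nat) : R := if (m < j)%N then z else w.

Definition colour_step (w z : R) (m1 m2 m3 j : nat) : R :=
  q ^+ ((m1 < j) + (m2 < j))%N * link w z m3 j.

(* Sums all colourings of the remaining letters, one list entry per integer t, where
   [None] marks a missing letter.  The colours of t - 1, t - 2 and t - 3 are [m1], [m2] and
   [m3]; a missing letter has colour [N], which is below no colour. *)
Fixpoint colsum (l : seq (option (R * R))) (m1 m2 m3 : nat) (x : 'I_N -> R) : R :=
  match l with
  | [::] => 1
  | None :: l' => colsum l' N m1 m2 x
  | Some (w, z) :: l' =>
      \sum_(j < N) colour_step w z m1 m2 m3 j * x j * colsum l' j m1 m2 x
  end.

Section Adjacent.

Variables ia ib : 'I_N.
Hypothesis ib_succ : ib = ia.+1 :> nat.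

Let sw (x : 'I_N -> R) : 'I_N -> R := fun i => x (tperm ia ib i).
Definition swap_invariant (f : ('I_N -> R) -> R) := forall x, f (sw x) = f x.

Let recolour (M : bool) (c : nat) : nat := if M then nat_of_ord ia else c.

(* The colour [ia] is the only one of the two that later letters can tell from the other:
   past [ib] is below neither of them.  [Mi] says that the letter t - i has colour [ia]
   instead of [ib].  The coefficients [g] can be chosen symmetric, and in this form the
   recursion of [colsum] preserves that. *)
Definition mask_form (g : bool -> bool -> bool -> R) (y : R) (M1 M2 M3 : bool) : R :=
  g false false false
  + M1%:R * y * g true false false
  + M2%:R * q ^+ M1 * y * g false true false
  + M3%:R * q ^+ (M1 + M2)%N * y * g false false true
  + (M1 && M2)%:R * y ^+ 2 * g true true false
  + (M1 && M3)%:R * q ^+ M2 * y ^+ 2 * g true false true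
  + (M2 && M3)%:R * q ^+ (2 * M1)%N * y ^+ 2 * g false true true
  + [&& M1, M2 & M3]%:R * y ^+ 3 * g true true true.

Lemma neutral_ltn c : c != ia :> nat -> (c < ib)%N = (c < ia)%N.
Proof. by move=> ca; rewrite ib_succ ltnS leq_eqVlt (negPf ca). Qed.

Lemma recolour_ltn (M : bool) c (j : 'I_N) : (M -> c = ib :> nat) -> j != ia -> j != ib ->
  (recolour M c < j)%N = (c < j)%N.
Proof.
rewrite /recolour; case: M => // cb ja jb; rewrite cb // ib_succ.
by rewrite [LHS]leq_eqVlt -ib_succ -[ib == j :> nat]/(ib == j) eq_sym (negPf jb).
Qed.

Lemma recolour_ltn_l (M : bool) c : (M -> c = ib :> nat) -> (recolour M c < ia)%N = (c < ia)%N.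
Proof. by rewrite /recolour; case: M => // cb; rewrite cb // ltnn ib_succ ltnNge leqnSn. Qed.

Lemma recolour_ltn_r (M : bool) c : c != ia :> nat -> (M -> c = ib :> nat) ->
  (recolour M c < ib)%N = (M + (c < ia))%N :> nat.
Proof.
move=> ca; rewrite /recolour; case: M => [cb|_]; last by rewrite neutral_ltn.
by rewrite cb // ib_succ ltnSn ltnNge leqnSn.
Qed.

Lemma recolour_link_r w z (M : bool) c : c != ia :> nat -> (M -> c = ib :> nat) ->
  link w z (recolour M c) ib = if M then z else link w z c ia.
Proof.
move=> ca; rewrite /recolour /link; case: M => [cb|_]; last by rewrite neutral_ltn.
by rewrite ib_succ ltnSn.
Qed.

Lemma recolour_link_l w z (M : bool) c : (M -> c = ib :> nat) ->
  link w z (recolour M c) ia = link w z c ia.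
Proof. by move=> cb; rewrite /link recolour_ltn_l. Qed.

(** Induction on the letters. A new letter of a third colour is blind to the masks and only shifts
    them. A letter of colour [ib] gains a factor q for each of [M1], [M2] and has link [z] under
    [M3]. A letter of colour [ia] ignores the old masks but sets a new one. Collecting terms by
    masks yields the recursion for [g]. *)
Lemma colsum_mask_form l c1 c2 c3 : c1 != ia :> nat -> c2 != ia :> nat -> c3 != ia :> nat ->
  exists2 g : bool -> bool -> bool -> ('I_N -> R) -> R,
    forall U1 U2 U3, swap_invariant (g U1 U2 U3) &
    forall (M1 M2 M3 : bool) x, (M1 -> c1 = ib :> nat) -> (M2 -> c2 = ib :> nat) -> (M3 -> c3 = ib :> nat) ->
    colsum l (recolour M1 c1) (recolour M2 c2) (recolour M3 c3) x =
    mask_form (fun a b c => g a b c x) (x ib) M1 M2 M3.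
Proof.
have ab : ia != ib by rewrite -val_eqE /= ib_succ neq_ltn ltnSn.
elim: l c1 c2 c3 => [|[[w z]|] l IH] c1 c2 c3 c1a c2a c3a.
- exists (fun a b c _ => (~~ [|| a, b | c])%:R) => // M1 M2 M3 x _ _ _.
  by rewrite /mask_form /=; ring.
(* The induction hypothesis excludes the colour [ia], so a letter of that colour is stored as [ib]
   with its mask set. *)
- pose d (j : 'I_N) : nat := if j == ia then ib else j.
  have da j : d j != ia :> nat.
    rewrite /d; case: ifP => [_|/negbT //].
    by rewrite ib_succ neq_ltn ltnSn orbT.
  have [g gs gE] := fin_all_exists2 (fun j => IH (d j) c1 c2 (da j) c1a c2a).
  pose W := q ^+ ((c1 < ia) + (c2 < ia))%N * link w z c3 ia.
  pose Z := q ^+ ((c1 < ia) + (c2 < ia))%N * z.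
  pose e U1 U2 x := \sum_(j | (j != ia) && (j != ib))
     colour_step w z c1 c2 c3 j * x j * g j false U1 U2 x.
  pose h := g ib.
  (* Here [W] and [Z] are the weights of a step to [ib] with all masks off and with only [M3] on.
     The third mask acts through Z - W only, since t - 3 is then forgotten. *)
  exists (fun U1 U2 U3 x => (if U3 then 0 else e U1 U2 x) +
   match U1, U2, U3 with
   | false, false, false => W * ((x ia + x ib) * h false false false x + x ia * x ib * h true false false x)
   | true, false, false => W * q * (x ia + x ib) * h false true false x + W * x ia * x ib * h true true false x + W * (q - 1) * h false false false x
   | false, true, false => W * q * (x ia + x ib) * h false false true x + W * x ia * x ib * h true false true x + W * (q - 1) * h false false false x
   | true, true, false => W * q ^+ 2 * (x ia + x ib) * h false true true x + W * x ia * x ib * h true true true x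
        + W * q * (q - 1) * h false true false x + W * q ^+ 2 * (q - 1) * h false false true x
   | false, false, true => (Z - W) * h false false false x
   | true, false, true => (Z - W) * q * h false true false x
   | false, true, true => (Z - W) * q * h false false true x
   | true, true, true => (Z - W) * q ^+ 2 * h false true true x
   end).
    move=> U1 U2 U3 x.
    have es V1 V2 : e V1 V2 (sw x) = e V1 V2 x.
      apply: eq_bigr => j /andP [ja jb]; rewrite gs; congr (_ * _ * _).
      by rewrite /sw tpermD // eq_sym.
    have swa : sw x ia = x ib by rewrite /sw tpermL.
    have swb : sw x ib = x ia by rewrite /sw tpermR.
    by case: U1; case: U2; case: U3; rewrite ?es /h !gs ?swa ?swb; ring.
  move=> M1 M2 M3 x h1 h2 h3 /=.
  rewrite (bigD1 ia) //= (bigD1 ib) /=; last by rewrite eq_sym.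
  have -> : \sum_(i < N | (i != ia) && (i != ib)) colour_step w z (recolour M1 c1) (recolour M2 c2) (recolour M3 c3) i * x i
      * colsum l i (recolour M1 c1) (recolour M2 c2) x
    = mask_form (fun a b c => if c then 0 else e a b x) (x ib) M1 M2 M3.
    transitivity (\sum_(i < N | (i != ia) && (i != ib)) (colour_step w z c1 c2 c3 i * x i)
       * mask_form (fun a b c => if c then 0 else g i false a b x) (x ib) M1 M2 M3).
      apply: eq_bigr => j /andP [ja jb]; congr (_ * _ * _).
        by rewrite /colour_step /link !recolour_ltn.
      have := gE j false M1 M2 x; rewrite /recolour /= /d (negPf ja) => -> //.
      by rewrite /mask_form /=; ring.
    rewrite /mask_form /= !mulr0 !addr0 /e !mulr_sumr -!big_split /=.
    by apply: eq_bigr => j _; ring.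
  have -> : colour_step w z (recolour M1 c1) (recolour M2 c2) (recolour M3 c3) ia = W.
    by rewrite /colour_step !recolour_ltn_l // recolour_link_l.
  have -> : colour_step w z (recolour M1 c1) (recolour M2 c2) (recolour M3 c3) ib
     = q ^+ (M1 + M2)%N * (if M3 then Z else W).
    rewrite /colour_step !recolour_ltn_r // recolour_link_r // addnACA exprD -mulrA.
    by case: M3 {h3}.
  have hA := gE ib true M1 M2 x; have hB := gE ib false M1 M2 x.
  rewrite /d eq_sym (negPf ab) in hA hB.
  rewrite {1}/recolour in hA; rewrite {1}/recolour in hB.
  rewrite hA // hB // -/h {hA hB}.
  have WE : M3 -> W = q ^+ ((c1 < ia) + (c2 < ia))%N * w.
    have baF : (ia.+1 < ia)%N = false by rewrite ltnNge leqnSn.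
    by move=> M3t; rewrite /W /link h3 // ib_succ baF.
  rewrite /mask_form.
  by case: M1 {h1}; case: M2 {h2}; case: M3 {h3 WE} => /=; ring.
- have Na : N != ia :> nat by rewrite neq_ltn ltn_ord orbT.
  have [g gs gE] := IH N c1 c2 Na c1a c2a.
  exists (fun U1 U2 U3 x => if U3 then 0 else g false U1 U2 x).
    by move=> U1 U2 [] x //; apply: gs.
  move=> M1 M2 M3 x h1 h2 h3 /=.
  have := gE false M1 M2 x; rewrite {1}/recolour => -> //.
  by rewrite /mask_form /=; ring.
Qed.

(** With all masks off only one symmetric coefficient of the mask form survives. *)
Lemma colsum_symm l c1 c2 c3 : c1 != ia :> nat -> c2 != ia :> nat -> c3 != ia :> nat ->
  swap_invariant (colsum l c1 c2 c3).
Proof.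
move=> h1 h2 h3 x; have [g gs gE] := colsum_mask_form l h1 h2 h3.
have E y : colsum l c1 c2 c3 y = g false false false y.
  by have := gE false false false y; rewrite /recolour => ->//; rewrite /mask_form /=; ring.
by rewrite !E gs.
Qed.

(** The mask form gives x_a (g0 + x_b g1) + x_b g0 = (x_a + x_b) g0 + x_a x_b g1 with symmetric g0
    and g1. *)
Lemma colsum_pair_symm l c1 c3 : c1 != ia :> nat -> c3 != ia :> nat ->
  swap_invariant (fun x => x ia * colsum l c1 ia c3 x + x ib * colsum l c1 ib c3 x).
Proof.
move=> h1 h3 x.
have h2 : ib != ia :> nat by rewrite ib_succ neq_ltn ltnSn orbT.
have [g gs gE] := colsum_mask_form l h1 h2 h3.
have EA y : colsum l c1 ia c3 y = g false false false y + y ib * g false true false y.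
  by have := gE false true false y; rewrite /recolour => ->//; rewrite /mask_form /=; ring.
have EB y : colsum l c1 ib c3 y = g false false false y.
  by have := gE false false false y; rewrite /recolour => ->//; rewrite /mask_form /=; ring.
rewrite !EA !EB !gs /sw tpermL tpermR; ring.
Qed.

Lemma colsum_pair_symm1 l c2 c3 : c2 != ia :> nat -> c3 != ia :> nat ->
  swap_invariant (fun x => x ia * colsum l ia c2 c3 x + x ib * colsum l ib c2 c3 x).
Proof.
move=> h1 h3 x.
have h2 : ib != ia :> nat by rewrite ib_succ neq_ltn ltnSn orbT.
have [g gs gE] := colsum_mask_form l h2 h1 h3.
have EA y : colsum l ia c2 c3 y = g false false false y + y ib * g true false false y.
  by have := gE true false false y; rewrite /recolour => ->//; rewrite /mask_form /=; ring.
have EB y : colsum l ib c2 c3 y = g false false false y.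
  by have := gE false false false y; rewrite /recolour => ->//; rewrite /mask_form /=; ring.
rewrite !EA !EB !gs /sw tpermL tpermR; ring.
Qed.

End Adjacent.
End Colourings.

(** * Walks in the Weyl chamber *)

Section Alternation.

Variables (R : comNzRingType) (N : nat).
Implicit Types (f g : ('I_N -> R) -> R) (x y : 'I_N -> R).

Definition alternation f x : R := \sum_(s : 'S_N) (-1) ^+ s * f (x \o s).

Lemma eq_alternation f g x : f =1 g -> alternation f x = alternation g x.
Proof. by move=> fg; apply: eq_bigr => s _; rewrite fg. Qed.

Lemma alternationD f g x :
  alternation (fun y => f y + g y) x = alternation f x + alternation g x.
Proof. by rewrite -big_split; apply: eq_bigr => s _; rewrite mulrDr. Qed.

Lemma alternationZ k f x : alternation (fun y => k * f y) x = k * alternation f x.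
Proof. by rewrite mulr_sumr; apply: eq_bigr => s _; rewrite mulrCA. Qed.

Lemma alternation_sum (I : Type) (r : seq I) (P : pred I) (F : I -> ('I_N -> R) -> R) x :
  alternation (fun y => \sum_(i <- r | P i) F i y) x = \sum_(i <- r | P i) alternation (F i) x.
Proof.
by rewrite exchange_big; apply: eq_bigr => s _; rewrite mulr_sumr.
Qed.

(** Matching even with odd permutations cancels the terms in pairs, which is valid also in rings
    where 2 is a zero divisor. *)
Lemma alternation_symm0 (ia ib : 'I_N) f x : ia != ib ->
  (forall y, f (y \o tperm ia ib) = f y) -> alternation f x = 0.
Proof.
move=> ab fs; rewrite /alternation (bigID (@odd_perm _)) /= addrC.
apply: canLR (subrK _) _; rewrite sub0r -sumrN (reindex_inj (mulgI (tperm ia ib))).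
apply: eq_big => [s|s]; first by rewrite odd_permM odd_tperm ab /= negbK.
rewrite odd_permM odd_tperm ab /= negbK => os; rewrite os expr0 expr1 mul1r mulN1r.
rewrite opprK -[RHS]fs; congr (f _); apply: funext => i /=.
by rewrite permM.
Qed.

End Alternation.

Section Chamber.

Variables (R : comNzRingType) (q : R) (N : nat) (x : 'I_N -> R).
Implicit Types (lam mu : nat -> nat) (l : seq (option (R * R))).

Definition shifted_monomial lam (y : 'I_N -> R) : R := \prod_(i < N) y i ^+ (lam i + (N - i.+1)).

Definition alternant lam : R := alternation (shifted_monomial lam) x.

Definition addcell lam (j : nat) : nat -> nat := fun i => (lam i + (i == j))%N.

Definition addable lam (j : nat) : bool := (j == 0) || (lam j < lam j.-1)%N.

Definition partf lam : Prop := forall i, (i.+1 < N)%N -> (lam i.+1 <= lam i)%N.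

(* Placing t in row [j] completes a 2 x 2 square with t - 2 below t - 3 and t - 1 to its right:
   the case of a southeast arrow from t - 3 to t. *)
Definition block lam (m1 m2 m3 j : nat) : bool :=
  [&& j == m3.+1, m2 == j, m1 == m3 & lam m3 == (lam j).+1].

(** A closed square has m3 < j, for which [link] would choose [z]; its southeast arrow makes the
    letter t - 3 precede t in the reading word, hence [w]. *)
Definition stdstep lam (w z : R) (m1 m2 m3 j : nat) : R :=
  q ^+ ((m1 < j) + (m2 < j))%N * (if block lam m1 m2 m3 j then w else link w z m3 j).

Fixpoint stdsum l lam (m1 m2 m3 : nat) : R :=
  match l with
  | [::] => alternant lam
  | None :: l' => stdsum l' lam N m1 m2
  | Some (w, z) :: l' =>
      \sum_(j < N | addable lam j)
         stdstep lam w z m1 m2 m3 j * stdsum l' (addcell lam j) j m1 m2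
  end.

Definition alternated_colsum l lam (m1 m2 m3 : nat) : R :=
  alternation (fun y => shifted_monomial lam y * colsum q l m1 m2 m3 y) x.

Lemma addcellC lam i j : addcell (addcell lam i) j = addcell (addcell lam j) i.
Proof. by apply: funext => k; rewrite /addcell addnAC. Qed.

Lemma mono_addcell lam (j : 'I_N) y : shifted_monomial (addcell lam j) y = y j * shifted_monomial lam y.
Proof.
rewrite /shifted_monomial (bigD1 j) //= [in RHS](bigD1 j) //= mulrA -exprS; congr (_ * _).
  by rewrite /addcell eqxx addnAC addn1.
by apply: eq_bigr => i ij; rewrite /addcell -[_ == _ :> nat]/(i == j) (negPf ij) addn0.
Qed.

Lemma alternated_nil lam m1 m2 m3 : alternated_colsum [::] lam m1 m2 m3 = alternant lam.
Proof. by apply: eq_alternation => y /=; rewrite mulr1. Qed.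

Lemma alternated_cons w z l lam m1 m2 m3 :
  alternated_colsum (Some (w, z) :: l) lam m1 m2 m3 =
  \sum_(j < N) colour_step q w z m1 m2 m3 j * alternated_colsum l (addcell lam j) j m1 m2.
Proof.
under [RHS]eq_bigr do rewrite -alternationZ.
rewrite -alternation_sum; apply: eq_alternation => y /=.
rewrite mulr_sumr; apply: eq_bigr => j _; rewrite mono_addcell; ring.
Qed.

(** On the wall the two exponents, shifted by the staircase, coincide. *)
Lemma mono_wall lam (ia ib : 'I_N) y : ib = ia.+1 :> nat -> lam ib = (lam ia).+1 ->
  shifted_monomial lam (y \o tperm ia ib) = shifted_monomial lam y.
Proof.
move=> ab lab; have hb := ltn_ord ib.
rewrite /shifted_monomial (reindex_inj (@perm_inj _ (tperm ia ib))) /=.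
apply: eq_bigr => i _; rewrite tpermK; congr (_ ^+ _).
by case: tpermP => [->|->|//]; lia.
Qed.

Lemma ord_succ_neq (ia ib : 'I_N) : ib = ia.+1 :> nat -> ia != ib.
Proof. by move=> ab; rewrite -val_eqE /= ab neq_ltn ltnSn. Qed.

Lemma alternated_wall l lam (a b : nat) m1 m2 m3 : (b < N)%N -> b = a.+1 -> lam b = (lam a).+1 ->
  m1 != a -> m2 != a -> m3 != a -> alternated_colsum l lam m1 m2 m3 = 0.
Proof.
move=> bN ab lab h1 h2 h3; have aN : (a < N)%N by lia.
pose ia := Ordinal aN; pose ib := Ordinal bN.
apply: (alternation_symm0 (ia := ia) (ib := ib)); first exact: ord_succ_neq.
move=> y; rewrite mono_wall //; congr (_ * _).
exact: (@colsum_symm _ q _ ia ib ab l _ _ _ h1 h2 h3 y).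
Qed.

(* On a wall the swap of [ia] and [ib] fixes the monomial, so a summand that is
   symmetric in these two variables contributes 0. *)
Lemma alternation_pair (ia ib : 'I_N) lam F G : ib = ia.+1 :> nat -> lam ib = (lam ia).+1 ->
  (forall y, y ib * F (y \o tperm ia ib) + y ia * G (y \o tperm ia ib) = y ia * F y + y ib * G y) ->
  alternation (fun y => shifted_monomial lam y * (y ia * F y)) x =
  - alternation (fun y => shifted_monomial lam y * (y ib * G y)) x.
Proof.
move=> ab lab FG; apply/eqP; rewrite -addr_eq0 -alternationD; apply/eqP.
apply: (alternation_symm0 x (ord_succ_neq ab)) => y.
by rewrite -!mulrDr mono_wall // /= tpermL tpermR FG.
Qed.

(** Row [a] costs [w] and row [b] costs [z]; they lead to the same sum with opposite signs, and
    every other row stays on the wall. The memory on the right is written as b, a, b because this is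
    where the legitimate walk through the same square arrives. *)
Lemma alternated_forbidden w z l lam (a b : nat) : (b < N)%N -> b = a.+1 -> lam b = (lam a).+1 ->
  alternated_colsum (Some (w, z) :: l) lam b b a = (w - z) * alternated_colsum l (addcell lam a) b a b.
Proof.
move=> bN ab lab; have aN : (a < N)%N by lia.
pose ia := Ordinal aN; pose ib := Ordinal bN.
have iab : ib = ia.+1 :> nat by [].
have ba : b != a by lia.
rewrite alternated_cons (bigD1 ia) //= (bigD1 ib) /=; last by rewrite eq_sym ord_succ_neq.
rewrite big1 ?addr0; last first.
  move=> j /andP [ja jb]; rewrite (@alternated_wall _ _ a b) ?mulr0 //.
    have -> : addcell lam j a = lam a by rewrite /addcell eq_sym -[j == a :> nat]/(j == ia) (negPf ja) addn0.
    by rewrite /addcell eq_sym -[j == b :> nat]/(j == ib) (negPf jb) addn0.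
rewrite /colour_step /link ab !ltnn ltnSn ltnNge leqnSn /= expr0 mul1r -ab.
pose g m1 m2 m3 : R := alternation (fun y => shifted_monomial lam y * (y ia * colsum q l m1 m2 m3 y)) x.
have bbb : alternated_colsum l (addcell lam b) b b b = - g b b b.
  rewrite /g (@alternation_pair ia ib lam _ (colsum q l b b b)) //.
    by rewrite opprK; apply: eq_alternation => y; rewrite (mono_addcell lam ib); ring.
  by move=> y; have := colsum_symm q (ia := ia) (ib := ib) iab l ba ba ba y => /= ->; ring.
have gE m1 m2 m3 : alternated_colsum l (addcell lam a) m1 m2 m3 = g m1 m2 m3.
  by apply: eq_alternation => y; rewrite (mono_addcell lam ia); ring.
(* Pair symmetry exchanges y_a F for y_b times the [colsum] with memory b, b, b, with a sign; [bbb]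
   exchanges y_b back for y_a with another sign. *)
have gb F : (forall y, y ib * F (y \o tperm ia ib) + y ia * colsum q l b b b (y \o tperm ia ib) = y ia * F y + y ib * colsum q l b b b y) ->
   alternation (fun y => shifted_monomial lam y * (y ia * F y)) x = g b b b.
  move=> h; rewrite (alternation_pair iab lab h) -[RHS]opprK -bbb; congr (- _).
  by apply: eq_alternation => y; rewrite (mono_addcell lam ib); ring.
have abb : g a b b = g b b b.
  by apply: gb => y; have := colsum_pair_symm1 q (ia := ia) (ib := ib) iab l ba ba y; rewrite tpermL tpermR.
have bab : g b a b = g b b b.
  by apply: gb => y; have := colsum_pair_symm q (ia := ia) (ib := ib) iab l ba ba y; rewrite tpermL tpermR.
by rewrite !gE bbb abb bab; ring.
Qed.

(** Knowing that the preceding shapes are partitions is what keeps the upper row of a wall out of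
    the memory, apart from the exceptional case. A letter of colour [N] adds no cell to the rows of
    index less than [N]. *)
Definition valid_state lam (m1 m2 m3 : nat) : Prop :=
  exists mu, [/\ partf mu, partf (addcell mu m3), partf (addcell (addcell mu m3) m2),
    partf lam & forall i, (i < N)%N -> lam i = addcell (addcell (addcell mu m3) m2) m1 i].

(* [colsum] weights the pair (t - 3, t) of a southeast arrow by its rows, [stdsum] by its
   arrow.  The difference is made up for one step earlier, by the walk of
   [alternated_forbidden], so that the two sums differ only half way through such a square. *)
Definition correction l lam (m1 m2 m3 : nat) : R :=
  if l is Some (w, z) :: l' then
    if [&& m2 == m3.+1, m1 == m3, (m2 < N)%N & lam m3 == (lam m2).+1]
    then q * (w - z) * stdsum l' (addcell lam m2) m2 m1 m2 else 0
  else 0.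

(** The two step weights differ only at the row that closes a square, where [w] replaces [z]; the
    factor q comes from m1 < j. *)
Lemma stdsum_correction w z l lam m1 m2 m3 :
  \sum_(j < N | addable lam j) colour_step q w z m1 m2 m3 j * stdsum l (addcell lam j) j m1 m2
  = stdsum (Some (w, z) :: l) lam m1 m2 m3 - correction (Some (w, z) :: l) lam m1 m2 m3.
Proof.
rewrite /correction /=; case: ifP => [/and4P[/eqP e2 /eqP e1 bN /eqP elam]|C].
  pose ib := Ordinal bN.
  have ad : addable lam ib by rewrite /addable /= {3}e2 /= elam ltnSn orbT.
  rewrite (bigD1 ib) //= [in RHS](bigD1 ib) //= addrAC; congr (_ + _).
    rewrite /colour_step /stdstep /block e2 e1 !eqxx -e2 elam eqxx /= /link e2 ltnSn !ltnn /=.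
    by rewrite expr1; ring.
  apply: eq_bigr => j /andP [_ jb]; rewrite /stdstep /colour_step /block.
  case: ifP => // /and4P[/eqP j3 /eqP j2 _ _].
  by move: jb; rewrite -val_eqE /= j2 eqxx.
rewrite subr0; apply: eq_bigr => j _; rewrite /stdstep /colour_step /block.
case: ifP => // /and4P[/eqP j3 /eqP j2 /eqP j1 l3]; move: C.
by rewrite j2 j3 j1 -j3 ltn_ord !eqxx l3.
Qed.

Lemma valid_add lam m1 m2 m3 (j : 'I_N) : valid_state lam m1 m2 m3 -> addable lam j ->
  valid_state (addcell lam j) j m1 m2.
Proof.
move=> [mu [p0 p1 p2 p lamE]] ad; exists (addcell mu m3); split=> //.
- by move=> i iN; rewrite -!lamE ?p //; lia.
- move=> i iN; have := p i iN; rewrite /addcell.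
  case: (eqVneq i.+1 j) => [e _|_ h]; last by rewrite addn0 (leq_trans h) ?leq_addr.
  by move: ad; rewrite /addable -e /=; lia.
by move=> i iN; rewrite /addcell lamE.
Qed.

Lemma valid_none lam m1 m2 m3 : valid_state lam m1 m2 m3 -> valid_state lam N m1 m2.
Proof.
move=> [mu [p0 p1 p2 p lamE]]; exists (addcell mu m3); split=> //.
  by move=> i iN; rewrite -!lamE ?p //; lia.
by move=> i iN; rewrite lamE // [RHS]/addcell (ltn_eqF iN) addn0.
Qed.

Lemma partf_addable lam (j : nat) : partf lam -> (j < N)%N -> ~~ addable lam j ->
  exists a, j = a.+1 /\ lam j = lam a.
Proof.
move=> p; case: j => [|a] jN; rewrite /addable //= -leqNgt => h.
by exists a; split=> //; apply/eqP; rewrite eqn_leq h p.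
Qed.

(** The induction is on the length, because the exceptional step is resolved only after two
    letters. *)
Lemma alternated_stdsum l lam m1 m2 m3 : valid_state lam m1 m2 m3 ->
  alternated_colsum l lam m1 m2 m3 = stdsum l lam m1 m2 m3 - correction l lam m1 m2 m3.
Proof.
have [k] := ubnP (size l); elim: k l lam m1 m2 m3 => // k IH [|[[w z]|] l] lam m1 m2 m3 sl v.
- by rewrite alternated_nil subr0.
- rewrite -stdsum_correction alternated_cons [RHS]big_mkcond /=; apply/eqP.
  rewrite -subr_eq0 -sumrB; apply/eqP.
  have [mu [p0 p1 p2 p lamE]] := v.
  (* Outside the exceptional configuration the two sides agree row by row: an addable row leaves no
     correction, any other row hits a wall. *)
  have nonX (j : 'I_N) : ~~ [&& m1 == m2.+1, (m1 < N)%N, lam m1 == lam m2 & (j == m1 :> nat) || (j == m2 :> nat)] ->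
     colour_step q w z m1 m2 m3 j * alternated_colsum l (addcell lam j) j m1 m2 -
     (if addable lam j then colour_step q w z m1 m2 m3 j * stdsum l (addcell lam j) j m1 m2 else 0) = 0.
    move=> C; case: ifP => [ad|/negbT nad].
      rewrite IH //; last exact: valid_add v ad.
      suff -> : correction l (addcell lam j) j m1 m2 = 0 by rewrite subr0 subrr.
      rewrite /correction; case: l {sl} => [//|[[w' z']|//] l]; case: ifP => // /and4P[/eqP e1 /eqP e2 m1N e3].
      case/negP: C; rewrite e1 eqxx -e1 m1N e2 eqxx orbT /= andbT.
      move: e3; rewrite /addcell -e2 eqxx e1 -e2 (gtn_eqF (ltnSn _)); lia.
    have [a [ja la]] := partf_addable p (ltn_ord j) nad; have jN := ltn_ord j; have jN' := jN.
    have aN : (a < N)%N by lia.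
    have lj := lamE _ jN; have la' := lamE _ aN; rewrite ja in jN lj.
    rewrite subr0 (@alternated_wall _ _ a j) ?mulr0 //; last 1 first.
    + apply: contraNneq C => m2a.
      (* Otherwise removing the last two cells would leave row [j] longer than row [a], although
         that earlier shape is a partition. *)
      have m1j : m1 = j.
        have := p1 a jN; move: lj la' la; rewrite m2a ja /addcell eqxx (gtn_eqF (ltnSn a)).
        by case: (eqVneq m1 a.+1) => //; lia.
      by rewrite m2a m1j la ja !eqxx -ja jN'.
    + by rewrite /addcell eqxx la ja; lia.
    + by rewrite ja; lia.
    apply/eqP => m1a; have := p2 a jN; move: lj la' la.
    by rewrite m1a ja /addcell; lia.
  have [/and3P[/eqP m12 m1N /eqP lam12]|C] := boolP [&& m1 == m2.+1, (m1 < N)%N & lam m1 == lam m2]; last first.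
    apply: big1 => j _; apply: nonX; apply: contra C.
    by move=> /and4P[-> -> -> _].
  have m2N : (m2 < N)%N by lia.
  pose ib := Ordinal m1N; pose ia := Ordinal m2N.
  have iab : ib = ia.+1 :> nat by [].
  rewrite (bigD1 ib) //= (bigD1 ia) /=; last exact: ord_succ_neq.
  rewrite big1 ?addr0; last first.
    move=> j /andP [jb ja]; apply: nonX.
    by rewrite -[j == m1 :> nat]/(j == ib) -[j == m2 :> nat]/(j == ia) (negPf ja) (negPf jb) !andbF.
  have -> : addable lam m1 = false by rewrite /addable m12 /= -m12 lam12 ltnn.
  (* The rows are adjacent and [m3] is not the upper one, so both compare alike with [m3]; the
     additional q records m2 < m1. *)
  have stE : colour_step q w z m1 m2 m3 m1 = q * colour_step q w z m1 m2 m3 m2.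
    have m32 : m3 != m2.
      apply/eqP => m32; have m1N' := m1N; rewrite m12 in m1N'; have := p0 m2 m1N'.
      by have := lamE _ m1N; have := lamE _ m2N; move: lam12; rewrite m32 m12 /addcell; lia.
    have -> : colour_step q w z m1 m2 m3 m2 = link w z m3 m2.
      by rewrite /colour_step ltnn m12 ltnNge leqnSn mul1r.
    rewrite /colour_step ltnn {1}m12 ltnSn expr1 /link; congr (q * (if _ then _ else _)).
    by rewrite m12 ltnS leq_eqVlt (negPf m32).
  rewrite stE subr0.
  have lamb : addcell lam m1 m1 = (addcell lam m1 m2).+1.
    by rewrite /addcell eqxx lam12; lia.
  have wallb l' c1 c2 c3 : c1 != m2 -> c2 != m2 -> c3 != m2 -> alternated_colsum l' (addcell lam m1) c1 c2 c3 = 0.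
    exact: (alternated_wall _ m1N m12 lamb).
  have m12n : m1 != m2 by lia.
  (* If no letter follows at once, the oldest memory entry [m2] is lost before it can be compared,
     and the wall applies. *)
  have corN l' : ~~ (if l' is Some _ :: _ then true else false) ->
    alternated_colsum l' (addcell lam m1) m1 m1 m2 = 0.
    case: l' => [|[//|] l'] _; first by rewrite alternated_nil -(alternated_nil _ m1 m1 m1) wallb.
    by rewrite -[LHS]/(alternated_colsum l' (addcell lam m1) N m1 m1) wallb //; lia.
  (* If [m2] is addable, the correction left by the step to [m2] cancels the forbidden step to
     [m1]. *)
  have [ad|nad] := boolP (addable lam m2).
    rewrite [X in _ + (_ * X - _)]IH //; last exact: (valid_add (j := ia) v).
    rewrite mulrBr [X in _ + X]addrAC subrr sub0r.
    have [cN|] := boolP (~~ (if l is Some _ :: _ then true else false)).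
      rewrite corN // mulr0; case: l sl cN {nonX} => [|[//|] l] _ _;
        by rewrite /= mulr0 oppr0 addr0.
    rewrite negbK; case: l sl {nonX} => [//|[[w' z']|//] l] sl _.
    rewrite (alternated_forbidden _ _ _ m1N m12 lamb) IH; last 2 first.
    + by move: sl => /=; lia.
    + rewrite addcellC; apply: (valid_add (j := ib)); first exact: (valid_add (j := ia) v).
      by rewrite /addable /= /addcell m12 /= -m12 eqxx lam12; lia.
    have -> : correction l (addcell (addcell lam m1) m2) m1 m2 m1 = 0.
      rewrite /correction; case: l {sl} => [//|[[w2 z2]|//] l]; case: ifP => //; lia.
    rewrite /correction m12 !eqxx -m12 m1N /addcell eqxx lam12 eq_sym (negPf m12n) addn0 addn1 eqxx /=.
    rewrite -![fun i => _]/(addcell _ _) addcellC; ring.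
  (* If [m2] is not addable either, both contributions vanish on the wall above row [m2]. *)
  have [a [m2a la]] := partf_addable p m2N nad.
  have lama : addcell lam m2 m2 = (addcell lam m2 a).+1.
    by rewrite /addcell eqxx la m2a; lia.
  rewrite subr0 [X in _ + _ * X](alternated_wall _ m2N m2a lama) ?mulr0 ?addr0; [|lia|lia|lia].
  have [cN|] := boolP (~~ (if l is Some _ :: _ then true else false)).
    by rewrite corN // mulr0.
  rewrite negbK; case: l sl {nonX} => [//|[[w' z']|//] l] sl _.
  rewrite (alternated_forbidden _ _ _ m1N m12 lamb) (alternated_wall _ m2N m2a) ?mulr0 //; try lia.
  by rewrite /addcell eqxx la; lia.
- rewrite /= subr0 -[LHS]/(alternated_colsum l lam N m1 m2) IH //; last exact: valid_none v.
  rewrite /correction; case: l {sl} => [|[[w z]|] l]; rewrite ?subr0 //.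
  by case: ifP; rewrite ?subr0 //; lia.
Qed.

End Chamber.

(** * Alternants and Schur polynomials *)

Section Bialternant.

Variables (R : comNzRingType) (x : nat -> R).

Definition powdet (n : nat) (e : nat -> nat) : R :=
  \det (\matrix_(i < n, j < n) x j ^+ e i).

Lemma det_sum_rows (n K : nat) (P : 'I_n -> pred 'I_K) (f : 'I_n -> 'I_K -> R) (g : 'I_n -> 'I_K -> nat) :
  \det (\matrix_(i < n, j < n) \sum_(v < K | P i v) f i v * x j ^+ g i v) =
  \sum_(mu : {ffun 'I_n -> 'I_K} | [forall i, P i (mu i)])
     (\prod_i f i (mu i)) * \det (\matrix_(i < n, j < n) x j ^+ g i (mu i)).
Proof.
rewrite /determinant.
under eq_bigr => s _.
  under eq_bigr => i _ do rewrite mxE.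
  rewrite bigA_distr_big_dep mulr_sumr.
  over.
rewrite exchange_big /=; apply: eq_big => [mu|mu _].
  by apply/familyP/forallP.
rewrite mulr_sumr; apply: eq_bigr => s _.
rewrite big_split /= mulrCA; congr (_ * (_ * _)).
by apply: eq_bigr => i _; rewrite mxE.
Qed.

Lemma det_scale_cols (n : nat) (A : 'M[R]_n) (k : 'I_n -> R) :
  \det (\matrix_(i, j) (k j * A i j)) = (\prod_j k j) * \det A.
Proof.
rewrite mulrC -[\prod_j k j](_ : \det (diag_mx (\row_j k j)) = _); last first.
  by rewrite det_diag; apply: eq_bigr => i _; rewrite mxE.
rewrite -det_mulmx; congr (\det _); apply/matrixP => i j.
by rewrite mul_mx_diag !mxE mulrC.
Qed.

Lemma geometric_window (W a b : nat) (y z : R) : (a <= b.+1)%N -> (b <= W)%N ->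
  y ^+ b.+1 - z ^+ (b.+1 - a) * y ^+ a =
  (y - z) * \sum_(v < W.+1 | (a <= v <= b)%N) z ^+ (b - v) * y ^+ v.
Proof.
move=> ab bW.
have -> : \sum_(v < W.+1 | (a <= v <= b)%N) z ^+ (b - v) * y ^+ v =
   \sum_(a <= v < b.+1) z ^+ (b - v) * y ^+ v.
  rewrite big_geq_mkord /= (big_ord_widen_cond W.+1 (fun v => a <= v)%N (fun v => z ^+ (b - v) * y ^+ v)) //.
have := telescope_sumr (fun v => z ^+ (b.+1 - v) * y ^+ v) ab.
rewrite subnn mul1r => <-; rewrite mulr_sumr; apply: eq_big_nat => v /andP [_ vb].
by rewrite subSS subSn // !exprS; ring.
Qed.

(** Subtracting from each row the multiple of the next one that kills its last entry leaves a minor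
    whose column j is divisible by x_j - x_n. The quotients are geometric sums over lam_(i+1) <= v
    <= lam_i, so expanding the minor row by row produces the interlacing sequences. *)
Lemma powdetS (n W : nat) (lam : nat -> nat) :
  (forall i, lam i <= W)%N -> (forall i, (i < n)%N -> (lam i.+1 <= lam i)%N) ->
  powdet n.+1 (fun i => lam i + (n.+1 - i.+1))%N =
  (\prod_(j < n) (x j - x n)) *
  \sum_(mu : {ffun 'I_n -> 'I_W.+1} | [forall i : 'I_n, (lam i.+1 <= mu i <= lam i)%N])
     x n ^+ (lam n + \sum_(i < n) (lam i - mu i))%N *
     powdet n (fun i => (if insub i is Some i' then mu i' : nat else 0) + (n - i.+1))%N.
Proof.
move=> lamW lamS; pose e i := (lam i + (n - i))%N.
pose M : 'M[R]_n.+1 := \matrix_(i, j) x j ^+ e i.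
(* The row operations as a unitriangular matrix, so the determinant is unchanged. *)
pose C : 'M[R]_n.+1 := \matrix_(i, j) ((i == j)%:R - (j == i.+1 :> nat)%:R * x n ^+ (e i - e i.+1)).
have detC : \det C = 1.
  rewrite -det_tr det_trig; last first.
    apply/is_trig_mxP => i j ij; rewrite !mxE (ltn_eqF (leqW ij)) mul0r subr0.
    by rewrite -val_eqE /= (gtn_eqF ij).
  by rewrite big1 // => i _; rewrite !mxE eqxx (ltn_eqF (ltnSn _)) mul0r subr0.
have BE i j : (C *m M) i j = x j ^+ e i - (i < n)%N%:R * (x n ^+ (e i - e i.+1) * x j ^+ e i.+1).
  rewrite mxE; under eq_bigr do rewrite !mxE mulrBl.
  rewrite sumrB (bigD1 i) //= eqxx mul1r big1 ?addr0; last first.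
    by move=> k ki; rewrite eq_sym (negPf ki) mul0r.
  congr (_ - _); case: (ltnP i n) => ni; last first.
    rewrite mul0r big1 // => k _; rewrite (ltn_eqF _) ?mul0r //.
    by have := ltn_ord k; lia.
  have ni' : (i.+1 < n.+1)%N by [].
  rewrite (bigD1 (Ordinal ni')) //= eqxx !mul1r big1 ?addr0 // => k.
  by rewrite -val_eqE /= => /negPf ->; rewrite !mul0r.
have -> : powdet n.+1 (fun i => lam i + (n.+1 - i.+1))%N = \det (C *m M).
  by rewrite det_mulmx detC mul1r; congr (\det _); apply/matrixP => i j; rewrite !mxE subSS.
rewrite (expand_det_col _ ord_max) (bigD1 ord_max) //= big1 ?addr0; last first.
  move=> i ni; rewrite BE /=.
  have -> : (i < n)%N by move: ni; rewrite -val_eqE /=; have := ltn_ord i; lia.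
  rewrite mul1r -exprD subnK ?subrr ?mul0r //.
  move: ni (ltn_ord i); rewrite -val_eqE /= /e => ni i1.
  have ni' : (i < n)%N by lia.
  by have := lamS i ni'; lia.
rewrite /cofactor /= addnn -mul2n exprM sqrrN expr1n expr1n mul1r.
have -> : row' ord_max (col' ord_max (C *m M)) =
   \matrix_(i < n, j < n) ((x j - x n) *
      (\matrix_(i < n, j < n) \sum_(v < W.+1 | (lam i.+1 <= v <= lam i)%N)
          x n ^+ (lam i - v) * x j ^+ (v + (n - i.+1))) i j).
  apply/matrixP => i j; rewrite 2!mxE [LHS]BE !mxE /= /bump.
  have -> : (n <= i)%N = false by rewrite leqNgt ltn_ord.
  have -> : (n <= j)%N = false by rewrite leqNgt ltn_ord.
  rewrite !add0n ltn_ord mul1r.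
  have hl := lamS i (ltn_ord i); have hi := ltn_ord i.
  under eq_bigr do rewrite exprD mulrA.
  rewrite -mulr_suml mulrA -geometric_window //; last exact: leqW.
  rewrite mulrBl -exprD -mulrA -exprD.
  congr (x j ^+ _ - x n ^+ _ * x j ^+ _); rewrite /e; move: hl hi;
    by move: (lam i.+1) (lam i) (nat_of_ord i) => /= u v k; lia.
rewrite det_scale_cols (det_sum_rows (fun i v => lam i.+1 <= v <= lam i)%N (fun i v => x n ^+ (lam i - v))).
rewrite BE /= ltnn mul0r subr0 mulrCA; congr (_ * _).
rewrite mulr_sumr; apply: eq_bigr => mu _.
rewrite mulrA /e subnn addn0 exprD expr_sum; congr (_ * _).
congr (\det _); apply/matrixP => i j; rewrite !mxE; congr (_ ^+ (_ + _)).
by case: insubP => [i' _ /val_inj ->|]; rewrite ?ltn_ord.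
Qed.

End Bialternant.

(** * Branching of semistandard fillings *)

Section Semistandard.

Variables (R : comNzRingType) (x : nat -> R) (M W : nat).
Implicit Types (T : {ffun 'I_M * 'I_W -> 'I_M.+1}) (lam : nat -> nat) (z : 'I_M * 'I_W).

(* Fillings of [lam] are extended by [M] outside of [lam], so that the fillings
   of all shapes in the M x W box live in one finite type. *)
Definition ssfill (n : nat) lam T : bool :=
  [forall z : 'I_M * 'I_W, if (z.2 < lam z.1)%N then (T z < n)%N else T z == ord_max] &&
  [forall z : 'I_M * 'I_W, forall z' : 'I_M * 'I_W,
     ((z.1 == z'.1) && (z.2 < z'.2)%N ==> (T z <= T z')%N) &&
     ([&& z.2 == z'.2, (z.1 < z'.1)%N & (z'.2 < lam z'.1)%N] ==> (T z < T z')%N)].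

Definition sssum (n : nat) lam : R :=
  \sum_(T | ssfill n lam T) \prod_(z : 'I_M * 'I_W | (z.2 < lam z.1)%N) x (T z).

Definition extend_rows (n : nat) (mu : {ffun 'I_n -> 'I_W.+1}) (i : nat) : nat :=
  if insub i is Some i' then mu i' : nat else 0.

Lemma ssfillP n lam T : reflect
  [/\ forall z : 'I_M * 'I_W, (z.2 < lam z.1)%N -> (T z < n)%N,
      forall z : 'I_M * 'I_W, (lam z.1 <= z.2)%N -> T z = ord_max,
      forall i (c c' : 'I_W), (c <= c')%N -> (T (i, c) <= T (i, c'))%N &
      forall (i i' : 'I_M) (c : 'I_W), (i < i')%N -> (c < lam i')%N -> (T (i, c) < T (i', c))%N]
  (ssfill n lam T).
Proof.
apply: (iffP andP) => [[/forallP h1 /forallP h2]|[h1 h2 h3 h4]]; split.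
- by move=> z hz; have := h1 z; rewrite hz.
- by move=> z; rewrite leqNgt => /negPf hz; have := h1 z; rewrite hz => /eqP.
- move=> i c c'; rewrite leq_eqVlt => /orP [/eqP/val_inj -> //|cc].
  by have /forallP /(_ (i, c')) := h2 (i, c); rewrite /= eqxx cc /= => /andP [].
- move=> i i' c ii cl.
  by have /forallP /(_ (i', c)) := h2 (i, c); rewrite /= eqxx ii cl /= => /andP [].
- apply/forallP => z; case: ltnP => [/h1|/h2 ->] //.
apply/forallP => -[i c]; apply/forallP => -[i' c'] /=.
apply/andP; split; apply/implyP.
  by case/andP => /eqP <- /ltnW; apply: h3.
by case/and3P => /eqP <-; apply: h4.
Qed.

Lemma sssum_eq n lam lam' : (forall i, (i < M)%N -> lam i = lam' i) -> sssum n lam = sssum n lam'.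
Proof.
move=> e; apply: eq_big => [T|T _]; last by apply: eq_bigl => z; rewrite e.
rewrite /ssfill; congr (_ && _); first by apply: eq_forallb => z; rewrite e.
by apply: eq_forallb => z; apply: eq_forallb => z'; rewrite e.
Qed.

Lemma sssum0 : sssum 0 (fun=> 0%N) = 1.
Proof.
rewrite /sssum (eq_bigl (pred1 [ffun=> ord_max])) ?big_pred1_eq ?big_pred0 // => T.
apply/ssfillP/eqP => [[_ h _ _]|->]; first by apply/ffunP => z; rewrite ffunE h.
by split=> // [z _|i c c' _]; rewrite !ffunE.
Qed.

Lemma prod_interval (k : R) (a b : nat) : (b <= W)%N ->
  \prod_(c < W | (a <= c < b)%N) k = k ^+ (b - a).
Proof.
move=> bW; rewrite -prodr_const_nat big_geq_mkord /= (big_ord_widen_cond W) //.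
Qed.

Lemma ltn_row_count (P : pred 'I_W) :
  (forall c c' : 'I_W, (c <= c')%N -> P c' -> P c) ->
  forall c : 'I_W, P c = (c < #|P|)%N.
Proof.
move=> down c; apply/idP/idP => [Pc|].
  have sub : [pred c' : 'I_W | (c' < c.+1)%N] \subset P.
    by apply/fintype.subsetP => c'; rewrite inE ltnS => /down; apply.
  have := subset_leq_card sub; congr (_ <= _)%N.
  rewrite -sum1_card (eq_bigl (fun c' : 'I_W => (c' < c.+1)%N)) //.
  by rewrite -(big_ord_widen W (fun=> 1%N)) ?ltn_ord // sum1_card card_ord.
apply: contraTT => nPc; rewrite -leqNgt.
have sub : P \subset [pred c' : 'I_W | (c' < c)%N].
  apply/fintype.subsetP => c' Pc'; rewrite inE ltnNge; apply: contra nPc => /down; exact.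
have := subset_leq_card sub; congr (_ <= _)%N.
rewrite -sum1_card (eq_bigl (fun c' : 'I_W => (c' < c)%N)) //.
by rewrite -(big_ord_widen W (fun=> 1%N)) ?(ltnW (ltn_ord c)) // sum1_card card_ord.
Qed.

Lemma extend_small n (mu : {ffun 'I_n -> 'I_W.+1}) i : (n <= i)%N -> extend_rows mu i = 0%N.
Proof. by move=> ni; rewrite /extend_rows insubF // ltnNge ni. Qed.

Lemma extend_ord n (mu : {ffun 'I_n -> 'I_W.+1}) (i : 'I_n) : extend_rows mu i = mu i.
Proof. by rewrite /extend_rows; case: insubP => [i' _ /val_inj ->|]; rewrite ?ltn_ord. Qed.

Section Branching.

Variables (n : nat) (lam : nat -> nat).
Hypotheses (nM : (n < M)%N) (lamW : forall i, (lam i <= W)%N).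
Hypotheses (lamS : forall i, (lam i.+1 <= lam i)%N) (lam0 : forall i, (n < i)%N -> lam i = 0%N).

Let interlaced (mu : {ffun 'I_n -> 'I_W.+1}) := [forall i : 'I_n, (lam i.+1 <= mu i <= lam i)%N].

Let low T (i : 'I_n) : pred 'I_W := fun c => (T (widen_ord (ltnW nM) i, c) < n)%N.

Let restr T : {ffun 'I_n -> 'I_W.+1} * {ffun 'I_M * 'I_W -> 'I_M.+1} :=
  ([ffun i => inord #|low T i|], [ffun z => if (T z < n)%N then T z else ord_max]).

Let fill (p : {ffun 'I_n -> 'I_W.+1} * {ffun 'I_M * 'I_W -> 'I_M.+1}) : {ffun 'I_M * 'I_W -> 'I_M.+1} :=
  [ffun z : 'I_M * 'I_W => if (extend_rows p.1 z.1 <= z.2 < lam z.1)%N then inord n else p.2 z].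

Lemma lam_le i j : (i <= j)%N -> (lam j <= lam i)%N.
Proof.
apply: (@homo_leq _ lam (fun a b => b <= a)%N) => // a b c ba cb.
exact: leq_trans cb ba.
Qed.

Lemma interlaced_le mu i : interlaced mu -> (extend_rows mu i <= lam i)%N.
Proof.
move=> /forallP h; case: (ltnP i n) => [ni|/extend_small -> //].
by rewrite -[i]/(nat_of_ord (Ordinal ni)) extend_ord; have /andP [] := h (Ordinal ni).
Qed.

Lemma interlaced_ge mu i : interlaced mu -> (lam i.+1 <= extend_rows mu i)%N.
Proof.
move=> /forallP h; case: (ltnP i n) => [ni|ni]; last by rewrite lam0 // ltnS.
by rewrite -[i]/(nat_of_ord (Ordinal ni)) extend_ord; have /andP [] := h (Ordinal ni).
Qed.

(** Weakly increasing rows make the entries below [n] initial segments, and strict columns allow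
    only one [n] per column, which is the interlacing condition. *)
Lemma restr_spec T : ssfill n.+1 lam T ->
  [/\ forall z : 'I_M * 'I_W, (T z < n)%N = (z.2 < extend_rows (restr T).1 z.1)%N,
      interlaced (restr T).1 & ssfill n (extend_rows (restr T).1) (restr T).2].
Proof.
move=> /ssfillP [h1 h2 h3 h4].
have lowE z : (T z < n)%N = (z.2 < extend_rows (restr T).1 z.1)%N.
  case: z => i c /=; case: (ltnP i n) => [ni|ni].
    pose i' := Ordinal ni; have -> : i = widen_ord (ltnW nM) i' by apply: val_inj.
    rewrite extend_ord ffunE inordK; last by rewrite ltnS (leq_trans (max_card _)) ?card_ord.
    rewrite -(ltn_row_count (P := low T i')) // => c1 c2 cc; apply: leq_ltn_trans.
    exact: h3.
  rewrite extend_small // ltn0; apply/negbTE; rewrite -leqNgt.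
  (* Strict columns force entries of at least k from row k on, so no entry below [n] occurs in row
     [n] or further south. *)
  have low_row (k : nat) (i0 : 'I_M) : (k <= i0)%N -> (k <= n)%N -> (k <= T (i0, c))%N.
    elim: k i0 => // k IHk i0 ki kn.
    have k0M : (k < M)%N by apply: leq_ltn_trans nM; apply: ltnW.
    case: (ltnP c (lam i0)) => [cl|/(h2 (i0, c)) -> /=]; last by apply: leq_trans kn (ltnW nM).
    exact: leq_ltn_trans (IHk (Ordinal k0M) (leqnn k) (ltnW kn)) (h4 (Ordinal k0M) i0 c ki cl).
  exact: low_row.
have inlam z : (T z < n)%N -> (z.2 < lam z.1)%N.
  by move=> h; rewrite ltnNge; apply/negP => /h2 Tz; move: h; rewrite Tz /= ltnNge ltnW.
split=> //.
  apply/forallP => i; apply/andP; split.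
    rewrite leqNgt; apply/negP => hi.
    have cW : (extend_rows (restr T).1 i < W)%N.
      by rewrite extend_ord; apply: leq_trans hi (lamW _).
    have iM : (i.+1 < M)%N by apply: leq_ltn_trans nM.
    have := lowE (widen_ord (ltnW nM) i, Ordinal cW); rewrite /= ltnn => /negbT; rewrite -leqNgt => nT.
    rewrite -extend_ord in hi.
    have := h4 (widen_ord (ltnW nM) i) (Ordinal iM) (Ordinal cW) (ltnSn i) hi.
    rewrite ltnNge => /negP; apply; apply: leq_trans nT.
    by have := h1 (Ordinal iM, Ordinal cW) hi; rewrite ltnS.
  rewrite leqNgt; apply/negP => hi.
  have cW : (lam i < W)%N by apply: leq_trans hi _; rewrite -ltnS.
  rewrite -extend_ord in hi.
  have := lowE (widen_ord (ltnW nM) i, Ordinal cW); rewrite /= hi => /inlam /=.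
  by rewrite ltnn.
apply/ssfillP; split.
- by move=> z; rewrite -lowE ffunE => h; rewrite h.
- by move=> z; rewrite leqNgt -lowE ffunE => /negPf ->.
- move=> i c c' cc; rewrite !ffunE; have := h3 i c c' cc.
  case: (ltnP (T (i, c')) n) => [h hc|_ _]; first by rewrite (leq_ltn_trans hc h).
  by case: ifP => _ //=; rewrite -ltnS.
move=> i i' c ii; rewrite -[(c < _)%N]/((i', c).2 < extend_rows _ (i', c).1)%N -lowE !ffunE => h; rewrite h.
have := h4 i i' c ii (inlam _ h) => hT.
by rewrite (ltn_trans hT h).
Qed.

Lemma fill_spec mu T : interlaced mu -> ssfill n (extend_rows mu) T ->
  ssfill n.+1 lam (fill (mu, T)) /\ restr (fill (mu, T)) = (mu, T).
Proof.
move=> hmu /ssfillP [h1 h2 h3 h4].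
have mul i := interlaced_le i hmu; have muS i := interlaced_ge i hmu.
have inn : (inord n : 'I_M.+1) = n :> nat by rewrite inordK // ltnS ltnW.
have fillE z : fill (mu, T) z = (if (z.2 < extend_rows mu z.1)%N then T z
    else if (z.2 < lam z.1)%N then inord n else ord_max) :> nat.
  rewrite ffunE /=; case: (ltnP z.2 (extend_rows mu z.1)) => h //=.
  by case: ifP => // _; rewrite h2.
have fill_low z : (fill (mu, T) z < n)%N = (z.2 < extend_rows mu z.1)%N.
  rewrite fillE; case: (ltnP z.2 (extend_rows mu z.1)) => h; first by rewrite h1.
  by case: ifP => _; rewrite ?inn ?ltnn //= ltnNge ltnW.
split.
  apply/ssfillP; split.
  - move=> z zl; rewrite fillE zl; case: ifP => [/h1 /ltnW //|_].
    by rewrite inn.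
  - move=> z zl; apply: val_inj; rewrite /= fillE !ltnNge zl /=.
    by rewrite (leq_trans (mul _) zl).
  - move=> i c c' cc; rewrite !fillE /=.
    case: (ltnP c' (extend_rows mu i)) => [c'l|c'l].
      by rewrite (leq_ltn_trans cc c'l); apply: h3.
    case: (ltnP c (extend_rows mu i)) => [cl|cl].
      have := h1 (i, c) cl => /= hT.
      by case: ifP => _; rewrite ?inn /= ?(ltnW hT) // (leq_trans (ltnW hT)) // ltnW.
    case: (ltnP c' (lam i)) => [c'l'|_]; first by rewrite (leq_ltn_trans cc c'l').
    by case: ifP => _; rewrite //= inn ltnW.
  move=> i i' c ii cl; rewrite !fillE /= cl.
  have ci : (c < extend_rows mu i)%N.
    apply: leq_trans (muS i); apply: leq_trans cl _; exact: lam_le.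
  rewrite ci; case: (ltnP c (extend_rows mu i')) => [c'l|_]; first exact: h4.
  by rewrite inn; apply: (h1 (i, c)).
congr (_, _).
  apply/ffunP => i; apply: val_inj; rewrite ffunE /= inordK; last first.
    by rewrite ltnS (leq_trans (max_card _)) ?card_ord.
  rewrite -sum1_card (eq_bigl (fun c : 'I_W => (c < mu i)%N)); last first.
    by move=> c; rewrite -topredE /= /low fill_low /= extend_ord.
  by rewrite -(big_ord_widen W (fun=> 1%N)) ?sum1_card ?card_ord // -ltnS.
apply/ffunP => z; rewrite ffunE fill_low; apply: val_inj; case: ifP => h /=; last first.
  by rewrite h2 // leqNgt h.
by rewrite fillE h.
Qed.

Lemma sssumS :
  sssum n.+1 lam =
  \sum_(mu : {ffun 'I_n -> 'I_W.+1} | [forall i : 'I_n, (lam i.+1 <= mu i <= lam i)%N])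
     x n ^+ (lam n + \sum_(i < n) (lam i - mu i))%N * sssum n (extend_rows mu).
Proof.
rewrite /sssum.
under [RHS]eq_bigr do rewrite mulr_sumr.
rewrite pair_big_dep /= (reindex_onto fill restr) /=; last first.
  move=> T hT; have [lowE _ _] := restr_spec hT.
  apply/ffunP => z; rewrite ffunE /= [(_ <= z.2)%N]leqNgt -lowE ffunE.
  have /ssfillP [h1 h2 _ _] := hT.
  case: (ltnP (T z) n) => //= nT; case: (ltnP z.2 (lam z.1)) => [zl|/h2 -> //].
  apply: val_inj; rewrite /= inordK; last by rewrite ltnS ltnW.
  by apply/eqP; rewrite eqn_leq nT -ltnS h1.
apply: eq_big => [[mu T]|[mu T] /andP [hT /eqP e]] /=.
  apply/andP/andP => [[hT /eqP e]|[h1 h2]].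
    by have [_] := restr_spec hT; rewrite e.
  by have [-> ->] := fill_spec h1 h2.
have [_ hmu /ssfillP [h1 h2 _ _]] := restr_spec hT; rewrite e /= in hmu h1 h2.
rewrite (bigID (fun z : 'I_M * 'I_W => (z.2 < extend_rows mu z.1)%N)) /= mulrC; congr (_ * _); last first.
  apply: eq_big => [z|z /andP [_ zl]]; last by rewrite ffunE /= leqNgt zl.
  by rewrite andb_idl // => /leq_trans; apply; apply: interlaced_le.
transitivity (\prod_(i < M) x n ^+ (lam i - extend_rows mu i)).
  under [RHS]eq_bigr do rewrite -prod_interval //.
  rewrite pair_big_dep /=; apply: eq_big => [z|z /andP [zl]].
    by rewrite andbC -leqNgt.
  by rewrite -leqNgt ffunE /= zl => ->; rewrite inordK // ltnS ltnW.
rewrite -expr_sum; congr (_ ^+ _).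
(* Row [n] consists of entries [n] only, hence the separate summand [lam n]; the rows after it are
   empty. *)
rewrite -(big_mkord xpredT (fun i => lam i - extend_rows mu i)%N) (big_cat_nat (n := n.+1)) //=.
rewrite [X in (_ + X)%N]big_nat_cond [X in (_ + X)%N]big1 ?addn0; last first.
  by move=> i /andP [/andP [ni _] _]; rewrite lam0.
rewrite big_nat_recr //= addnC extend_small // subn0 big_mkord; congr (_ + _)%N.
by apply: eq_bigr => i _; rewrite extend_ord.
Qed.

End Branching.


(** Alternants and semistandard sums branch over the same interlacing sequences with the same powers
    of x_n; the remaining factor is the one by which the Vandermonde determinant grows. *)
Theorem bialternant n lam : (n <= M)%N -> (forall i, lam i <= W)%N ->
  (forall i, lam i.+1 <= lam i)%N -> (forall i, (n <= i)%N -> lam i = 0%N) ->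
  powdet x n (fun i => n - i.+1)%N * sssum n lam = powdet x n (fun i => lam i + (n - i.+1))%N.
Proof.
elim: n lam => [|n IH] lam nM lamW lamS lam0.
  by rewrite /powdet !det_mx00 mul1r (@sssum_eq _ _ (fun=> 0%N)) ?sssum0 // => i _; rewrite lam0.
rewrite sssumS //.
have -> : powdet x n.+1 (fun i => n.+1 - i.+1)%N =
   (\prod_(j < n) (x j - x n)) * powdet x n (fun i => n - i.+1)%N.
  (* The recursion for the Vandermonde determinant is the case of the empty partition, where only
     the zero sequence interlaces. *)
  have := @powdetS _ x n 0 (fun=> 0%N) (fun=> leqnn 0) (fun _ _ => leqnn 0).
  rewrite (big_pred1 [ffun=> ord0]); last first.
    move=> mu; apply/forallP/eqP => [h|->]; last by move=> i; rewrite ffunE.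
    by apply/ffunP => i; apply/val_inj; have := h i; rewrite ffunE /=; case: (mu i) => [[]].
  rewrite [in X in x n ^+ X]big1 // expr0 mul1r.
  move=> H; rewrite -[LHS]/(powdet x n.+1 (fun i => 0 + (n.+1 - i.+1))%N) {}H /powdet.
  congr (_ * \det _); apply/matrixP => i j; rewrite !mxE.
  by case: insubP => [i' _ _|]; rewrite ?ffunE ?ltn_ord.
rewrite -mulrA mulr_sumr (@powdetS _ x n W lam lamW); last by move=> i _; apply: lamS.
congr (_ * _); apply: eq_bigr => mu /forallP hmu.
rewrite mulrCA IH ?(ltnW nM) //.
- move=> i; rewrite /extend_rows; case: insubP => [i' _ _|] //; first by rewrite -ltnS ltn_ord.
- move=> i; rewrite /extend_rows; case: insubP => [i1 h1 e1|] //.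
  case: insubP => [i0 h0 e0|]; last by rewrite (ltn_trans (ltnSn i) h1).
  have /andP [_] := hmu i1; have /andP [] := hmu i0.
  by rewrite e0 e1 => a _ b; apply: leq_trans b a.
by move=> i ni; rewrite /extend_rows insubF // ltnNge ni.
Qed.

End Semistandard.

Definition rowlen (p : intpart) (i : nat) : nat := nth 0%N (val p) i.

Lemma rowlenS (p : intpart) i : (rowlen p i.+1 <= rowlen p i)%N.
Proof.
have [/(sortedP 0%N) h _] := andP (valP p); rewrite /rowlen.
by case: (ltnP i.+1 (size (val p))) => [/h //|hi]; rewrite nth_default.
Qed.

Lemma rowlen_le (p : intpart) i j : (i <= j)%N -> (rowlen p j <= rowlen p i)%N.
Proof.
apply: (@homo_leq _ (rowlen p) (fun a b => b <= a)%N) => // [a b c ba cb|k].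
  exact: leq_trans cb ba.
exact: rowlenS.
Qed.

Lemma rowlen_default (p : intpart) i : (size (val p) <= i)%N -> rowlen p i = 0%N.
Proof. exact: nth_default. Qed.

Lemma rowlen_gt0 (p : intpart) i : (i < size (val p))%N -> (0 < rowlen p i)%N.
Proof.
have [_ n0] := andP (valP p); move=> hi; rewrite lt0n; apply: contraNneq n0 => <-.
exact: mem_nth.
Qed.

Lemma mem_diagram (p : intpart) (z : cell) : (z \in diagram p) = (z.2 < rowlen p z.1)%N.
Proof.
case: z => r c /=; apply/allpairsPdep/idP => [[r' [c' [h1 h2 [-> ->]]]]|h].
  by move: h2; rewrite mem_iota.
exists r, c; rewrite !mem_iota /= h; split=> //.
by rewrite ltnNge; apply/negP => /rowlen_default r0; rewrite r0 in h.
Qed.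

(** * Schur polynomials as box fillings *)

Section SchurBox.

Variables (p : intpart) (N : nat).
Hypothesis pN : (size (val p) <= N)%N.
Let W := rowlen p 0.
Let boxfill := {ffun 'I_N * 'I_W -> 'I_N.+1}.

Definition mvar (v : nat) : {mpoly {poly int}[N]} := if insub v is Some i then 'X_i else 0.

Let in_box (z : seq_sub (diagram p)) : ((val z).1 < N)%N /\ ((val z).2 < W)%N.
Proof.
have := valP z; rewrite mem_diagram => h; split; last first.
  by apply: leq_trans h _; apply: rowlen_le.
by apply: leq_trans pN; rewrite ltnNge; apply/negP => /rowlen_default r0; rewrite r0 in h.
Qed.

Let brow z : 'I_N := Ordinal (in_box z).1.
Let bcol z : 'I_W := Ordinal (in_box z).2.

Let to_box (T : {ffun seq_sub (diagram p) -> 'I_N}) : boxfill :=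
  [ffun z : 'I_N * 'I_W =>
     if insub (nat_of_ord z.1, nat_of_ord z.2) is Some z' then widen_ord (leqnSn N) (T z') else ord_max].

(** [brow z] is a mere default value: the existence of a cell shows that ['I_N] is inhabited. *)
Let of_box (T : boxfill) : {ffun seq_sub (diagram p) -> 'I_N} :=
  [ffun z => insubd (brow z) (T (brow z, bcol z) : nat)].

Let to_boxE T z : to_box T (brow z, bcol z) = T z :> nat.
Proof.
rewrite ffunE /=.
have -> : insub ((val z).1, (val z).2) = Some z :> option (seq_sub (diagram p)).
  by rewrite -surjective_pairing valK.
by [].
Qed.

Let box_val (z : 'I_N * 'I_W) : (z.2 < rowlen p z.1)%N ->
  {z' | z = (brow z', bcol z') & val z' = (nat_of_ord z.1, nat_of_ord z.2)}.
Proof.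
move=> h; have hz : (nat_of_ord z.1, nat_of_ord z.2) \in diagram p by rewrite mem_diagram.
exists (SeqSub hz) => //; rewrite [LHS]surjective_pairing; congr (_, _); exact: val_inj.
Qed.

Let to_box_out T (z : 'I_N * 'I_W) : (rowlen p z.1 <= z.2)%N -> to_box T z = ord_max.
Proof. by move=> h; rewrite ffunE insubF // mem_diagram /= ltnNge h. Qed.

Let of_boxK T : of_box (to_box T) = T.
Proof.
apply/ffunP => z; rewrite ffunE; apply: val_inj.
by rewrite val_insubd to_boxE ltn_ord.
Qed.

Let to_boxK T : ssfill N (rowlen p) T -> to_box (of_box T) = T.
Proof.
move=> /ssfillP [h1 h2 _ _]; apply/ffunP => z; apply: val_inj => /=.
case: (ltnP z.2 (rowlen p z.1)) => hz; last by rewrite to_box_out ?h2.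
have hT := h1 z hz.
have [z' zz' _] := box_val hz; rewrite {1}zz' to_boxE ffunE -zz'.
by rewrite val_insubd hT.
Qed.

Let semistandard_box (T : {ffun seq_sub (diagram p) -> 'I_N}) :
  [forall z, forall z', (row_lt (val z) (val z') ==> (T z <= T z')%N) &&
                        (col_lt (val z) (val z') ==> (T z < T z')%N)] =
  ssfill N (rowlen p) (to_box T).
Proof.
apply/forallP/ssfillP => [h|[_ _ h3 h4] z].
  split.
  - by move=> z /box_val [z' -> _]; rewrite to_boxE.
  - exact: to_box_out.
  - move=> i c c'; rewrite leq_eqVlt => /orP [/eqP/val_inj -> //|cc].
    case: (ltnP c' (rowlen p i)) => hc'; last by rewrite [to_box T (i, c')]to_box_out // -ltnS.
    have [z zE zv] := @box_val (i, c) (ltn_trans cc hc').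
    have [z' zE' zv'] := @box_val (i, c') hc'.
    rewrite zE zE' !to_boxE.
    have /forallP /(_ z') /andP [/implyP + _] := h z; apply.
    by rewrite zv zv' /row_lt /= eqxx.
  move=> i i' c ii hc.
  have [z zE zv] := @box_val (i, c) (leq_trans hc (rowlen_le p (ltnW ii))).
  have [z' zE' zv'] := @box_val (i', c) hc.
  rewrite zE zE' !to_boxE.
  have /forallP /(_ z') /andP [_ /implyP] := h z; apply.
  by rewrite zv zv' /col_lt /= eqxx andbT.
apply/forallP => z'; apply/andP; split; apply/implyP => /andP [].
  move=> /eqP e c; rewrite -!to_boxE.
  have -> : brow z' = brow z by apply: val_inj; rewrite /= e.
  by apply: h3; apply: ltnW.
move=> c /eqP e; rewrite -!to_boxE.
have -> : bcol z = bcol z' by apply: val_inj; rewrite /= e.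
by apply: h4 => //=; have := valP z'; rewrite mem_diagram.
Qed.

Lemma schur_sssum : schur p N = sssum mvar N W N (rowlen p).
Proof.
rewrite /sssum (reindex_onto to_box of_box) => [|T /to_boxK //].
apply: eq_big => [T|T _]; first by rewrite of_boxK eqxx andbT semistandard_box.
rewrite (@reindex_omap _ _ _ _ _ (fun z => (brow z, bcol z))
   (fun z => insub (nat_of_ord z.1, nat_of_ord z.2))); last first.
  move=> z hz; rewrite insubT /=; first by rewrite mem_diagram.
  move=> hz'; congr Some; rewrite [RHS]surjective_pairing; congr (_, _); exact: val_inj.
apply: eq_big => [z|z _].
  rewrite /= -surjective_pairing valK eqxx andbT.
  by have := valP z; rewrite mem_diagram.
rewrite to_boxE /mvar insubT // => h; congr ('X__); exact: val_inj.
Qed.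

Lemma schur_bialternant :
  powdet mvar N (fun i => N - i.+1)%N * schur p N =
  powdet mvar N (fun i => rowlen p i + (N - i.+1))%N.
Proof.
rewrite schur_sssum bialternant // => [i|i|i h].
- exact: rowlen_le.
- exact: rowlenS.
by apply: rowlen_default; apply: leq_trans pN h.
Qed.

End SchurBox.

(** The first column increases strictly, so its entry in row [N] would be at least [N]. *)
Lemma schur_gt_vars (p : intpart) (N : nat) : (N < size (val p))%N -> schur p N = 0.
Proof.
move=> Np; apply: big_pred0 => T; apply/negP => /forallP h.
have inD i : (i < size (val p))%N -> (i, 0)%N \in diagram p.
  by move=> hi; rewrite mem_diagram rowlen_gt0.
have low k (hk : (k < size (val p))%N) : (k <= T (SeqSub (inD k hk)))%N.
  elim: k hk => // k IH hk; have hk' := ltnW hk.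
  apply: leq_ltn_trans (IH hk') _.
  have /forallP /(_ (SeqSub (inD _ hk))) /andP [_ /implyP] := h (SeqSub (inD _ hk')); apply.
  by rewrite /col_lt /= ltnSn.
by have := low N Np; rewrite leqNgt ltn_ord.
Qed.

(** * Linear independence of the Schur polynomials *)

Lemma perm_ltn_id (N : nat) (s : 'S_N) : (forall i j : 'I_N, (i < j)%N -> (s i < s j)%N) -> s = 1%g.
Proof.
move=> hs.
have ge (t : 'S_N) : (forall i j : 'I_N, (i < j)%N -> (t i < t j)%N) -> forall i : 'I_N, (i <= t i)%N.
  move=> ht [i hi]; elim: i hi => // i IH hi.
  exact: leq_ltn_trans (IH (ltnW hi)) (ht (Ordinal (ltnW hi)) (Ordinal hi) (ltnSn i)).
apply/permP => i; rewrite perm1; apply/val_inj/eqP; rewrite eqn_leq (ge s hs) andbT.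
rewrite -{2}[i](permK s); apply: ge => j k jk; rewrite ltnNge; apply/negP => kj.
case: (ltngtP (s^-1 k)%g (s^-1 j)%g) kj => // [h _|/val_inj/perm_inj e _].
  by have := hs _ _ h; rewrite !permKV ltnNge ltnW.
by rewrite e ltnn in jk.
Qed.

Definition expmnm (N : nat) (e : nat -> nat) : 'X_{1..N} := [multinom e i | i < N].

(** A permutation that carries one strictly decreasing exponent sequence to another preserves the
    order, so it is the identity. *)
Lemma mcoeff_powdet (N : nat) (e e' : nat -> nat) :
  (forall i j, (i < j)%N -> (j < N)%N -> (e j < e i)%N) ->
  (forall i j, (i < j)%N -> (j < N)%N -> (e' j < e' i)%N) ->
  (powdet (mvar N) N e)@_(expmnm N e') = (expmnm N e == expmnm N e')%:R.
Proof.
move=> he he'; have vK (i : 'I_N) : insub (nat_of_ord i) = Some i :> option 'I_N := valK i.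
have term (s : 'S_N) : \prod_(i < N) (\matrix_(i < N, j < N) mvar N j ^+ e i) i (s i) = 'X_[expmnm N (fun j => if insub j is Some j' then e ((s^-1)%g j') else 0%N)].
  rewrite mpolyXE_id (reindex_inj (@perm_inj _ s^-1%g)) /=; apply: eq_bigr => i _.
  by rewrite mxE permKV mnmE /mvar !vK.
rewrite /powdet /determinant raddf_sum /= (bigD1 (1%g : 'S_N)) //= [X in _ + X]big1 ?addr0.
  rewrite odd_perm1 expr0 mul1r.
  rewrite term mcoeffX; congr ((_ == _)%:R).
  by apply/mnmP => i; rewrite !mnmE vK invg1 perm1.
move=> s s1.
have ne : expmnm N (fun j => if insub j is Some j' then e ((s^-1)%g j') else 0%N) != expmnm N e'.
  apply: contraNneq s1 => /mnmP E.
  suff e1 : (s^-1 = 1)%g by rewrite -[s]invgK e1 invg1.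
  apply: perm_ltn_id => i j ij.
  have Ei (k : 'I_N) : e ((s^-1)%g k) = e' k.
    by have := E k; rewrite !mnmE vK.
  rewrite ltnNge leq_eqVlt; apply/negP => /orP [/eqP/val_inj/perm_inj ji|h].
    by rewrite ji ltnn in ij.
  by have := he _ _ h (ltn_ord _); rewrite !Ei ltnNge ltnW // he'.
by rewrite term mulr_sign; case: (odd_perm s); rewrite ?mcoeffN mcoeffX (negPf ne) ?oppr0.
Qed.

Lemma expmnm_rowlen_inj (N : nat) (p p' : intpart) : (size (val p) <= N)%N -> (size (val p') <= N)%N ->
  expmnm N (fun i => rowlen p i + (N - i.+1))%N = expmnm N (fun i => rowlen p' i + (N - i.+1))%N -> p = p'.
Proof.
move=> pN p'N /mnmP E.
have rowE i : rowlen p i = rowlen p' i.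
  case: (ltnP i N) => [iN|Ni]; last by rewrite !rowlen_default // (leq_trans _ Ni).
  by have := E (Ordinal iN); rewrite !mnmE /= => /addIn.
have sz (r r' : intpart) : (forall i, rowlen r i = rowlen r' i) -> (size (val r) <= size (val r'))%N.
  move=> h; rewrite leqNgt; apply/negP => /rowlen_gt0.
  by rewrite h rowlen_default.
apply: val_inj; apply: (@eq_from_nth _ 0%N) => [|i _]; last exact: rowE.
by apply/eqP; rewrite eqn_leq !sz.
Qed.

Lemma shifted_decreasing (N : nat) (f : nat -> nat) : (forall i, f i.+1 <= f i)%N ->
  forall i j, (i < j)%N -> (j < N)%N -> (f j + (N - j.+1) < f i + (N - i.+1))%N.
Proof.
move=> fS i j ij jN.
have := @homo_leq _ f (fun a b => b <= a)%N (@leqnn) (fun b a c ab bc => leq_trans bc ab) fS _ _ (ltnW ij).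
lia.
Qed.

Lemma powdet_delta_neq0 (N : nat) : powdet (mvar N) N (fun i => N - i.+1)%N != 0.
Proof.
have hd := @shifted_decreasing N (fun=> 0%N) (fun=> isT).
apply: contraTneq (oner_neq0 {poly int}) => h.
have := mcoeff_powdet hd hd; rewrite -[powdet _ _ _]/(powdet (mvar N) N (fun i => N - i.+1)%N) h mcoeff0 eqxx.
by move=> /eqP e01; rewrite negbK eq_sym.
Qed.

(** Times the Vandermonde determinant, each Schur polynomial becomes an alternant, and the
    coefficient of its dominant monomial isolates one partition. *)
Lemma schur_free (N : nat) (S : seq intpart) (f : intpart -> {poly int}) : uniq S ->
  {in S, forall p : intpart, (size (val p) <= N)%N} ->
  \sum_(p <- S) f p *: schur p N = 0 -> {in S, forall p, f p = 0}.
Proof.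
move=> uS SN h0 p pS.
have := congr1 (fun P => (powdet (mvar N) N (fun i => N - i.+1)%N * P)@_(expmnm N (fun i => rowlen p i + (N - i.+1))%N)) h0.
rewrite mulr0 mcoeff0 mulr_sumr raddf_sum /= (bigD1_seq p) //= big1_seq ?addr0.
  rewrite -scalerAr schur_bialternant ?SN // mcoeffZ mcoeff_powdet ?eqxx ?mulr1 //;
    exact: shifted_decreasing (@rowlenS p).
move=> r /andP [rp rS].
rewrite -scalerAr schur_bialternant ?SN // mcoeffZ mcoeff_powdet; [|exact: shifted_decreasing (@rowlenS _)..].
case: eqP => [/expmnm_rowlen_inj e|]; last by rewrite mulr0.
by rewrite e ?SN // eqxx in rp.
Qed.

Lemma schur_expansion_unique (F : symfun) (f g : {fsfun intpart -> {poly int} with 0}) :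
  (forall N, F N = \sum_(mu <- finsupp f) f mu *: schur mu N) ->
  (forall N, F N = \sum_(mu <- finsupp g) g mu *: schur mu N) -> f = g.
Proof.
move=> hf hg; pose S := (finsupp f `|` finsupp g)%fset.
have ext (h : {fsfun intpart -> {poly int} with 0}) N : (finsupp h `<=` S)%fset ->
    \sum_(mu <- finsupp h) h mu *: schur mu N = \sum_(mu <- S) h mu *: schur mu N.
  move=> sub; apply: big_fset_incl => // mu _ /fsfun_dflt ->; exact: scale0r.
(* Enough variables for every shape in either support, so that independence applies. *)
pose N := \max_(mu <- S) size (val mu).
have d0 : \sum_(mu <- S) (f mu - g mu) *: schur mu N = 0.
  under eq_bigr do rewrite scalerBl.
  by rewrite sumrB -!ext ?fsubsetUl ?fsubsetUr // -hf -hg subrr.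
have SN : {in (S : seq intpart), forall p : intpart, (size (val p) <= N)%N}.
  by move=> p pS; apply: (@leq_bigmax_seq _ _ xpredT (fun q : intpart => size (val q)) p pS).
apply/fsfunP => mu; have [muS|] := boolP (mu \in S).
  by apply/eqP; rewrite -subr_eq0; apply/eqP; apply: (schur_free (fset_uniq S) SN d0).
by rewrite in_fsetU negb_or => /andP [/fsfun_dflt -> /fsfun_dflt ->].
Qed.

(** * Sums over colourings as sums over words *)

Section FullSymmetry.

Variables (R : comNzRingType) (N : nat) (f : ('I_N -> R) -> R).
Hypothesis f_adj : forall (ia ib : 'I_N) y, ib = ia.+1 :> nat -> f (y \o tperm ia ib) = f y.

Lemma comp_permM (y : 'I_N -> R) (s t : 'S_N) : y \o (s * t)%g = (y \o t) \o s.
Proof. by apply: funext => i /=; rewrite permM. Qed.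

(** Induction on the distance: a transposition is conjugated by an adjacent one into a shorter
    one. *)
Lemma symm_tperm (i j : 'I_N) y : (i < j)%N -> f (y \o tperm i j) = f y.
Proof.
move=> ij; have [d dE] : exists d, (j = i + d.+1 :> nat)%N.
  by exists (j - i.+1)%N; lia.
elim: d j ij dE y => [|d IH] j ij dE y; first by apply: f_adj; rewrite dE addn1.
have kN : (i + d.+1 < N)%N by have := ltn_ord j; lia.
pose k := Ordinal kN; have kj : j = k.+1 :> nat by rewrite dE addnS.
have -> : tperm i j = (tperm k j * tperm i k * tperm k j)%g.
  have := tpermJ i k (tperm k j); rewrite conjgE tpermV tpermL tpermD => [<-||]; last 2 first.
  - by rewrite -val_eqE /=; lia.
  - by rewrite -val_eqE /=; lia.
  by rewrite mulgA.
rewrite !comp_permM f_adj // IH //=; last by lia.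
exact: f_adj.
Qed.

Lemma symm_perm (s : 'S_N) y : f (y \o s) = f y.
Proof.
have [ts -> _] := prod_tpermP s.
elim: ts y => [|[i j] ts IH] y.
  by rewrite big_nil; congr f; apply: funext => i /=; rewrite perm1.
rewrite big_cons comp_permM -[RHS]IH /=.
case: (ltngtP i j) => [ij|ji|/val_inj ->]; first exact: symm_tperm.
  by rewrite tpermC symm_tperm.
by rewrite tperm1; congr f; apply: funext => k /=; rewrite perm1.
Qed.

End FullSymmetry.

Lemma big_tuple_cons (V : nmodType) (T : finType) n (F : n.+1.-tuple T -> V) :
  \sum_c F c = \sum_j \sum_(c : n.-tuple T) F [tuple of j :: c].
Proof.
rewrite pair_big /= (reindex (fun p : T * n.-tuple T => [tuple of p.1 :: p.2])) //=.
exists (fun c => (thead c, [tuple of behead c])) => [[j c] _|c _] /=.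
  by rewrite theadE; congr (_, _); apply: val_inj.
by rewrite -tuple_eta.
Qed.

Section Walks.

Variables (R : comNzRingType) (N : nat).
Variables (om : (nat -> nat) -> R -> R -> nat -> nat -> nat -> nat -> R).
Variable (base : (nat -> nat) -> R).

(** Common form of [colsum] and [stdsum], so that one lemma unfolds both recursions into sums over
    words. *)
Fixpoint walk (l : seq (option (R * R))) (lam : nat -> nat) (m1 m2 m3 : nat) : R :=
  match l with
  | [::] => base lam
  | None :: l' => walk l' lam N m1 m2
  | Some (w, z) :: l' =>
      \sum_(j < N) om lam w z m1 m2 m3 j * walk l' (addcell lam j) j m1 m2
  end.

Variables (w z : int -> R).

(** Absent integers get an entry too, because the memory of a walk refers to the values t - 1, t -
    2, t - 3 and not to positions in [s]. *)
Definition schedule (s : seq int) (t : int) (L : nat) : seq (option (R * R)) :=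
  [seq if t + i%:Z \in s then Some (w (t + i%:Z), z (t + i%:Z)) else None | i <- iota 0 L].

(* Colour of the letter [t], and [N] when [t] does not occur. *)
Definition colour (s : seq int) (c : seq nat) (t : int) : nat := nth N c (index t s).

Definition vals (c : seq 'I_N) : seq nat := map (@nat_of_ord N) c.

Definition mult (c : seq nat) : nat -> nat := fun i => count_mem i c.

Definition letter_factor (s : seq int) (c : seq nat) (k : nat) : R :=
  let t := nth 0 s k in
  om (mult (take k c)) (w t) (z t)
     (colour s c (t - 1)) (colour s c (t - 2)) (colour s c (t - 3)) (nth N c k).

Lemma scheduleS s t L : schedule s t L.+1 =
  (if t \in s then Some (w t, z t) else None) :: schedule s (t + 1) L.
Proof.
rewrite /schedule /= addr0; congr (_ :: _).
rewrite (iotaDl 1 0) -map_comp; apply: eq_map => i /=.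
by rewrite PoszD addrA.
Qed.

Lemma mult_rcons c j : mult (rcons c j) = addcell (mult c) j.
Proof.
by apply: funext => i; rewrite /mult /addcell -cats1 count_cat /= addn0 eq_sym.
Qed.

Lemma colour_cat s1 s2 c1 c2 t : size c1 = size s1 -> t \notin s2 ->
  colour (s1 ++ s2) (c1 ++ c2) t = if t \in s1 then colour s1 c1 t else nth N c2 (size s2).
Proof.
move=> sz ts2; rewrite /colour index_cat; case: ifP => ts1.
  by rewrite nth_cat sz index_mem ts1.
by rewrite nth_cat sz ltnNge leq_addr /= addKn memNindex.
Qed.

Lemma colour_notin s c t : size c = size s -> t \notin s -> colour s c t = N.
Proof. by move=> sz ts; rewrite /colour memNindex // nth_default ?sz. Qed.

(** Generalised for the induction over a prefix [s1] already coloured by [c1], whose multiplicities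
    are the current shape. *)
Lemma walk_words L (t : int) (s1 s2 : seq int) (c1 : seq nat) :
  size c1 = size s1 -> uniq (s1 ++ s2) -> sorted <%R s2 ->
  {in s1, forall u, u < t} -> {in s2, forall u, t <= u < t + L%:Z} ->
  walk (schedule (s1 ++ s2) t L) (mult c1)
    (colour s1 c1 (t - 1)) (colour s1 c1 (t - 2)) (colour s1 c1 (t - 3)) =
  \sum_(c2 : (size s2).-tuple 'I_N)
    (\prod_(size s1 <= k < size (s1 ++ s2)) letter_factor (s1 ++ s2) (c1 ++ vals c2) k)
    * base (mult (c1 ++ vals c2)).
Proof.
elim: L t s1 s2 c1 => [|L IH] t s1 s2 c1 sz us so h1 h2.
  have s20 : s2 = [::].
    case: s2 h2 {us so} => // u s2 /(_ u (mem_head _ _)).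
    by rewrite addr0 => /andP [a b]; have := le_lt_trans a b; rewrite ltxx.
  rewrite s20 /= cats0 (big_pred1 [tuple]) => [|c]; last by apply/esym/eqP/val_inj; case: c => -[].
  by rewrite /= cats0 big_geq // mul1r.
have colS (s : seq int) (c : seq nat) : forall d : int, colour s c (t + 1 - (d + 1)) = colour s c (t - d).
  by move=> d; congr colour; ring.
rewrite scheduleS mem_cat.
have tns1 : t \notin s1 by apply/negP => /h1; rewrite ltxx.
rewrite (negPf tns1) /=; case: ifP => ts2; last first.
  have colN : colour s1 c1 (t + 1 - 1) = N by rewrite addrK colour_notin.
  rewrite -[X in walk _ _ X _ _]colN -(colS _ _ 1) -(colS _ _ 2); rewrite -/(walk) IH //.
    by move=> u /h1 ut; apply: lt_trans ut _; rewrite ltrDl.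
  move=> u us2; have /andP [tu ul] := h2 u us2; apply/andP; split; last by rewrite -addrA -[1]/(1%:Z) -PoszD add1n.
  by rewrite lezD1 lt_neqAle tu andbT; apply: contraFneq ts2 => ->.
move: ts2 so us h2; case: s2 => [//|t' s2] ts2 so us h2.
have tt' : t' = t.
  move: ts2; rewrite inE => /predU1P [->//|ts2].
  move: so => /= /(order_path_min lt_trans) /allP /(_ t ts2) t't.
  by have /andP [] := h2 t' (mem_head _ _); rewrite leNgt t't.
rewrite {}tt' {ts2} in so us h2 *.
have so2 : all (fun u => t < u) s2 by move: so => /= /(order_path_min lt_trans).
rewrite big_tuple_cons; apply: eq_bigr => j _.
have usr : uniq (rcons s1 t ++ s2) by rewrite cat_rcons.
have szr : size (rcons c1 j) = size (rcons s1 t) by rewrite !size_rcons sz.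
(* Colouring [t] does not change the colours of smaller integers, present or absent. *)
have lt1 d : 0 <= d -> colour (rcons s1 t) (rcons c1 j) (t - (d + 1)) = colour s1 c1 (t - (d + 1)).
  move=> d0; have nt : t - (d + 1) != t by rewrite -subr_eq0 addrAC subrr sub0r oppr_eq0; lia.
  rewrite /colour -!cats1 index_cat; case: ifP => ts; first by rewrite nth_cat sz index_mem ts.
  rewrite [in RHS]memNindex ?ts // [RHS]nth_default ?sz //.
  by rewrite /= eq_sym (negPf nt) nth_default // size_cat sz.
have col0 : colour (rcons s1 t) (rcons c1 j) t = j.
  by rewrite /colour -(cats1 s1) index_cat (negPf tns1) /= eqxx addn0 nth_rcons sz ltnn eqxx.
rewrite -mult_rcons.
have -> : walk (schedule (s1 ++ t :: s2) (t + 1) L) (mult (rcons c1 j)) j (colour s1 c1 (t - 1)) (colour s1 c1 (t - 2)) =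
   walk (schedule (rcons s1 t ++ s2) (t + 1) L) (mult (rcons c1 j)) (colour (rcons s1 t) (rcons c1 j) (t + 1 - 1))
     (colour (rcons s1 t) (rcons c1 j) (t + 1 - 2)) (colour (rcons s1 t) (rcons c1 j) (t + 1 - 3)).
  rewrite cat_rcons addrK col0; congr (walk _ _ _ _ _).
    by rewrite -(lt1 0) // add0r; congr colour; ring.
  by rewrite -(lt1 1) //; congr colour; ring.
rewrite IH //; last 3 first.
- by move: so => /= /path_sorted.
- move=> u; rewrite mem_rcons inE => /predU1P [->|/h1 ut]; first by rewrite ltrDl.
  by apply: lt_trans ut _; rewrite ltrDl.
- move=> u us2; have /allP /(_ u us2) tu := so2.
  have us2' : u \in t :: s2 by rewrite inE us2 orbT.
  have /andP [_ ul] := h2 u us2'; rewrite lezD1 tu /=.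
  by apply: lt_le_trans ul _; lia.
rewrite mulr_sumr; apply: eq_bigr => c _.
have sC : (size s1 < size (s1 ++ t :: s2))%N by rewrite size_cat /= addnS ltnS leq_addr.
have -> : vals [tuple of j :: c] = nat_of_ord j :: vals c by [].
rewrite [in RHS](big_ltn sC) !cat_rcons size_rcons mulrA; congr (_ * _ * _).
rewrite /letter_factor !nth_cat sz ltnn subnn /= take_size_cat ?sz //.
have nts d : 0 <= d -> t - (d + 1) \notin t :: s2.
  move=> d0; rewrite inE negb_or; apply/andP; split; first by rewrite -subr_eq0 addrAC subrr sub0r oppr_eq0; lia.
  by apply/negP => /(allP so2); lia.
have colE d : 0 <= d -> colour (s1 ++ t :: s2) (c1 ++ nat_of_ord j :: vals c) (t - (d + 1)) = colour s1 c1 (t - (d + 1)).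
  move=> d0; rewrite colour_cat ?nts //; case: ifP => // ts.
  by rewrite [RHS]colour_notin ?sz ?ts // nth_default //= size_map size_tuple.
have -> : t - 1 = t - (0 + 1) by rewrite add0r.
have -> : t - 2 = t - (1 + 1) by [].
have -> : t - 3 = t - (2 + 1) by [].
by rewrite !colE.
Qed.

End Walks.

Section ColourSums.

Variables (R : comNzRingType) (q : R) (N : nat) (w z : int -> R) (x : 'I_N -> R).

Definition colour_weight (s : seq int) (c : seq nat) : R :=
  \prod_(0 <= k < size s) letter_factor N (fun=> colour_step q) w z s c k.

Definition tableau_step (lam : nat -> nat) (u v : R) (m1 m2 m3 j : nat) : R :=
  if addable lam j then stdstep q lam u v m1 m2 m3 j else 0.

Definition tableau_weight (s : seq int) (c : seq nat) : R :=
  \prod_(0 <= k < size s) letter_factor N tableau_step w z s c k.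

Lemma stdsum_walk l lam m1 m2 m3 :
  stdsum q x l lam m1 m2 m3 = walk N tableau_step (alternant x) l lam m1 m2 m3.
Proof.
elim: l lam m1 m2 m3 => [//|[[u v]|] l IH] lam m1 m2 m3 /=; last exact: IH.
rewrite big_mkcond; apply: eq_bigr => j _; rewrite /tableau_step.
by case: ifP; rewrite ?mul0r // IH.
Qed.

Lemma colsum_walk l lam m1 m2 m3 :
  walk N (fun=> colour_step q) (fun lam => \prod_i x i ^+ lam i) l lam m1 m2 m3 =
  (\prod_i x i ^+ lam i) * colsum q l m1 m2 m3 x.
Proof.
elim: l lam m1 m2 m3 => [|[[u v]|] l IH] lam m1 m2 m3 /=; [by rewrite mulr1| |exact: IH].
rewrite mulr_sumr; apply: eq_bigr => j _; rewrite IH.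
have -> : \prod_i x i ^+ addcell lam j i = x j * \prod_i x i ^+ lam i.
  rewrite (bigD1 j) //= [in RHS](bigD1 j) //= mulrA -exprS /addcell eqxx addn1; congr (_ * _).
  by apply: eq_bigr => i ij; rewrite -[_ == _ :> nat]/(i == j) (negPf ij) addn0.
by ring.
Qed.

Lemma colsum_symm_perm l (s : 'S_N) y : colsum q l N N N (y \o s) = colsum q l N N N y.
Proof.
apply: symm_perm => ia ib {}y ab.
have Na : N != ia :> nat by rewrite neq_ltn ltn_ord orbT.
exact: (@colsum_symm _ q _ ia ib ab l _ _ _ Na Na Na y).
Qed.

Lemma int_window (s : seq int) : exists t L, {in s, forall u, t <= u < t + L%:Z}.
Proof.
exists (- (\max_(u <- s) `|u|%N)%:Z), (\max_(u <- s) `|u|%N).*2.+1 => u us.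
have h : (`|u| <= \max_(u <- s) `|u|)%N by apply: (@leq_bigmax_seq _ _ xpredT (fun u : int => `|u|%N)).
by move: h; move: (\max_(u <- s) _) => m h; apply/andP; split; lia.
Qed.

Lemma walk_words_total om base (s : seq int) t L : sorted <%R s -> {in s, forall u, t <= u < t + L%:Z} ->
  \sum_(c : (size s).-tuple 'I_N) (\prod_(0 <= k < size s) letter_factor N om w z s (vals c) k) * base (mult (vals c))
   = walk N om base (schedule w z s t L) (fun=> 0%N) N N N.
Proof.
move=> so tL; have us : uniq ([::] ++ s) by apply: (sorted_uniq lt_trans) so; apply: ltxx.
by rewrite -[RHS]/(walk N om base (schedule w z ([::] ++ s) t L) (mult [::]) _ _ _)
     (@walk_words _ _ _ _ _ _ L t [::] s [::]).
Qed.

End ColourSums.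

Section ColourSumTheorems.

Variables (R : comNzRingType) (q : R) (N : nat) (w z : int -> R) (s : seq int).
Hypothesis so : sorted <%R s.

Lemma colour_sum_colsum : exists l, forall x : 'I_N -> R,
  \sum_(c : (size s).-tuple 'I_N) colour_weight q N w z s (vals c) * \prod_i x i ^+ mult (vals c) i
  = colsum q l N N N x.
Proof.
have [t [L tL]] := int_window s; exists (schedule w z s t L) => x.
rewrite (@walk_words_total _ N w z (fun=> colour_step q) (fun lam => \prod_i x i ^+ lam i) s t L so tL).
by rewrite colsum_walk big1 ?mul1r.
Qed.

Lemma colour_sum_perm (p : 'S_N) (x : 'I_N -> R) :
  \sum_(c : (size s).-tuple 'I_N) colour_weight q N w z s (vals c) * \prod_i x (p i) ^+ mult (vals c) i =
  \sum_(c : (size s).-tuple 'I_N) colour_weight q N w z s (vals c) * \prod_i x i ^+ mult (vals c) i.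
Proof.
have [l lE] := colour_sum_colsum.
by rewrite (lE (x \o p)) lE colsum_symm_perm.
Qed.

(** The colour sum is symmetric, so multiplying it by the Vandermonde determinant equals alternating
    its product with the staircase monomial: the walk from the empty shape with memory N, N, N. *)
Theorem colour_sum_bialternant (x : 'I_N -> R) :
  alternant x (fun=> 0%N) *
    \sum_(c : (size s).-tuple 'I_N) colour_weight q N w z s (vals c) * \prod_i x i ^+ mult (vals c) i =
  \sum_(c : (size s).-tuple 'I_N) tableau_weight q N w z s (vals c) * alternant x (mult (vals c)).
Proof.
have [t [L tL]] := int_window s; pose l := schedule w z s t L.
rewrite (@walk_words_total _ N w z (fun=> colour_step q) (fun lam => \prod_i x i ^+ lam i) s t L so tL).
rewrite (@walk_words_total _ N w z (tableau_step q) (alternant x) s t L so tL) -/l.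
rewrite -stdsum_walk colsum_walk big1 ?mul1r //.
have v : valid_state N (fun=> 0%N) N N N.
  by exists (fun=> 0%N); split=> // i iN; rewrite /addcell ?(ltn_eqF iN) // !(ltn_eqF (ltnW iN)).
have := alternated_stdsum q x l v.
(* A square half way through would require N = N + 1. *)
have -> : correction q x l (fun=> 0%N) N N N = 0.
  by rewrite /correction; case: (l) => [//|[[u u']|//] l']; rewrite (ltn_eqF (ltnSn N)).
rewrite subr0 => <-; rewrite /alternated_colsum mulrC -alternationZ.
by apply: eq_bigr => p _; congr (_ * _); rewrite colsum_symm_perm mulrC.
Qed.

End ColourSumTheorems.

(** * From LLT polynomials to colourings *)

Section Standardization.

Variables (n N : nat).
Implicit Types (c : n.-tuple 'I_N) (w : 'S_n) (a : {ffun 'I_n -> 'I_N}).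

Definition lex_lt c (i j : 'I_n) : bool :=
  (tnth c i < tnth c j)%N || (tnth c i == tnth c j) && (i < j)%N.

Lemma lex_lt_irr c i : lex_lt c i i = false.
Proof. by rewrite /lex_lt !ltnn andbF. Qed.

Lemma lex_lt_trans c : transitive (lex_lt c).
Proof.
move=> j i k; rewrite /lex_lt -!val_eqE /=.
by move=> /orP [h|/andP [/eqP -> h]] /orP [h'|/andP [/eqP e' h']]; lia.
Qed.

Lemma lex_lt_total c i j : i != j -> lex_lt c i j || lex_lt c j i.
Proof. by rewrite /lex_lt -!val_eqE /=; lia. Qed.

Definition rank c (i : 'I_n) : nat := #|[pred j | lex_lt c j i]|.

Lemma rank_lt c i j : lex_lt c i j -> (rank c i < rank c j)%N.
Proof.
move=> ij; apply: proper_card; apply/properP; split.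
  by apply/fintype.subsetP => k; rewrite !inE => ki; apply: lex_lt_trans ij.
by exists i; rewrite !inE ?lex_lt_irr.
Qed.

Lemma rank_ltE c i j : (rank c i < rank c j)%N = lex_lt c i j.
Proof.
apply/idP/idP => [|/rank_lt //]; apply: contraTT => nij.
have [->|/lex_lt_total] := eqVneq i j; first by rewrite ltnn.
by move=> /(_ c); rewrite (negPf nij) /= => /rank_lt; rewrite -leqNgt => /ltnW.
Qed.

Lemma rank_ltn c i : (rank c i < n)%N.
Proof.
rewrite -[X in (_ < X)%N]card_ord; apply: proper_card; apply/properP; split.
  by apply/fintype.subsetP.
by exists i; rewrite // inE lex_lt_irr.
Qed.

Lemma rank_inj c : injective (fun i => Ordinal (rank_ltn c i)).
Proof.
move=> i j [] e; apply/eqP; apply: contraT => ij.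
by case/orP: (lex_lt_total c ij) => /rank_lt; rewrite e ltnn.
Qed.

Definition std_perm c : 'S_n := perm (@rank_inj c).

Lemma std_permE c i : std_perm c i = rank c i :> nat.
Proof. by rewrite permE. Qed.

Definition std_colours c : {ffun 'I_n -> 'I_N} := [ffun j => tnth c ((std_perm c)^-1 j)%g].

(* The condition of [Qsym], for the descents of the inverse of [w]. *)
Definition compatible w a : bool :=
  [forall j : 'I_n, forall j' : 'I_n, (j' == j.+1 :> nat) ==>
     (a j <= a j')%N && (((w^-1)%g j' < (w^-1)%g j)%N ==> (a j < a j')%N)].

Lemma compatible_lex w a (j j' : 'I_n) : compatible w a -> (j < j')%N ->
  (a j < a j')%N || (a j == a j') && ((w^-1)%g j < (w^-1)%g j')%N.
Proof.
move=> /forallP h jj; have [d dE] : exists d, (j' = j + d.+1 :> nat)%N.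
  by exists (j' - j.+1)%N; lia.
have adj (k k' : 'I_n) : k' = k.+1 :> nat ->
    (a k < a k')%N || (a k == a k') && ((w^-1)%g k < (w^-1)%g k')%N.
  move=> e; have /forallP /(_ k') := h k; rewrite e eqxx /= => /andP [le imp].
  have ne : (w^-1)%g k != (w^-1)%g k' by rewrite (inj_eq perm_inj) -val_eqE /= e; lia.
  by move: le imp ne; rewrite -!val_eqE /=; lia.
elim: d j' dE {jj} => [|d IH] j' dE; first by apply: adj; rewrite dE addn1.
have kn : (j + d.+1 < n)%N by have := ltn_ord j'; lia.
have := IH (Ordinal kn) erefl; have := @adj (Ordinal kn) j'.
rewrite /= dE addnS => /(_ erefl); rewrite -!val_eqE /=.
by move=> /orP [h1|/andP [/eqP e1 h1]] /orP [h2|/andP [/eqP e2 h2]]; lia.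
Qed.

Lemma std_compatible c : compatible (std_perm c) (std_colours c).
Proof.
apply/forallP => j; apply/forallP => j'; apply/implyP => /eqP e; rewrite !ffunE.
set i := ((std_perm c)^-1%g j); set i' := ((std_perm c)^-1%g j').
have : lex_lt c i i' by rewrite -rank_ltE -!std_permE !permKV e.
by rewrite /lex_lt -val_eqE /=; lia.
Qed.

Lemma std_unique w a : compatible w a ->
  std_perm [tuple a (w i) | i < n] = w.
Proof.
move=> wa; set c := [tuple _ | _ < _].
have lt1 i j : (w i < w j)%N -> lex_lt c i j.
  by move=> /(compatible_lex wa); rewrite !permK /lex_lt !tnth_mktuple.
have ltE i j : lex_lt c i j = (w i < w j)%N.
  apply/idP/idP => [|/lt1 //]; apply: contraTT; rewrite -leqNgt leq_eqVlt.
  move=> /orP [/eqP/val_inj/perm_inj ->|/lt1 ji]; first by rewrite lex_lt_irr.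
  by apply/negP => /lex_lt_trans /(_ ji); rewrite lex_lt_irr.
apply/permP => i; apply: val_inj; rewrite /= std_permE /rank.
rewrite (eq_card (B := [pred j | (w j < w i)%N])); last by move=> j; rewrite !inE ltE.
rewrite -(card_image (@perm_inj _ w)) (eq_card (B := [pred j : 'I_n | (j < w i)%N])); last first.
  move=> j; rewrite inE; apply/fintype.imageP/idP => [[k kw ->]|jw]; first by rewrite inE in kw.
  by exists ((w^-1)%g j); rewrite ?inE permKV.
rewrite -sum1_card (eq_bigl (fun j : 'I_n => (j < w i)%N)) //.
by rewrite -(big_ord_widen n (fun=> 1%N)) ?(ltnW (ltn_ord _)) // sum1_card card_ord.
Qed.

(** A word amounts to its standardization together with its sorted letters, which are compatible
    with the descents of the inverse. Ties are numbered from left to right, so the strict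
    inversions, which are all that [F] sees, stay the same. *)
Lemma sum_standardization (R : comNzRingType) (F : {ffun 'I_n * 'I_n -> bool} -> R) (x : 'I_N -> R) :
  \sum_(w : 'S_n) F [ffun p : 'I_n * 'I_n => (p.1 < p.2)%N && (w p.2 < w p.1)%N] *
     (\sum_(a : {ffun 'I_n -> 'I_N} | compatible w a) \prod_(j < n) x (a j)) =
  \sum_(c : n.-tuple 'I_N) F [ffun p : 'I_n * 'I_n => (p.1 < p.2)%N && (tnth c p.2 < tnth c p.1)%N] *
     \prod_(i < n) x (tnth c i).
Proof.
under eq_bigr do rewrite mulr_sumr.
rewrite pair_big_dep /= (reindex_onto (fun c => (std_perm c, std_colours c))
   (fun p => [tuple p.2 (p.1 i) | i < n])) /=; last first.
  move=> [w a] /= wa; rewrite std_unique //; congr (_, _).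
  by apply/ffunP => j; rewrite ffunE std_unique // tnth_mktuple permKV.
have cK c : [tuple (std_colours c) (std_perm c i) | i < n] = c.
  by apply: eq_from_tnth => i; rewrite tnth_mktuple ffunE permK.
apply: eq_big => [c|c _]; first by rewrite std_compatible cK eqxx.
congr (F _ * _).
  apply/ffunP => -[i j]; rewrite !ffunE /= !std_permE rank_ltE /lex_lt.
  by case: (ltnP i j) => //= ij; rewrite -val_eqE /=; lia.
rewrite (reindex_inj (@perm_inj _ (std_perm c))) /=.
by apply: eq_bigr => i _; rewrite ffunE permK.
Qed.

End Standardization.

(** * Weights of colourings as inversion statistics *)

Section Weights.

Variables (R : comNzRingType) (q : R) (N : nat) (s : seq int) (ls : int -> bool).
Hypothesis so : sorted <%R s.

(** These indicators make a colouring count only if the pair (t - 3, t) is inverted exactly when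
    [ls t]. If t - 3 is absent, its colour [N] always selects the plain link, which must be 1. *)
Definition link_plain (t : int) : R := if t - 3 \in s then (~~ ls t)%:R else 1.
Definition link_inverted (t : int) : R := (ls t)%:R.

Lemma prod_indicator n (a : nat -> nat) (b : nat -> bool) :
  \prod_(0 <= k < n) (q ^+ a k * (b k)%:R) =
  if all b (iota 0 n) then q ^+ (\sum_(0 <= k < n) a k) else 0.
Proof.
rewrite big_split /= -expr_sum; case: ifP => [/allP h|/negbT /allPn [k + nb]].
  rewrite [X in _ * X]big_nat_cond [X in _ * X]big1 ?mulr1 // => k /andP [/andP [_ kn] _].
  by rewrite h // mem_iota.
rewrite mem_iota /= add0n => kn.
by rewrite [X in _ * X](bigD1_seq k) /= ?mem_index_iota ?iota_uniq // (negPf nb) mul0r mulr0.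
Qed.

Definition near_inversions (c : seq nat) (k : nat) : nat :=
  ((colour N s c (nth 0 s k - 1)%R < nth N c k) + (colour N s c (nth 0 s k - 2)%R < nth N c k))%N.

Definition far_inversion (c : seq nat) (k : nat) : bool :=
  (colour N s c (nth 0 s k - 3)%R < nth N c k)%N.

Definition square_closed (c : seq nat) (k : nat) : bool :=
  block (mult (take k c)) (colour N s c (nth 0 s k - 1)%R) (colour N s c (nth 0 s k - 2)%R)
        (colour N s c (nth 0 s k - 3)%R) (nth N c k).

Lemma link_indicator k (b : bool) :
  (nth 0 s k - 3 \notin s -> ~~ b) ->
  (if b then link_inverted (nth 0 s k) else link_plain (nth 0 s k)) =
  ((nth 0 s k - 3 \in s) ==> (b == ls (nth 0 s k)))%:R.
Proof.
rewrite /link_plain /link_inverted.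
case: (boolP (_ \in s)) => [_ _|_ /(_ isT)/negbTE -> //] /=.
by case: b; case: (ls _).
Qed.

Lemma colour_weightE (c : seq nat) : size c = size s -> all (fun j => j < N)%N c ->
  colour_weight q N link_plain link_inverted s c =
  if all (fun k => (nth 0 s k - 3 \in s) ==> (far_inversion c k == ls (nth 0 s k))) (iota 0 (size s))
  then q ^+ (\sum_(0 <= k < size s) near_inversions c k) else 0.
Proof.
move=> sz cN; rewrite -prod_indicator; apply: eq_big_nat => k /andP [_ kn].
rewrite /letter_factor /colour_step -/(near_inversions c k); congr (_ * _).
rewrite -link_indicator // => a; rewrite /far_inversion colour_notin // -leqNgt ltnW //.
by have /allP := cN; apply; rewrite mem_nth ?sz.
Qed.

Lemma tableau_weightE (c : seq nat) : size c = size s -> all (fun j => j < N)%N c ->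
  tableau_weight q N link_plain link_inverted s c =
  if all (fun k => addable (mult (take k c)) (nth N c k)) (iota 0 (size s)) &&
     all (fun k => (nth 0 s k - 3 \in s) ==>
        ((far_inversion c k && ~~ square_closed c k) == ls (nth 0 s k))) (iota 0 (size s))
  then q ^+ (\sum_(0 <= k < size s) near_inversions c k) else 0.
Proof.
move=> sz cN; rewrite -all_predI -prod_indicator; apply: eq_big_nat => k /andP [_ kn] /=.
rewrite /letter_factor /tableau_step; case: ifP => _; last by rewrite mulr0.
rewrite /stdstep -/(near_inversions c k) -/(square_closed c k); congr (_ * _).
rewrite -link_indicator //; last first.
  move=> a; rewrite negb_and /far_inversion colour_notin // -leqNgt ltnW //.
  by have /allP := cN; apply; rewrite mem_nth ?sz.
by rewrite /link /far_inversion; case: (square_closed c k); rewrite ?andbF ?andbT.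
Qed.

Lemma lt_sorted_uniq : uniq s.
Proof. by apply: (sorted_uniq lt_trans) so; apply: ltxx. Qed.

Lemma sum_at_letter (c : seq nat) (P : pred nat) (t : int) : size c = size s ->
  ~~ P N -> (\sum_(i < size s) ((nth 0%R s i == t) && P (nth N c i)))%N = P (colour N s c t).
Proof.
move=> sz PN; case: (boolP (t \in s)) => ts; last first.
  rewrite colour_notin // (negPf PN) big1 // => i _.
  by apply/eqP; rewrite eqb0 negb_and; apply/orP; left; apply: contraNneq ts => <-; rewrite mem_nth.
have it : (index t s < size s)%N by rewrite index_mem.
rewrite (bigD1 (Ordinal it)) //= nth_index // eqxx /= big1 ?addn0 // => i ne.
apply/eqP; rewrite eqb0 negb_and; apply/orP; left; apply: contraNneq ne => e.
by apply/eqP/val_inj; rewrite /= -e index_uniq ?lt_sorted_uniq.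
Qed.

Lemma sum_near_pairs (c : seq nat) : size c = size s -> all (fun j => j < N)%N c ->
  (\sum_(k < size s) \sum_(i < size s)
    ((nth N c i < nth N c k) && (0 < nth 0 s k - nth 0 s i < 3)%R))%N =
  (\sum_(0 <= k < size s) near_inversions c k)%N.
Proof.
move=> sz cN; rewrite big_mkord; apply: eq_bigr => k _; have ck : (nth N c k < N)%N.
  by have /allP := cN; apply; rewrite mem_nth ?sz.
rewrite /near_inversions -!(sum_at_letter (P := fun j => j < nth N c k)%N) -?leqNgt ?(ltnW ck) //.
rewrite -big_split /=; apply: eq_bigr => i _.
move: (nth N c i < _)%N => b; move: (nth 0 s i) (nth 0 s k) => u v.
by case: b; rewrite ?andbF //= ?andbT; lia.
Qed.

Lemma card_near_pairs (c : seq nat) : size c = size s -> all (fun j => j < N)%N c ->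
  #|[set p : 'I_(size s) * 'I_(size s) |
       [&& (p.1 < p.2)%N, (nth N c p.1 < nth N c p.2)%N & 0 < nth 0 s p.2 - nth 0 s p.1 < 3]]| =
  (\sum_(0 <= k < size s) near_inversions c k)%N.
Proof.
move=> sz cN; rewrite -sum1dep_card -sum_near_pairs // exchange_big pair_big /= big_mkcond.
apply: eq_bigr => -[i k] _ /=.
have e : (i < k)%N = (nth 0 s i < nth 0 s k) by rewrite (lt_sorted_ltn_nth 0 so) // inE.
have -> : [&& (i < k)%N, (nth N c i < nth N c k)%N, 0 < nth 0 s k - nth 0 s i & nth 0 s k - nth 0 s i < 3]
   = (nth N c i < nth N c k)%N && (0 < nth 0 s k - nth 0 s i < 3).
  rewrite e; move: (nth N c i < _)%N => b; move: (nth 0 s i) (nth 0 s k) => u v.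
  by case: b; rewrite ?andbF //=; lia.
by case: (_ && _).
Qed.

Lemma far_pairs (c : seq nat) : size c = size s ->
  [forall p : 'I_(size s) * 'I_(size s), (nth 0 s p.2 - nth 0 s p.1 == 3) ==>
      ((p.1 < p.2)%N && (nth N c p.1 < nth N c p.2)%N == ls (nth 0 s p.2))] =
  all (fun k => (nth 0 s k - 3 \in s) ==> (far_inversion c k == ls (nth 0 s k))) (iota 0 (size s)).
Proof.
move=> sz; have colE i k : (i < size s)%N -> nth 0 s k - nth 0 s i = 3 ->
    colour N s c (nth 0 s k - 3) = nth N c i.
  move=> hi e; rewrite /colour (_ : _ - 3 = nth 0 s i) ?index_uniq ?lt_sorted_uniq //.
  by rewrite -e; lia.
have lt i k : (i < size s)%N -> (k < size s)%N -> nth 0 s k - nth 0 s i = 3 -> (i < k)%N.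
  move=> hi hk e; by rewrite -(lt_sorted_ltn_nth 0 so) ?inE // -subr_gt0 e.
apply/forallP/allP => [h k|h [i k] /=].
  rewrite mem_iota /= add0n => hk; apply/implyP => h3.
  have hi : (index (nth 0 s k - 3)%R s < size s)%N by rewrite index_mem.
  have e : nth 0 s k - nth 0 s (index (nth 0 s k - 3) s) = 3 by rewrite nth_index // opprB addrC subrK.
  have /implyP := h (Ordinal hi, Ordinal hk); rewrite /= e => /(_ (eqxx _)).
  by rewrite (lt _ _ hi hk e) /far_inversion (colE _ _ hi e).
apply/implyP => /eqP e; rewrite (lt i k) //=.
have := h k; rewrite mem_iota /= add0n ltn_ord => /(_ isT).
have e3 : nth 0 s k - 3 = nth 0 s i by rewrite -[X in _ - X]e opprB addrC subrK.
by rewrite /far_inversion (colE i k) // e3 mem_nth.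
Qed.

End Weights.

(** * Contents of skew shapes without squares *)

Lemma mem_cells (b : skew_shape) (z : cell) :
  (z \in cells b) = (z.2 < rowlen (outer b) z.1)%N && (rowlen (inner b) z.1 <= z.2)%N.
Proof. by rewrite mem_filter !mem_diagram -leqNgt andbC. Qed.

Lemma cells_convex (b : skew_shape) (z y z' : cell) : z \in cells b -> z' \in cells b ->
  le_se z y -> le_se y z' -> y \in cells b.
Proof.
rewrite !mem_cells => /andP [_ h1] /andP [h2 _] /andP [r1 c1] /andP [r2 c2].
apply/andP; split; first by apply: leq_ltn_trans c2 _; apply: leq_trans h2 _; apply: rowlen_le.
by apply: leq_trans c1; apply: leq_trans h1; apply: rowlen_le.
Qed.

(** Skew shapes are convex, so the 2 x 2 square with northwest corner [z] would lie inside. Hence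
    each content occurs once, and consecutive contents belong to adjacent cells. *)
Lemma no_square_lt_se (b : skew_shape) (z z' : cell) : no_square b ->
  z \in cells b -> z' \in cells b -> ~~ lt_se z z'.
Proof.
move=> nb zb z'b; apply/negP => /andP [r c]; case/negP: (nb z.1 z.2).
apply/and4P; split; first by rewrite -surjective_pairing.
all: by apply: (cells_convex zb z'b); rewrite /le_se /= ?leqnn ?leqnSn ?(ltnW r) ?(ltnW c) ?r ?c.
Qed.

Lemma content_inj (b : skew_shape) (z z' : cell) : no_square b ->
  z \in cells b -> z' \in cells b -> content z = content z' -> z = z'.
Proof.
move=> nb zb z'b; have := no_square_lt_se nb zb z'b; have := no_square_lt_se nb z'b zb.
case: z z' {zb z'b} => [r c] [r' c']; rewrite /lt_se /content /= => h1 h2 e.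
by congr (_, _); lia.
Qed.

Lemma content_adjacent (b : skew_shape) (z z' : cell) : no_square b ->
  z \in cells b -> z' \in cells b -> content z = content z' + 1 -> east z' z || south z z'.
Proof.
move=> nb zb z'b; have := no_square_lt_se nb zb z'b; have := no_square_lt_se nb z'b zb.
case: z z' {zb z'b} => [r c] [r' c']; rewrite /lt_se /content /east /south /= => h1 h2 e.
by rewrite !xpair_eqE; lia.
Qed.

Section Tuple.

Variable (beta : 'I_3 -> skew_shape).
Hypothesis hbeta : forall i, no_square (beta i).

Lemma mem_tcells (z : 'I_3 * cell) : (z \in tcells beta) = (z.2 \in cells (beta z.1)).
Proof.
case: z => i z /=; apply/allpairsPdep/idP => [[i' [z' [_ h [-> ->]]]] //|h].
by exists i, z; rewrite mem_enum.
Qed.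

Lemma uniq_diagram (p : intpart) : uniq (diagram p).
Proof.
apply: allpairs_uniq_dep => [|r _|]; rewrite ?iota_uniq //.
by move=> [r c] [r' c'] _ _ /= [-> ->].
Qed.

Lemma uniq_tcells : uniq (tcells beta).
Proof.
apply: allpairs_uniq_dep => [|i _|]; rewrite ?enum_uniq ?filter_uniq ?uniq_diagram //.
by move=> [r c] [r' c'] _ _ /= [-> ->].
Qed.

(** The residue of a shifted content modulo 3 names the component. *)
Lemma scontent_diff (d : int) (z z' : 'I_3 * cell) : scontent z = scontent z' + 3 * d ->
  z.1 = z'.1 /\ content z.2 = content z'.2 + d.
Proof.
case: z z' => [i z] [i' z']; rewrite /scontent /= => e.
have hi := ltn_ord i; have hi' := ltn_ord i'.
by split; first apply: val_inj => /=; lia.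
Qed.

Lemma scontent_inj : {in tcells beta &, injective (@scontent 3)}.
Proof.
move=> z z'; rewrite !mem_tcells => hz hz' e.
have [e1 e2] : z.1 = z'.1 /\ content z.2 = content z'.2 + 0.
  by apply: scontent_diff; rewrite e mulr0 addr0.
case: z z' e1 e2 hz hz' {e} => [i z] [i' z'] /= <- e2 hz hz'; congr (_, _).
by apply: (content_inj (hbeta i)) => //; rewrite e2 addr0.
Qed.

Definition letters : seq int := sort <=%R [seq scontent z | z <- tcells beta].

Lemma size_letters : size letters = ncells beta.
Proof. by rewrite size_sort size_map. Qed.

Lemma mem_letters t : (t \in letters) = (t \in [seq scontent z | z <- tcells beta]).
Proof. exact: mem_sort. Qed.

Lemma uniq_letters : uniq letters.
Proof. by rewrite sort_uniq map_inj_in_uniq ?uniq_tcells //; apply: scontent_inj. Qed.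

Lemma letters_sorted : sorted <%R letters.
Proof. by rewrite lt_sorted_uniq_le uniq_letters (sort_sorted le_total). Qed.

Lemma letters_st : letters = [seq scontent z | z <- sort (@st_le 3) (tcells beta)].
Proof.
apply: (@homo_sort_map_in _ _ (mem (tcells beta))); last by apply/allP.
- by move=> z z' hz hz' /le_anti; apply: scontent_inj.
- by move=> z1 z2 z3 _ _ _; apply: le_trans.
- move=> z z' hz hz'; rewrite /st_le; case: ltgtP => //= e.
  by rewrite (scontent_inj hz hz' e) /le_se !leqnn.
by move=> z z' _ _ /orP [/ltW|/andP [/eqP ->]].
Qed.

Lemma st_letters z : z \in tcells beta -> st beta z = index (scontent z) letters.
Proof.
move=> hz; rewrite letters_st /st.
have hz' : z \in sort (@st_le 3) (tcells beta) by rewrite mem_sort.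
have inj : {in sort (@st_le 3) (tcells beta) &, injective (@scontent 3)}.
  by move=> x y; rewrite !mem_sort; apply: scontent_inj.
rewrite -{1}(nth_index_map z inj hz') index_uniq ?sort_uniq ?uniq_tcells //.
by rewrite -(size_map (@scontent 3)) index_mem map_f.
Qed.

Definition letter_south (t : int) : bool :=
  has (fun z => has (fun z' => [&& z.1 == z'.1, scontent z == t, scontent z' == t - 3 & south z.2 z'.2])
    (tcells beta)) (tcells beta).

(** Letters at distance 3 come from adjacent cells of one component, and the cell of larger content
    is east or north of the other; only in the latter case is it the smaller one in the southeast
    order. *)
Lemma mem_descent_data (ij : 'I_(ncells beta) * 'I_(ncells beta)) :
  (ij \in descent_data beta) =
  (nth 0 letters ij.2 - nth 0 letters ij.1 == 3) && letter_south (nth 0 letters ij.2).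
Proof.
rewrite inE; apply/hasP/andP => [[z hz /hasP [z' hz']]|[/eqP e /hasP [z hz /hasP [z' hz']]]].
  move=> /and5P [/eqP i1 /eqP i2 /eqP e1 /eqP e2 /andP [ne le]].
  rewrite i1 i2 !st_letters // !nth_index ?mem_letters ?map_f //; split.
    by rewrite e2 addrAC subrr add0r.
  apply/hasP; exists z => //; apply/hasP; exists z' => //; rewrite e1 e2 addrK !eqxx /=.
  have [_ ec] := scontent_diff (d := 1) e2.
  rewrite mem_tcells in hz; rewrite mem_tcells -e1 in hz'.
  have := content_adjacent (hbeta _) hz hz' ec; case/orP => // /eqP ez.
  by move: le; rewrite ez /le_se /= ltnn andbF.
move=> /and4P [/eqP e1 /eqP ez /eqP ez' so].
exists z => //; apply/hasP; exists z' => //.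
have e3 : nth 0 letters ij.2 - 3 = nth 0 letters ij.1 by rewrite -[X in _ - X]e opprB addrC subrK.
rewrite !st_letters // e1 ez ez' e3 !index_uniq ?size_letters ?uniq_letters // !eqxx /=.
rewrite -e3 subrK eqxx /=; move/eqP: so => ->; rewrite /le_se /= leqnn leqnSn !andbT.
by apply/eqP => h; have := congr1 fst h => /= /eqP; rewrite (ltn_eqF (ltnSn _)).
Qed.

Lemma letter_southE (z z' : 'I_3 * cell) : z \in tcells beta -> z' \in tcells beta ->
  scontent z = scontent z' + 3 -> letter_south (scontent z) = south z.2 z'.2.
Proof.
move=> hz hz' e; apply/hasP/idP => [[y hy /hasP [y' hy']]|h].
  move=> /and4P [_ /eqP ey /eqP ey' so].
  have <- : y = z by apply: scontent_inj.
  by have <- : y' = z' by apply: scontent_inj; rewrite // ey' e addrK.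
exists z => //; apply/hasP; exists z' => //.
have [-> _] := scontent_diff (d := 1) e.
by rewrite e addrK !eqxx.
Qed.

Lemma south_adjacent (z z' : 'I_3 * cell) : z \in tcells beta -> z' \in tcells beta ->
  scontent z = scontent z' + 3 -> east z'.2 z.2 = ~~ south z.2 z'.2.
Proof.
move=> hz hz' e; have [e1 ec] := scontent_diff (d := 1) e.
rewrite mem_tcells in hz; rewrite mem_tcells -e1 in hz'.
have := content_adjacent (hbeta _) hz hz' ec; rewrite /east /south.
by case: eqP => [->|_] //=; [rewrite {1}(surjective_pairing z'.2) xpair_eqE /= (ltn_eqF (ltnSn _))|move=> ->].
Qed.

(** Adjacent cells are the letters t - 3 and t: a vertical pair requires t first, a horizontal pair
    t - 3 first. *)
Lemma Wprime_letters (v : seq int) : Wprime beta v <->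
  perm_eq v letters /\ forall t : int, t \in letters -> t - 3 \in letters ->
     (index t v < index (t - 3)%R v)%N = letter_south t.
Proof.
rewrite /Wprime perm_sym -(perm_sort <=%R) perm_sym -/letters; split=> [[pv h]|[pv h]]; split=> //.
  move=> t ht ht'; have [z hz zE] : exists2 z, z \in tcells beta & t = scontent z.
    by apply/mapP; rewrite -mem_letters.
  have [z' hz' zE'] : exists2 z', z' \in tcells beta & t - 3 = scontent z'.
    by apply/mapP; rewrite -mem_letters.
  have e : scontent z = scontent z' + 3 by rewrite -zE -zE' subrK.
  have [e1 _] := scontent_diff (d := 1) e.
  rewrite zE' zE (letter_southE hz hz' e); have se := south_adjacent hz hz' e.
  have mz := hz; have mz' := hz'; rewrite mem_tcells in mz; rewrite mem_tcells -e1 in mz'.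
  case: (boolP (south z.2 z'.2)) se => so se.
    have := h z.1 z.2 z'.2 mz mz'; rewrite so orbT => /(_ isT).
    by rewrite -surjective_pairing e1 -surjective_pairing.
  have := h z.1 z'.2 z.2 mz' mz; rewrite se => /(_ isT).
  by rewrite -surjective_pairing {1}e1 -surjective_pairing => lt; apply/negbTE; rewrite -leqNgt ltnW.
move=> i z z' hz hz'.
have tz : (i, z) \in tcells beta by rewrite mem_tcells.
have tz' : (i, z') \in tcells beta by rewrite mem_tcells.
have lz : scontent (i, z) \in letters by rewrite mem_letters map_f.
have lz' : scontent (i, z') \in letters by rewrite mem_letters map_f.
case/orP => a.
  have e : scontent (i, z') = scontent (i, z) + 3.
    by rewrite (eqP a) /scontent /content /=; lia.
  have e3 : scontent (i, z') - 3 = scontent (i, z) by rewrite e addrK.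
  have := h _ lz'; rewrite e3 => /(_ lz); rewrite (letter_southE tz' tz e).
  have := south_adjacent tz' tz e; rewrite /= a => /esym/negbTE -> /negbT; rewrite -leqNgt leq_eqVlt.
  case/orP => // /eqP ie; have vz : scontent (i, z) \in v by rewrite (perm_mem pv).
  have vz' : scontent (i, z') \in v by rewrite (perm_mem pv).
  have := congr1 (nth 0 v) ie; rewrite !nth_index // => e0.
  by move/eqP: e; rewrite -e0 -subr_eq0 opprD addrA subrr.
have e : scontent (i, z) = scontent (i, z') + 3.
  by rewrite (eqP a) /scontent /content /=; lia.
have e3 : scontent (i, z) - 3 = scontent (i, z') by rewrite e addrK.
by have := h _ lz; rewrite e3 => /(_ lz'); rewrite (letter_southE tz tz' e) /= a.
Qed.

Section Colourings.

Variable N : nat.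

Let R := {mpoly {poly int}[N]}.

Definition qvar : R := ('X : {poly int})%:MP.

Definition pair_weight (n : nat) (cv : 'I_n -> int) (b : {ffun 'I_n * 'I_n -> bool}) : R :=
  if [forall p : 'I_n * 'I_n, (cv p.2 - cv p.1 == 3) ==> (b p == letter_south (cv p.2))]
  then qvar ^+ #|[set p : 'I_n * 'I_n | b p && (0 < cv p.2 - cv p.1 < 3)]| else 0.

Lemma nth_letters_lt (i j : nat) : (i < ncells beta)%N -> (j < ncells beta)%N ->
  (nth 0 letters i < nth 0 letters j) = (i < j)%N.
Proof. by move=> hi hj; rewrite (lt_sorted_ltn_nth 0 letters_sorted) // inE size_letters. Qed.

Lemma LLT_pair_weight : LLT beta N =
  \sum_(c : (ncells beta).-tuple 'I_N)
     pair_weight (@content_vector _ beta) [ffun p : 'I_(ncells beta) * 'I_(ncells beta) => (p.1 < p.2)%N && (tnth c p.2 < tnth c p.1)%N] *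
     \prod_i 'X_(tnth c i).
Proof.
apply: etrans (@sum_standardization _ N R (pair_weight (@content_vector _ beta)) (fun i => 'X_i)).
rewrite /LLT big_mkcond; apply: eq_bigr => w _.
(* Without repeated contents the ribbon condition is vacuous. *)
have -> : ribbon_word 3 (fun i => w i) (@content_vector _ beta).
  apply/forallP => i; apply/forallP => i'; apply/implyP => /andP [/eqP ii /eqP e].
  have := nth_letters_lt (ltn_ord i) (ltn_ord i'); rewrite -[nth 0 letters i]/(content_vector i) e.
  by rewrite ltxx ii ltnSn.
rewrite /= /pair_weight.
have -> : (Des_k 3 (fun i => w i) (@content_vector _ beta) == descent_data beta) =
  [forall p : 'I_(ncells beta) * 'I_(ncells beta), (content_vector p.2 - content_vector p.1 == 3) ==>
   ([ffun p : 'I_(ncells beta) * 'I_(ncells beta) => (p.1 < p.2)%N && (w p.2 < w p.1)%N] p == letter_south (content_vector p.2))].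
  apply/eqP/forallP => [/setP h p|h].
    apply/implyP => e; have := h p; rewrite mem_descent_data inE ffunE -!/(content_vector _) e /= andbT.
    by move=> ->.
  apply/setP => p; rewrite mem_descent_data inE -!/(content_vector _).
  have := h p; rewrite ffunE; case: eqP => //= _; last by rewrite !andbF.
  by rewrite andbT => /eqP.
case: ifP => _; last by rewrite mul0r.
rewrite -mul_mpolyC rmorphXn /=; congr (_ ^+ _ * _).
  by apply: eq_card => p; rewrite !inE ffunE -andbA.
apply: eq_bigl => a; apply: eq_forallb => j; apply: eq_forallb => j'.
case: eqP => //= jj; congr (_ && (_ ==> _)).
rewrite inE; apply/existsP/idP => [[j'' /andP [/eqP e]]|h].
  by have -> : j'' = j' by apply: val_inj; rewrite /= e jj.
by exists j'; rewrite jj eqxx.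
Qed.

End Colourings.

End Tuple.

Lemma prod_mult (R : comNzRingType) (N : nat) (c : seq 'I_N) (y : 'I_N -> R) :
  \prod_(j <- c) y j = \prod_(j < N) y j ^+ mult (vals c) j.
Proof.
elim: c => [|i c IH]; first by rewrite big_nil big1.
rewrite big_cons IH (bigD1 i) //= [in RHS](bigD1 i) //= mulrA; congr (_ * _).
  by rewrite /mult /= eqxx add1n exprS.
apply: eq_bigr => j ji; rewrite /mult /=.
by rewrite -[_ == _ :> nat]/(i == j) eq_sym (negPf ji).
Qed.

Section ColourSum.

Variables (N : nat) (s : seq int) (ls : int -> bool).
Hypothesis so : sorted <%R s.

Let R := {mpoly {poly int}[N]}.

(** The LLT polynomial counts descents of the colours along increasing contents, [colsum] counts
    ascents. Reversing the colours exchanges them, and the symmetry of the colour sum absorbs the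
    reversal of the variables. *)
Definition flip_colours (n : nat) (c : n.-tuple 'I_N) : n.-tuple 'I_N := [tuple of map (@rev_ord N) c].

Lemma flipK n : involutive (@flip_colours n).
Proof.
by move=> c; apply: eq_from_tnth => i; rewrite !tnth_map rev_ordK.
Qed.

Lemma flip_ltn (n : nat) (c : n.-tuple 'I_N) (i j : 'I_n) :
  (tnth (flip_colours c) j < tnth (flip_colours c) i)%N = (nth N (vals c) i < nth N (vals c) j)%N.
Proof.
rewrite !tnth_map /vals.
have e (k : 'I_n) : nth N (map (@nat_of_ord N) c) k = tnth c k.
  by rewrite (nth_map (tnth c k)) ?size_tuple // -tnth_nth.
rewrite !e /=; have := ltn_ord (tnth c i); have := ltn_ord (tnth c j); lia.
Qed.

Lemma all_vals (c : seq 'I_N) : all (fun j => j < N)%N (vals c).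
Proof. by apply/allP => _ /mapP [j _ ->]. Qed.

Lemma pair_weight_colour (n : nat) : size s = n ->
  \sum_(c : n.-tuple 'I_N)
    (if [forall p : 'I_n * 'I_n, (nth 0 s p.2 - nth 0 s p.1 == 3) ==>
        (([ffun p : 'I_n * 'I_n => (p.1 < p.2)%N && (tnth c p.2 < tnth c p.1)%N] : {ffun 'I_n * 'I_n -> bool}) p
          == ls (nth 0 s p.2))]
     then qvar N ^+ #|[set p : 'I_n * 'I_n |
        ([ffun p : 'I_n * 'I_n => (p.1 < p.2)%N && (tnth c p.2 < tnth c p.1)%N] : {ffun 'I_n * 'I_n -> bool}) p
          && (0 < nth 0 s p.2 - nth 0 s p.1 < 3)]| else 0)
    * \prod_i 'X_(tnth c i) =
  \sum_(c : (size s).-tuple 'I_N)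
     colour_weight (qvar N) N (link_plain R s ls) (link_inverted R ls) s (vals c)
     * \prod_i ('X_i : R) ^+ mult (vals c) i.
Proof.
move=> sn; case: _ / sn.
rewrite -(colour_sum_perm _ _ _ so (perm (@rev_ord_inj N)) (fun i => 'X_i : R)).
rewrite (reindex_inj (inv_inj (@flipK (size s)))) /=; apply: eq_bigr => c _.
have sz : size (vals c) = size s by rewrite size_map size_tuple.
congr (_ * _); last first.
  rewrite -(prod_mult c (fun i => 'X_((perm (@rev_ord_inj N)) i))) big_tuple.
  by apply: eq_bigr => i _; rewrite tnth_map permE.
rewrite colour_weightE ?all_vals // -far_pairs // -card_near_pairs ?all_vals //.
set b := [forall p, _]; set b' := [forall p, _].
have -> : b = b'.
  by apply: eq_forallb => p; rewrite ffunE flip_ltn.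
case: ifP => _ //; congr (_ ^+ _); apply: eq_card => p; rewrite !inE ffunE flip_ltn.
by rewrite -!andbA.
Qed.

End ColourSum.

Lemma LLT_colour_sum (beta : 'I_3 -> skew_shape) (hbeta : forall i, no_square (beta i)) (N : nat) :
  LLT beta N = \sum_(c : (size (letters beta)).-tuple 'I_N)
     colour_weight (qvar N) N (link_plain _ (letters beta) (letter_south beta))
       (link_inverted _ (letter_south beta)) (letters beta) (vals c)
     * \prod_i ('X_i : {mpoly {poly int}[N]}) ^+ mult (vals c) i.
Proof.
rewrite -(@pair_weight_colour N _ (letter_south beta) (letters_sorted hbeta) _ (size_letters beta)).
exact: LLT_pair_weight.
Qed.

(** * Reading words of tableaux *)

Section Reading.

Variables (p : intpart) (T : {ffun seq_sub (diagram p) -> int}).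
Let D := seq_sub (diagram p).
Implicit Types (z u : D).

Definition diagonal_cells (d : int) : seq D :=
  [seq z <- rev (Defs.diagonal p d) | nw_tail T z] ++ [seq z <- Defs.diagonal p d | ~~ nw_tail T z].

Definition reading_cells : seq D :=
  flatten [seq diagonal_cells (j%:Z - (size (val p))%:Z)
          | j <- iota 1 (size (val p) + head 0%N (val p)).-1].

Lemma sqread_cells : sqread T = [seq T z | z <- reading_cells].
Proof.
rewrite /sqread /reading_cells map_flatten -map_comp; congr flatten.
by apply: eq_map => j; rewrite /= /diagonal_word /diagonal_cells map_cat.
Qed.

Lemma mem_diagonal d z : (z \in Defs.diagonal p d) = (content (val z) == d).
Proof. by rewrite mem_sort mem_enum inE. Qed.

Lemma mem_diagonal_cells d z : (z \in diagonal_cells d) = (content (val z) == d).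
Proof.
rewrite mem_cat !mem_filter mem_rev mem_diagonal.
by case: (nw_tail T z) => /=; rewrite ?orbF.
Qed.

Lemma uniq_diagonal d : uniq (Defs.diagonal p d).
Proof. by rewrite sort_uniq enum_uniq. Qed.

(** The order of [reading_cells] in closed form; [index_reading] proves the agreement. *)
Definition read_before z u : bool :=
  (content (val z) < content (val u)) ||
  (content (val z) == content (val u)) &&
    (if nw_tail T z then nw_tail T u ==> le_se (val u) (val z)
     else ~~ nw_tail T u && le_se (val z) (val u)).

Lemma le_se_trans : transitive le_se.
Proof. by move=> y x z /andP [a b] /andP [c d]; apply/andP; split; apply: leq_trans; eauto. Qed.

Lemma le_se_anti (z u : cell) : le_se z u -> le_se u z -> z = u.
Proof.
case: z u => [r c] [r' c'] /andP [/= a b] /andP [/= a' b'].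
by congr (_, _); apply/eqP; rewrite eqn_leq ?a ?b.
Qed.

Lemma before_anti z u : read_before z u -> read_before u z -> z = u.
Proof.
rewrite /read_before; case: ltgtP => //= _.
by case: ifP => _; case: ifP => _ //= a b; apply: val_inj; apply: le_se_anti.
Qed.

Lemma diagonal_sorted d : pairwise (fun z u => le_se (val z) (val u)) (Defs.diagonal p d).
Proof.
rewrite -sorted_pairwise; last by move=> y x z; apply: le_se_trans.
apply: (@sort_sorted_in _ [pred z : D | content (val z) == d]); last first.
  by apply/allP => z; rewrite mem_enum.
move=> z u; rewrite !inE => /eqP <- /eqP; rewrite /content /le_se; lia.
Qed.

Lemma diagonal_cells_pairwise d : pairwise read_before (diagonal_cells d).
Proof.
have same z u : z \in diagonal_cells d -> u \in diagonal_cells d -> content (val z) = content (val u).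
  by rewrite !mem_diagonal_cells => /eqP -> /eqP ->.
have sub (P : pred D) r : subseq [seq z <- r | P z] r by apply: filter_subseq.
rewrite /diagonal_cells pairwise_cat; apply/and3P; split.
- apply/allrelP => z u hz hu; rewrite /read_before (same z u) ?mem_cat ?hz ?hu ?orbT // eqxx ltxx /=.
  by move: hz hu; rewrite !mem_filter => /andP [-> _] /andP [/negbTE -> _].
- have : pairwise (fun z u => le_se (val u) (val z)) [seq z <- rev (Defs.diagonal p d) | nw_tail T z].
    apply: (subseq_pairwise (sub _ _)); rewrite -sorted_pairwise.
      by rewrite rev_sorted sorted_pairwise ?diagonal_sorted // => y x z; apply: le_se_trans.
    by move=> y x z a b; apply: le_se_trans b a.
  apply: (@sub_in_pairwise _ [pred z | (z \in diagonal_cells d) && nw_tail T z]); last first.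
    by apply/allP => z hz; rewrite inE mem_cat hz /=; move: hz; rewrite mem_filter => /andP [].
  move=> z u /andP [hz tz] /andP [hu tu] le.
  by rewrite /read_before (same z u) // eqxx ltxx tz tu.
have : pairwise (fun z u => le_se (val z) (val u)) [seq z <- Defs.diagonal p d | ~~ nw_tail T z].
  by apply: (subseq_pairwise (sub _ _)); apply: diagonal_sorted.
apply: (@sub_in_pairwise _ [pred z | (z \in diagonal_cells d) && ~~ nw_tail T z]); last first.
  by apply/allP => z hz; rewrite inE mem_cat hz orbT /=; move: hz; rewrite mem_filter => /andP [].
move=> z u /andP [hz /negbTE tz] /andP [hu /negbTE tu] le.
by rewrite /read_before (same z u) // eqxx ltxx tz tu.
Qed.

Lemma flatten_pairwise (js : seq nat) : sorted ltn js ->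
  pairwise read_before (flatten [seq diagonal_cells (j%:Z - (size (val p))%:Z) | j <- js]).
Proof.
elim: js => //= j js IH so; rewrite pairwise_cat diagonal_cells_pairwise IH ?(path_sorted so) // !andbT.
apply/allrelP => z u; rewrite mem_diagonal_cells => /eqP ez /flattenP [_ /mapP [i hi ->]].
rewrite mem_diagonal_cells => /eqP eu; rewrite /read_before ez eu.
have /allP /(_ i hi) /= := order_path_min ltn_trans so.
by move=> ji; rewrite ltrD2r ltz_nat ji.
Qed.

Lemma reading_pairwise : pairwise read_before reading_cells.
Proof. by apply: flatten_pairwise; apply: iota_ltn_sorted. Qed.

Lemma mem_reading z : z \in reading_cells.
Proof.
have := valP z; rewrite mem_diagram; set r := (val z).1; set c := (val z).2 => hc.
have hr : (r < size (val p))%N.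
  by rewrite ltnNge; apply/negP => /rowlen_default r0; rewrite r0 in hc.
have h0 : (rowlen p r <= head 0%N (val p))%N by rewrite -nth0; apply: rowlen_le.
apply/flattenP; exists (diagonal_cells (content (val z))); last by rewrite mem_diagonal_cells.
apply/mapP; exists (c + size (val p) - r)%N.
  rewrite mem_iota; lia.
congr diagonal_cells; rewrite /content -/r -/c; lia.
Qed.

Lemma uniq_reading : uniq reading_cells.
Proof.
rewrite /reading_cells; have : sorted ltn (iota 1 (size (val p) + head 0%N (val p)).-1) by apply: iota_ltn_sorted.
elim: (iota _ _) => //= j js IH so; rewrite cat_uniq IH ?(path_sorted so) // andbT.
rewrite /diagonal_cells cat_uniq !filter_uniq ?rev_uniq ?uniq_diagonal //= andbT.
apply/andP; split; apply/hasPn => z.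
  by rewrite mem_filter => /andP [h _]; rewrite mem_filter (negbTE h).
move=> /flattenP [_ /mapP [i hi ->]]; rewrite mem_diagonal_cells => /eqP ez.
apply/negP; rewrite -/(diagonal_cells _) mem_diagonal_cells ez => /eqP e.
have /allP /(_ i hi) /= := order_path_min ltn_trans so; lia.
Qed.

Lemma index_reading z u : z != u ->
  (index z reading_cells < index u reading_cells)%N = read_before z u.
Proof.
move=> zu; have H z1 u1 : (index z1 reading_cells < index u1 reading_cells)%N -> read_before z1 u1.
  move=> lt; have := reading_pairwise; move=> /(pairwiseP z1) /(_ (index z1 reading_cells) (index u1 reading_cells)).
  by rewrite !inE !index_mem !mem_reading !nth_index ?mem_reading //; apply.
apply/idP/idP => [/H //|b]; case: ltngtP => // [/H b'|e].
  by rewrite (before_anti b b') eqxx in zu.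
by case/eqP: zu; rewrite -(nth_index z (mem_reading z)) e nth_index ?mem_reading.
Qed.

Lemma perm_reading : perm_eq reading_cells (enum {: seq_sub (diagram p)}).
Proof.
apply: uniq_perm; rewrite ?uniq_reading ?enum_uniq // => z.
by rewrite mem_reading mem_enum.
Qed.

End Reading.

(** * Reading order against differences of entries *)

Section Geometry.

Variables (p : intpart) (T : {ffun seq_sub (diagram p) -> int}).
Hypotheses (T_rsst : RSST T) (T_inj : injective T).
Implicit Types (z u y : seq_sub (diagram p)).

Lemma rsstP z u : [/\ row_lt (val z) (val u) -> T z < T u,
  col_lt (val z) (val u) -> T z < T u & lt_se (val z) (val u) -> T z + 3 <= T u].
Proof.
have /forallP /(_ z) /forallP /(_ u) /and3P [/implyP a /implyP b /implyP c] := T_rsst.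
by split.
Qed.

Lemma rsst_le_se z u : le_se (val z) (val u) -> T z <= T u.
Proof.
have [a b c] := rsstP z u; case/andP; rewrite leq_eqVlt => r; rewrite leq_eqVlt => k.
case/orP: r => r; case/orP: k => k.
- have -> : z = u by apply: val_inj; apply/eqP; rewrite [val z]surjective_pairing [val u]surjective_pairing xpair_eqE r k.
  exact: lexx.
- by apply/ltW/a; rewrite /row_lt r.
- by apply/ltW/b; rewrite /col_lt r k.
have /c h : lt_se (val z) (val u) by rewrite /lt_se r.
by apply: le_trans h; rewrite lerDl.
Qed.

Lemma rsst_lt_cases z u : T z < T u ->
  ((val u).1 <= (val z).1)%N && ((val z).2 < (val u).2)%N ||
  ((val z).1 < (val u).1)%N && ((val u).2 <= (val z).2)%N ||
  lt_se (val z) (val u).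
Proof.
move=> zu; have : ~~ le_se (val u) (val z) by apply/negP => /rsst_le_se; rewrite leNgt zu.
by rewrite /le_se /lt_se; move: (val z) (val u) => [r c] [r' c'] /=; lia.
Qed.

Lemma cell_at (r c : nat) : (c < rowlen p r)%N -> {y : seq_sub (diagram p) | val y = (r, c)}.
Proof.
move=> h; have hd : (r, c) \in diagram p by rewrite mem_diagram.
by exists (SeqSub hd).
Qed.

Lemma cell_nw z (r c : nat) : (r <= (val z).1)%N -> (c <= (val z).2)%N ->
  {y : seq_sub (diagram p) | val y = (r, c)}.
Proof.
move=> hr hc; apply: cell_at; have := valP z; rewrite mem_diagram => h.
by apply: leq_ltn_trans hc _; apply: leq_trans h _; apply: rowlen_le.
Qed.

Lemma before_content z u : content (val z) < content (val u) ->
  read_before T z u = true /\ read_before T u z = false.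
Proof.
move=> h; rewrite /read_before h; split=> //.
by rewrite ltNge (ltW h) /= (gt_eqF h).
Qed.

(* Entries that differ by 1 or 2 lie on different diagonals. *)
Lemma before_near z u : T u < T z -> T z < T u + 3 ->
  read_before T z u = ((val u).1 < (val z).1)%N.
Proof.
move=> uz z3; have /orP [/orP [/andP [r c]|/andP [r c]]|se] := rsst_lt_cases uz.
- have lt : content (val u) < content (val z) by move: r c; rewrite /content; move: (val z) (val u) => [? ?] [? ?] /=; lia.
  by have [_ ->] := before_content lt; apply/esym/negbTE; rewrite -leqNgt.
- have lt : content (val z) < content (val u) by move: r c; rewrite /content; move: (val z) (val u) => [? ?] [? ?] /=; lia.
  by have [-> _] := before_content lt; rewrite r.
by have [_ _ /(_ se)] := rsstP u z; rewrite leNgt z3.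
Qed.

Definition se_square z u : bool :=
  [&& (val z).1 == (val u).1.+1, (val z).2 == (val u).2.+1 &
      [exists y, (val y == ((val u).1.+1, (val u).2)) && (T y == T u + 1)]].

(** The next cell on the diagonal of [u] already holds at least T u + 3, so it must be [z]. *)
Lemma lt_se_adjacent z u : T z = T u + 3 -> lt_se (val u) (val z) ->
  (val z).1 = (val u).1.+1 /\ (val z).2 = (val u).2.+1.
Proof.
move=> e /andP [r c]; have [m mE] := cell_nw r c.
have [_ _ um] := rsstP u m; have {}um : T u + 3 <= T m.
  by apply: um; rewrite mE /lt_se /= !ltnSn.
have mz : T m <= T z by apply: rsst_le_se; rewrite mE /le_se r c.
have : m = z by apply/T_inj/le_anti; rewrite mz e um.
by move=> <-; rewrite mE.
Qed.

(** On different diagonals the rows decide. On a common diagonal [u] and [z] are corners of a 2 x 2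
    square whose southwest entry is T u + 1 or T u + 2: a southeast arrow reads [u] first, a
    northwest arrow reads its tail [z] first. *)
Lemma before_far z u : T z = T u + 3 ->
  read_before T z u = ((val u).1 < (val z).1)%N && ~~ se_square z u.
Proof.
move=> e; have uz : T u < T z by rewrite e ltrDl.
have /orP [/orP [/andP [r c]|/andP [r c]]|se] := rsst_lt_cases uz.
- have lt : content (val u) < content (val z) by move: r c; rewrite /content; move: (val z) (val u) => [? ?] [? ?] /=; lia.
  by have [_ ->] := before_content lt; apply/esym/negbTE; rewrite negb_and -leqNgt r.
- have lt : content (val z) < content (val u) by move: r c; rewrite /content; move: (val z) (val u) => [? ?] [? ?] /=; lia.
  have [-> _] := before_content lt; rewrite r /se_square; apply/esym/negP => /and3P [_ /eqP c' _].
  by move: c; rewrite c' ltnn.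
have [zr zc] := lt_se_adjacent e se; have /andP [r _] := se; rewrite r /=.
have ec : content (val z) = content (val u) by rewrite /content zr zc; move: (val u) => [? ?] /=; lia.
have [y yE] := @cell_nw z (val u).1.+1 (val u).2 r (ltnW (proj2 (andP se))).
have uy : T u < T y by have [_ -> //] := rsstP u y; rewrite yE /col_lt /= ltnSn eqxx.
have yz : T y < T z by have [-> //] := rsstP y z; rewrite yE /row_lt /= zr zc ltnSn eqxx.
have sq : se_square z u = (T y == T u + 1).
  rewrite /se_square zr zc !eqxx /=; apply/existsP/idP => [[y' /andP [/eqP h]]|h].
    by have -> : y' = y by apply: val_inj; rewrite /= h yE.
  by exists y; rewrite yE eqxx.
have tail : nw_tail T z = (T y == T u + 2).
  apply/existsP/idP => [[x /existsP [y' /and4P [/eqP sx _ /eqP ex /eqP ey]]]|h].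
    have xu : x = u by apply: T_inj; apply: (addIr 3); rewrite -e -ex.
    have -> : y = y' by apply: val_inj; rewrite /= yE sx xu.
    by rewrite ey xu.
  exists u; apply/existsP; exists y; rewrite yE e h eqxx /south /east /= eqxx andbT /=.
  by rewrite [val z]surjective_pairing zr zc eqxx.
have le : le_se (val u) (val z) by rewrite /le_se zr zc !leqnSn.
have nle : le_se (val z) (val u) = false by rewrite /le_se zr ltnn.
rewrite /read_before ec ltxx eqxx /= tail sq le nle implybT andbF; case: ifP => [/eqP ->|h]; apply/esym.
  by rewrite -subr_eq0 opprD addrACA subrr add0r.
by apply/negbTE; rewrite negbK; move: uy yz h; rewrite e; lia.
Qed.

End Geometry.

(** * Tableaux and lattice words *)

(** The k-th letter is the row receiving the k-th cell; the column is the number of earlier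
    occurrences of that row. *)
Definition word_cells (c : seq nat) : seq cell :=
  [seq (nth 0%N c k, mult (take k c) (nth 0%N c k)) | k <- iota 0 (size c)].

Definition lattice_word (c : seq nat) : bool :=
  all (fun k => addable (mult (take k c)) (nth 0%N c k)) (iota 0 (size c)).

Lemma size_word_cells c : size (word_cells c) = size c.
Proof. by rewrite size_map size_iota. Qed.

Lemma nth_word_cells c k : (k < size c)%N ->
  nth (0, 0)%N (word_cells c) k = (nth 0%N c k, mult (take k c) (nth 0%N c k)).
Proof. by move=> h; rewrite (nth_map 0%N) ?size_iota // nth_iota. Qed.

Lemma word_cells_rcons c j : word_cells (rcons c j) = rcons (word_cells c) (j, mult c j).
Proof.
rewrite /word_cells size_rcons -addn1 iotaD map_cat cats1 /= add0n nth_rcons ltnn eqxx; congr rcons.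
  apply/eq_in_map => k; rewrite mem_iota /= => kc.
  by rewrite nth_rcons kc -cats1 takel_cat // ltnW.
by rewrite -cats1 take_size_cat.
Qed.

Lemma mem_word_cells c (z : cell) : (z \in word_cells c) = (z.2 < mult c z.1)%N.
Proof.
elim/last_ind: c => [|c j IH]; first by rewrite ltn0.
rewrite word_cells_rcons mem_rcons inE IH mult_rcons /addcell.
case: z {IH} => r k /=; rewrite xpair_eqE; case: (eqVneq r j) => [->|] /=; lia.
Qed.

Lemma uniq_word_cells c : uniq (word_cells c).
Proof.
elim/last_ind: c => [//|c j IH].
by rewrite word_cells_rcons rcons_uniq IH andbT mem_word_cells ltnn.
Qed.

Lemma take_word_cells c k : (k <= size c)%N -> word_cells (take k c) = take k (word_cells c).
Proof.
move=> kc; rewrite /word_cells size_takel // -map_take take_iota (minn_idPl kc).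
apply/eq_in_map => i; rewrite mem_iota /= add0n => ik.
by rewrite nth_take // take_takel // ltnW.
Qed.

Lemma index_word_cells c k (z : cell) : (k <= size c)%N -> z \in word_cells c ->
  (index z (word_cells c) < k)%N = (z.2 < mult (take k c) z.1)%N.
Proof. by move=> kc zc; rewrite -in_take // -take_word_cells // mem_word_cells. Qed.

Section WordFilling.

Variables (p : intpart) (s : seq int).
Hypothesis so : sorted <%R s.

Definition word_filling (c : seq nat) : {ffun seq_sub (diagram p) -> int} :=
  [ffun z => nth 0 s (index (val z) (word_cells c))].

Section FixedWord.

Variable c : seq nat.
Hypotheses (sz : size c = size s) (c_shape : forall i, mult c i = rowlen p i).

Let T := word_filling c.
Let pos (z : seq_sub (diagram p)) : nat := index (val z) (word_cells c).

Lemma mem_cells_word (z : seq_sub (diagram p)) : val z \in word_cells c.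
Proof. by rewrite mem_word_cells c_shape -mem_diagram; apply: valP. Qed.

Lemma pos_lt z : (pos z < size s)%N.
Proof. by rewrite -sz -size_word_cells index_mem mem_cells_word. Qed.

Lemma val_pos z : val z = (nth 0%N c (pos z), mult (take (pos z) c) (nth 0%N c (pos z))).
Proof. by rewrite -nth_word_cells ?sz ?pos_lt // nth_index // mem_cells_word. Qed.

Lemma fillingE z : T z = nth 0 s (pos z).
Proof. by rewrite ffunE. Qed.

Lemma filling_lt z u : (T z < T u) = (pos z < pos u)%N.
Proof. by rewrite !fillingE (lt_sorted_ltn_nth 0 so) // inE pos_lt. Qed.

Lemma pos_before z k : (k <= size s)%N -> (pos z < k)%N = ((val z).2 < mult (take k c) (val z).1)%N.
Proof. by move=> hk; rewrite index_word_cells ?sz // mem_cells_word. Qed.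

Lemma filling_inj : injective T.
Proof.
move=> z u e; have pe : pos z = pos u.
  by case: (ltngtP (pos z) (pos u)) => //; rewrite -filling_lt e ltxx.
apply: val_inj; rewrite -[LHS](nth_index (0, 0)%N (mem_cells_word z)) -/(pos z) pe.
by rewrite nth_index ?mem_cells_word.
Qed.

Lemma cell_of_pos k : (k < size s)%N -> exists2 z, pos z = k & T z = nth 0 s k.
Proof.
move=> hk; have hk' : (k < size (word_cells c))%N by rewrite size_word_cells sz.
have hd : nth (0, 0)%N (word_cells c) k \in diagram p.
  by rewrite mem_diagram -c_shape -mem_word_cells mem_nth.
have e : pos (SeqSub hd) = k by rewrite /pos /= index_uniq ?uniq_word_cells.
by exists (SeqSub hd) => //; rewrite fillingE e.
Qed.

Lemma perm_filling : perm_eq [seq T z | z <- enum {: seq_sub (diagram p)}] s.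
Proof.
apply: uniq_perm; first by rewrite map_inj_uniq ?enum_uniq //; apply: filling_inj.
  by apply: (sorted_uniq lt_trans) so; apply: ltxx.
move=> t; apply/mapP/idP => [[z _ ->]|ts]; first by rewrite fillingE mem_nth ?pos_lt.
have [z _ zE] := cell_of_pos (eq_ind_r (fun b => is_true b) ts (index_mem t s)).
by exists z; rewrite ?mem_enum // zE nth_index.
Qed.

Lemma perm_sqread_filling : perm_eq (sqread T) s.
Proof.
rewrite sqread_cells; apply: perm_trans perm_filling.
by rewrite perm_map // perm_reading.
Qed.

Hypothesis c_lattice : lattice_word c.

Lemma filling_rsst : RSST T.
Proof.
have row z u : row_lt (val z) (val u) -> T z < T u.
  case/andP => /eqP r zu; rewrite filling_lt pos_before ?(ltnW (pos_lt u)) // r.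
  by rewrite (val_pos u) in zu *.
(* The lattice condition when [u] is added says that the row above is longer, so [z] is already
   there. *)
have col1 z u : south (val z) (val u) -> T z < T u.
  move=> /eqP zu; rewrite filling_lt pos_before ?(ltnW (pos_lt u)) //.
  have /allP /(_ (pos u)) := c_lattice; rewrite mem_iota /= add0n sz pos_lt => /(_ isT).
  have := val_pos u; rewrite zu => -[e1 e2]; rewrite /addable -e1 /=.
  by rewrite {1}e1 -e2.
have col z u : col_lt (val z) (val u) -> T z < T u.
  case/andP => zu /eqP k; have [d dE] : exists d, (val u).1 = ((val z).1 + d.+1)%N.
    by exists ((val u).1 - (val z).1.+1)%N; lia.
  elim: d u dE k {zu} => [|d IH] u dE k.
    by apply: col1; rewrite /south [val u]surjective_pairing dE k addn1.
  have [y yE] := @cell_nw p u ((val z).1 + d.+1) (val u).2 ltac:(by rewrite dE leq_add2l) (leqnn _).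
  apply: lt_trans (IH y _ _) (col1 y u _); rewrite ?yE ?k //.
  by rewrite /south [val u]surjective_pairing dE addnS.
apply/forallP => z; apply/forallP => u; apply/and3P; split; apply/implyP; [exact: row|exact: col|].
move=> /andP [r k].
have [y yE] := @cell_nw p u (val z).1 (val u).2 (ltnW r) (leqnn _).
have [x xE] := @cell_nw p u (val u).1 (val z).2 (leqnn _) (ltnW k).
have zy : T z < T y by apply: row; rewrite /row_lt yE /= eqxx.
have yu : T y < T u by apply: col; rewrite /col_lt yE /= r eqxx.
have zx : T z < T x by apply: col; rewrite /col_lt xE /= r eqxx.
have xu : T x < T u by apply: row; rewrite /row_lt xE /= eqxx.
(* Two distinct integers strictly between the opposite corners force the gap of 3. *)
have xy : T x != T y.
  apply/eqP => /filling_inj e; move: yE; rewrite -e xE => -[e1 _].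
  by rewrite e1 ltnn in r.
move: zy yu zx xu xy; move: (T z) (T y) (T x) (T u) => a b d e; lia.
Qed.

End FixedWord.

End WordFilling.

(** * From tableaux back to lattice words *)

Section Converse.

Variables (p : intpart) (s : seq int).
Hypothesis so : sorted <%R s.

Lemma word_filling_inj (c c' : seq nat) : size c = size s -> size c' = size s ->
  (forall i, mult c i = rowlen p i) -> (forall i, mult c' i = rowlen p i) ->
  word_filling p s c = word_filling p s c' -> c = c'.
Proof.
move=> sz sz' h h' e.
have rows d : d = map fst (word_cells d).
  rewrite -map_comp; apply: (@eq_from_nth _ 0%N) => [|k hk].
    by rewrite size_map size_iota.
  by rewrite (nth_map 0%N) ?size_iota // nth_iota.
rewrite [LHS]rows [RHS]rows.
congr map; apply: (@eq_from_nth _ (0, 0)%N) => [|k]; rewrite !size_word_cells ?sz ?sz' // => hk.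
have [z zk zE] := cell_of_pos sz h hk.
have mz := mem_cells_word h z; have mz' := mem_cells_word h' z.
rewrite -{1}zk nth_index //.
have : index (val z) (word_cells c') = k.
  have := congr1 (fun F : {ffun seq_sub (diagram p) -> int} => F z) e; rewrite !ffunE zk.
  have us : uniq s by apply: (sorted_uniq lt_trans) so; apply: ltxx.
  move=> /eqP; rewrite nth_uniq // => [/eqP //|].
  by rewrite -sz' -size_word_cells index_mem.
by move=> <-; rewrite nth_index.
Qed.

Variable T : {ffun seq_sub (diagram p) -> int}.
Hypotheses (T_rsst : RSST T) (T_perm : perm_eq (sqread T) s).

Let us : uniq s.
Proof. by apply: (sorted_uniq lt_trans) so; apply: ltxx. Qed.

Lemma rsst_inj : injective T.
Proof.
have : uniq (sqread T) by rewrite (perm_uniq T_perm).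
rewrite sqread_cells => h z u e.
have hz y : (index y (reading_cells T) < size [seq T y | y <- reading_cells T])%N.
  by rewrite size_map index_mem mem_reading.
have := nth_uniq 0 (hz z) (hz u) h.
rewrite !(nth_map z) ?index_mem ?mem_reading // !nth_index ?mem_reading // e eqxx.
move=> /esym/eqP ie.
by rewrite -(nth_index z (mem_reading T z)) ie nth_index ?mem_reading.
Qed.

Let cs := sort (fun z u : seq_sub (diagram p) => T z <= T u) (enum {: seq_sub (diagram p)}).

Lemma map_sorted_cells : [seq T z | z <- cs] = s.
Proof.
apply: (sorted_eq le_trans le_anti).
- by rewrite sorted_map; apply: sort_sorted => z u; apply: le_total.
- by apply: (sub_sorted _ so) => x y; apply: ltW.
apply: perm_trans T_perm; rewrite sqread_cells; apply: perm_map.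
by rewrite perm_sort perm_sym perm_reading.
Qed.

Lemma mem_sorted_cells z : z \in cs.
Proof. by rewrite mem_sort mem_enum. Qed.

Lemma uniq_sorted_cells : uniq cs.
Proof. by rewrite sort_uniq enum_uniq. Qed.

Lemma size_sorted_cells : size cs = size s.
Proof. by rewrite -map_sorted_cells size_map. Qed.

Lemma sorted_cells_lt z u : (index z cs < index u cs)%N = (T z < T u).
Proof.
rewrite -!(index_map rsst_inj) map_sorted_cells.
have ms y : T y \in s by rewrite -map_sorted_cells map_f ?mem_sorted_cells.
by rewrite -(lt_sorted_ltn_nth 0 so) ?inE ?index_mem // !nth_index.
Qed.

Lemma count_row (L : seq (seq_sub (diagram p))) (r m : nat) : uniq L -> (m <= rowlen p r)%N ->
  (forall u, (val u).1 = r -> (u \in L) = ((val u).2 < m)%N) ->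
  count (fun u => (val u).1 == r) L = m.
Proof.
move=> uL mr hL; rewrite -size_filter -(size_map val).
rewrite -[RHS](size_iota 0 m) -(size_map (fun j : nat => (r, j) : cell)).
apply: perm_size; apply: uniq_perm.
- by rewrite map_inj_uniq ?filter_uniq //; apply: val_inj.
- by rewrite map_inj_uniq ?iota_uniq // => i j [].
move=> z; apply/mapP/mapP => [[u]|[j]].
  rewrite mem_filter => /andP [/eqP ur uu] ->; exists (val u).2.
    by rewrite mem_iota /= add0n -hL.
  by rewrite -ur -surjective_pairing.
rewrite mem_iota /= add0n => jm ->.
have [u uE] := cell_at (leq_trans jm mr).
by exists u; rewrite ?uE // mem_filter uE eqxx /= hL uE.
Qed.

Definition row_word : seq nat := [seq (val z).1 | z <- cs].

Lemma size_row_word : size row_word = size s.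
Proof. by rewrite size_map size_sorted_cells. Qed.

Lemma mult_row_word i : mult row_word i = rowlen p i.
Proof.
rewrite /mult count_map; apply: count_row; rewrite ?uniq_sorted_cells // => u ui.
by rewrite mem_sorted_cells; have := valP u; rewrite mem_diagram ui.
Qed.

Lemma mem_take_cells k z u : (k < size cs)%N -> nth z cs k = z -> (u \in take k cs) = (T u < T z).
Proof.
move=> hk zk; rewrite in_take ?mem_sorted_cells // -sorted_cells_lt.
by rewrite -{1}zk index_uniq ?uniq_sorted_cells.
Qed.

Lemma row_lt_col z u : (val z).1 = (val u).1 -> (T u < T z) = ((val u).2 < (val z).2)%N.
Proof.
move=> r; have H x y : (val x).1 = (val y).1 -> ((val x).2 < (val y).2)%N -> T x < T y.
  by move=> e lt; have [h _ _] := rsstP T_rsst x y; apply: h; rewrite /row_lt e eqxx.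
apply/idP/idP => [lt|/H -> //]; case: (ltngtP (val u).2 (val z).2) => // [h|e].
  by move: lt; rewrite ltNge (ltW (H _ _ r h)).
have uz : u = z by apply: val_inj; rewrite [LHS]surjective_pairing [RHS]surjective_pairing r e.
by move: lt; rewrite uz ltxx.
Qed.

(** Rows increase, so the smaller entries in the row of a cell are exactly those to its west, and
    their number is its column. *)
Lemma word_cells_row_word : word_cells row_word = map val cs.
Proof.
apply: (@eq_from_nth _ (0, 0)%N) => [|k].
  by rewrite size_word_cells !size_map.
rewrite size_word_cells size_map => hk.
have [z0 z0k] : exists z, z = nth z cs k.
  by case E : cs hk => [//|z L] hk; exists (nth z cs k); rewrite E; apply: set_nth_default.
rewrite nth_word_cells ?size_map // (nth_map z0) //= (nth_map z0) // -z0k.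
rewrite [RHS]surjective_pairing; congr (_, _).
rewrite /row_word -map_take /mult count_map.
apply: count_row; first by rewrite take_uniq ?uniq_sorted_cells.
  by have := valP z0; rewrite mem_diagram => /ltnW.
by move=> u ur; rewrite /= (mem_take_cells _ hk (esym z0k)) row_lt_col.
Qed.

Lemma lattice_row_word : lattice_word row_word.
Proof.
apply/allP => k; rewrite mem_iota /= add0n size_map => hk.
have [z zk] : exists z, z = nth z cs k.
  by case E : cs hk => [//|z L] hk; exists (nth z cs k); rewrite E; apply: set_nth_default.
have hk' : (k < size row_word)%N by rewrite size_map.
have := nth_word_cells hk'; rewrite word_cells_row_word (nth_map z) // -zk.
rewrite (nth_map z) // -zk => zE; rewrite /addable.
case E : (val z).1 => [//|r] /=.
have [y yE] := @cell_nw p z r (val z).2 ltac:(by rewrite E) (leqnn _).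
have : val y \in word_cells (take k row_word).
  rewrite take_word_cells ?(ltnW hk') // word_cells_row_word -map_take map_f //.
  rewrite (mem_take_cells _ hk (esym zk)).
  by have [_ h _] := rsstP T_rsst y z; apply: h; rewrite yE /col_lt E /= ltnSn eqxx.
rewrite mem_word_cells yE /=; congr (_ < _)%N.
by move: zE; rewrite E => /(congr1 snd).
Qed.

Lemma word_filling_row_word : word_filling p s row_word = T.
Proof.
apply/ffunP => z; rewrite ffunE word_cells_row_word index_map; last exact: val_inj.
rewrite -{1}map_sorted_cells (nth_map z) ?index_mem ?mem_sorted_cells //.
by rewrite nth_index ?mem_sorted_cells.
Qed.

End Converse.

Lemma inv_prime_letters (k : nat) (v : seq int) : uniq v ->
  inv_prime k v = (\sum_(t <- v) \sum_(u <- v)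
     ((index t v < index u v) && (0 < t - u < k%:Z)%R))%N.
Proof.
move=> uv; rewrite /inv_prime -sum1dep_card big_mkcond.
rewrite (big_nth 0) big_mkord.
under [RHS]eq_bigr do rewrite (big_nth 0) big_mkord.
rewrite pair_big /=; apply: eq_bigr => -[i j] _ /=.
by rewrite !index_uniq //; case: (_ && _).
Qed.

(** * Walk weights as reading word statistics *)

Section FillingWeight.

Variables (p : intpart) (s : seq int) (c : seq nat) (N : nat) (ls : int -> bool).
Hypotheses (so : sorted <%R s) (sz : size c = size s) (c_shape : forall i, mult c i = rowlen p i).
Hypotheses (c_lattice : lattice_word c) (cN : all (fun j => j < N)%N c).

Let T := word_filling p s c.
Let v := sqread T.
Let T_rsst : RSST T := filling_rsst so sz c_shape c_lattice.
Let T_inj : injective T := filling_inj so sz c_shape.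
Let T_perm : perm_eq v s := perm_sqread_filling so sz c_shape.
Let us : uniq s.
Proof. by apply: (sorted_uniq lt_trans) so; apply: ltxx. Qed.

Lemma index_sqread z u : z != u -> (index (T z) v < index (T u) v)%N = read_before T z u.
Proof. by move=> zu; rewrite /v sqread_cells !(index_map T_inj) index_reading. Qed.

Let cell_at_index k : (k < size s)%N ->
  exists z, [/\ T z = nth 0 s k, index (val z) (word_cells c) = k & (val z).1 = nth N c k].
Proof.
move=> hk; have [z zk zE] := cell_of_pos sz c_shape hk; exists z; split; [exact: zE|exact: zk|].
by rewrite (val_pos sz c_shape z) zk /= (set_nth_default N 0%N) // sz.
Qed.

Let colour_cell z : colour N s c (T z) = (val z).1.
Proof.
have hz := pos_lt sz c_shape z; rewrite /colour fillingE index_uniq //.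
by rewrite [in RHS](val_pos sz c_shape z) /= (set_nth_default N 0%N) // sz.
Qed.

Let letter_cell t : t \in s -> exists z, T z = t.
Proof.
move=> ts; have h : (index t s < size s)%N by rewrite index_mem.
by have [z [zE _ _]] := cell_at_index h; exists z; rewrite zE nth_index.
Qed.

Lemma inv_prime_filling : inv_prime 3 v = (\sum_(0 <= k < size s) near_inversions N s c k)%N.
Proof.
rewrite inv_prime_letters ?(perm_uniq T_perm) // (perm_big _ T_perm) /= -sum_near_pairs //.
rewrite (big_nth 0) big_mkord; apply: eq_bigr => k _.
rewrite (perm_big _ T_perm) /= (big_nth 0) big_mkord; apply: eq_bigr => i _.
have [z [<- _ <-]] := cell_at_index (ltn_ord k).
have [u [<- _ <-]] := cell_at_index (ltn_ord i).
case: (boolP (0 < T z - T u < 3)) => [/andP [a b]|_]; rewrite ?andbF // !andbT.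
have uz : T u < T z by rewrite -subr_gt0.
rewrite index_sqread; last by apply: contraTneq uz => ->; rewrite ltxx.
rewrite (before_near T_rsst) //; by move: b; rewrite ltrBlDr addrC.
Qed.

(** The walk tests only the rows of the last letters and two row lengths. This determines the square
    because T u, ..., T u + 3 are consecutive: a cell in a wrong place would need an entry between
    two of them. *)
Lemma square_closedE k z u : (k < size s)%N -> T z = nth 0 s k -> T z = T u + 3 ->
  square_closed N s c k = se_square T z u.
Proof.
move=> hk zE zu.
have pz : index (val z) (word_cells c) = k.
  have [z' [zE' <- _]] := cell_at_index hk.
  by have -> : z = z' by apply: T_inj; rewrite zE zE'.
have ck : nth N c k = (val z).1.
  by have [z' [zE' _ <-]] := cell_at_index hk; congr (val _).1; apply: T_inj; rewrite zE zE'.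
have lamz : mult (take k c) (val z).1 = (val z).2.
  by rewrite {2}(val_pos sz c_shape z) pz /= (val_pos sz c_shape z) pz.
have earlier y : (T y < T z) = ((val y).2 < mult (take k c) (val y).1)%N.
  by rewrite (filling_lt so sz c_shape) pz (pos_before sz c_shape) // ltnW.
have u3 : nth 0 s k - 3 = T u by rewrite -zE zu addrK.
rewrite /square_closed /block u3 colour_cell ck lamz.
have zN : ((val z).1 < N)%N by rewrite -ck; have /allP := cN; apply; rewrite mem_nth ?sz.
have e2 : nth 0 s k - 2 = T u + 1 by rewrite -zE zu -addrA.
have e1 : nth 0 s k - 1 = T u + 2 by rewrite -zE zu -addrA.
have row x y : (val x).1 = (val y).1 -> (T y < T x) = ((val y).2 < (val x).2)%N.
  exact: row_lt_col T_rsst _ _.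
have uz : T u < T z by rewrite zu ltrDl.
rewrite e2 e1; apply/and4P/and3P => [[/eqP zr /eqP m2 /eqP m1 /eqP lam]|[/eqP zr /eqP zc /existsP [y /andP [/eqP yE /eqP yu]]]].
  have [y yE] : exists y, T y = T u + 1.
    apply: letter_cell; apply/negPn/negP => h; move: zN; rewrite -m2 colour_notin // ltnn //.
  have [y1 y1E] : exists y, T y = T u + 2.
    apply: letter_cell; apply/negPn/negP => h; move: zN; rewrite zr -m1 colour_notin //.
    by move=> /ltnW; rewrite ltnn.
  rewrite -yE colour_cell in m2; rewrite -y1E colour_cell in m1.
  have y1z : T y1 < T z by rewrite y1E zu ltrD2l.
  have yz : T y < T z by rewrite yE zu ltrD2l.
  have uy1 : T u < T y1 by rewrite y1E ltrDl.
  have c1 : (val y1).2 = (val z).2.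
    apply/eqP; rewrite eqn_leq; apply/andP; split.
      by move: y1z; rewrite earlier m1 lam ltnS.
    rewrite leqNgt; apply/negP => lt.
    (* The cell above [z] would hold an integer strictly between T u + 2 and T u + 3. *)
    have [x xE] := @cell_nw p z (val u).1 (val z).2 ltac:(by rewrite zr) (leqnn _).
    have xz : T x < T z by rewrite earlier xE lam.
    have : T y1 < T x by rewrite row xE.
    by rewrite y1E => h; move: xz; rewrite zu; move: h; move: (T u) (T x) => a b; lia.
  have c2 : (val y1).2 = (val u).2.+1.
    move: (uy1); rewrite row // leq_eqVlt => /orP [/eqP -> //|lt].
    (* A cell between [u] and [y1] could only hold T u + 1, but that entry is in the lower row. *)
    have [x xE] := @cell_nw p y1 (val u).1 (val u).2.+1 ltac:(by rewrite m1) (ltnW lt).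
    have ux : T u < T x by rewrite row xE /=.
    have xy1 : T x < T y1 by rewrite row xE.
    have xy : x = y by apply: T_inj; rewrite yE; move: ux xy1; rewrite y1E; move: (T u) (T x) => a b; lia.
    by move: m2; rewrite -xy xE zr /= => /eqP; rewrite (ltn_eqF (ltnSn _)).
  rewrite zr -c1 c2 !eqxx; split=> //; apply/existsP; exists y; rewrite yE eqxx andbT.
  have c3 : (val y).2 = (val u).2.
    apply/eqP; rewrite eqn_leq; apply/andP; split.
      by move: yz; rewrite row ?m2 // -c1 c2 ltnS.
    rewrite leqNgt; apply/negP => lt.
    have [x xE] := @cell_nw p z (val z).1 (val u).2 (leqnn _) ltac:(by rewrite -c1 c2).
    have yx : T y < T x by rewrite row xE.
    have xz : T x < T z by rewrite row xE // -c1 c2 /=.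
    have xy : x = y1.
      by apply: T_inj; rewrite y1E; move: yx xz; rewrite yE zu; move: (T u) (T x) => a b; lia.
    by move: m1; rewrite -xy xE zr /= => /eqP; rewrite (gtn_eqF (ltnSn _)).
  by rewrite [val y]surjective_pairing m2 zr c3.
have [x xE] := @cell_nw p z (val u).1 (val z).2 ltac:(by rewrite zr) (leqnn _).
have ux : T u < T x by rewrite row xE // zc /=.
have xz : T x < T z.
  by have [_ h _] := rsstP T_rsst x z; apply: h; rewrite xE /col_lt /= zr ltnSn eqxx.
have xu : T x = T u + 2.
  have : T x != T y by apply/eqP => /T_inj e; move: xE; rewrite e yE => -[/eqP]; rewrite (gtn_eqF (ltnSn _)).
  by move: ux xz; rewrite zu yu; move: (T u) (T x) => a b; lia.
rewrite -yu -xu !colour_cell yE xE zr !eqxx; split=> //.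
rewrite eqn_leq; apply/andP; split; last by move: xz; rewrite earlier xE.
rewrite leqNgt; apply/negP => lt.
(* If the upper row were longer at this moment, its next cell would hold an integer strictly between
   T u + 2 and T z. *)
have lt' : ((val z).2.+1 < rowlen p (val u).1)%N.
  apply: leq_trans lt _; rewrite -c_shape /mult -{2}(cat_take_drop k c) count_cat; exact: leq_addr.
have [x2 x2E] := cell_at lt'.
have xx2 : T x < T x2 by rewrite row xE x2E /=.
have x2z : T x2 < T z by rewrite earlier x2E.
by move: xx2 x2z; rewrite xu zu; move: (T u) (T x2) => a b; lia.
Qed.

Lemma tableau_weight_filling (R : comNzRingType) (q : R) :
  tableau_weight q N (link_plain R s ls) (link_inverted R ls) s c =
  if all (fun t => (t - 3 \in s) ==> ((index t v < index (t - 3)%R v)%N == ls t)) s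
  then q ^+ inv_prime 3 v else 0.
Proof.
rewrite tableau_weightE //.
have -> : all (fun k => addable (mult (take k c)) (nth N c k)) (iota 0 (size s)).
  apply/allP => k kI; have /allP := c_lattice; rewrite sz => /(_ k kI).
  by rewrite (set_nth_default N 0%N) // sz; move: kI; rewrite mem_iota add0n.
rewrite -inv_prime_filling /=; congr (if _ then _ else _).
rewrite -[X in _ = all _ X](mkseq_nth 0 s) /mkseq all_map; apply: eq_in_all => k.
rewrite mem_iota /= add0n => hk /=.
case: (boolP (nth 0 s k - 3 \in s)) => //= h3; congr (_ == _).
have [z [zE _ zr]] := cell_at_index hk; have [u uE] := letter_cell h3.
have zu : T z = T u + 3 by rewrite zE uE subrK.
rewrite -[in RHS]uE -[in RHS]zE index_sqread; last first.
  by apply/eqP => e; move/eqP: zu; rewrite e -subr_eq0 opprD addrA subrr.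
rewrite (before_far T_rsst T_inj zu) -(square_closedE hk zE zu) /far_inversion.
by rewrite -uE colour_cell zr.
Qed.

End FillingWeight.

(** * The Schur expansion *)

Lemma lattice_rcons c j : lattice_word (rcons c j) = lattice_word c && addable (mult c) j.
Proof.
rewrite /lattice_word size_rcons -addn1 iotaD all_cat /= add0n andbT nth_rcons ltnn eqxx.
rewrite (_ : take (size c) (rcons c j) = c); last by rewrite -cats1 take_size_cat.
congr (_ && _); apply: eq_in_all => k.
by rewrite mem_iota /= add0n => kc; rewrite nth_rcons kc -cats1 takel_cat // ltnW.
Qed.

Lemma lattice_mult c : lattice_word c -> forall i, (mult c i.+1 <= mult c i)%N.
Proof.
elim/last_ind: c => [//|c j IH]; rewrite lattice_rcons => /andP [/IH h a] i.
have := h i; rewrite mult_rcons /addcell; case: (eqVneq i.+1 j) => [e _|_ hi].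
  by move: a; rewrite /addable -e /=; lia.
by rewrite addn0 (leq_trans hi) // leq_addr.
Qed.

Lemma mult_gt0 c i : (0 < mult c i)%N = (i \in c).
Proof. by rewrite -has_pred1 has_count. Qed.

(** All rows from 0 to [i] must occur, which takes at least i + 1 letters. *)
Lemma lattice_ltn c i : lattice_word c -> i \in c -> (i < size c)%N.
Proof.
move=> lc ic; rewrite -[X in (X <= _)%N](size_iota 0); apply: uniq_leq_size; first exact: iota_uniq.
move=> k; rewrite mem_iota /= add0n ltnS -!mult_gt0 => ki; move: ic; rewrite -mult_gt0 => ic.
apply: leq_trans ic _.
by apply: (@homo_leq _ (mult c) (fun a b => b <= a)%N) => // [a b d ba db|k']; [exact: leq_trans db ba|exact: lattice_mult].
Qed.

Definition row_lengths (c : seq nat) : seq nat := [seq v <- mkseq (mult c) (size c) | v != 0%N].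

Lemma nth_filter_nonzero (r : seq nat) i : sorted geq r -> nth 0%N [seq v <- r | v != 0%N] i = nth 0%N r i.
Proof.
elim: r i => // x r IH i so; case: (eqVneq x 0%N) => [x0|xn] /=.
  have r0 : r = nseq (size r) 0%N.
    apply/all_pred1P/allP => v vr; have geq_tr : transitive geq by move=> b a d ab bd; apply: leq_trans bd ab.
    by have /allP /(_ v vr) := order_path_min geq_tr so; rewrite /= x0 leqn0.
  rewrite x0 eqxx /= r0 filter_nseq /= nth_nil; case: i => [|i] //=.
  by rewrite nth_nseq if_same.
by rewrite xn; case: i => [//|i] /=; apply: IH; apply: path_sorted so.
Qed.

Lemma row_lengths_sorted c : lattice_word c -> sorted geq (mkseq (mult c) (size c)).
Proof.
move=> lc; apply/(sortedP 0%N) => i; rewrite size_mkseq => hi.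
by rewrite !nth_mkseq ?(ltnW hi) //; apply: lattice_mult.
Qed.

Lemma row_lengths_part c : lattice_word c -> is_part (row_lengths c).
Proof.
move=> lc; rewrite /is_part mem_filter eqxx andbT; apply: sorted_filter; last exact: row_lengths_sorted.
by move=> b a d ab bd; apply: leq_trans bd ab.
Qed.

Lemma nil_part : is_part [::]. Proof. by []. Qed.

Definition word_shape (c : seq nat) : intpart := insubd (Sub [::] nil_part : intpart) (row_lengths c).

Lemma rowlen_shape c i : lattice_word c -> rowlen (word_shape c) i = mult c i.
Proof.
move=> lc; rewrite /rowlen val_insubd row_lengths_part // nth_filter_nonzero ?row_lengths_sorted //.
case: (ltnP i (size c)) => hi; first by rewrite nth_mkseq.
rewrite nth_default ?size_mkseq //; apply/esym/eqP; rewrite -leqn0 leqNgt mult_gt0.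
by apply: contraL hi => /(lattice_ltn lc); rewrite -ltnNge.
Qed.

Lemma intpart_eq (p p' : intpart) : (forall i, rowlen p i = rowlen p' i) -> p = p'.
Proof.
move=> h; apply: (@expmnm_rowlen_inj (maxn (size (val p)) (size (val p')))); rewrite ?leq_maxl ?leq_maxr //.
by congr expmnm; apply: boolp.funext => i; rewrite h.
Qed.

Lemma size_shape N c : lattice_word c -> all (fun j => j < N)%N c -> (size (val (word_shape c)) <= N)%N.
Proof.
move=> lc /allP cN; rewrite leqNgt; apply/negP => /rowlen_gt0.
by rewrite rowlen_shape // mult_gt0 => /cN; rewrite ltnn.
Qed.

Lemma vals_surj N n (r : seq nat) : size r = n -> all (fun j => j < N)%N r ->
  exists c : n.-tuple 'I_N, vals c = r.
Proof.
move=> sz rN; have [c cE] : exists c : seq 'I_N, vals c = r.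
  elim: r rN {sz} => [|j r IH] /=; first by exists [::].
  by move=> /andP [jN /IH [c <-]]; exists (Ordinal jN :: c).
have cn : size c == n by rewrite -sz -cE size_map.
by exists (Tuple cn).
Qed.

Section Assembly.

Variable (beta : 'I_3 -> skew_shape).
Hypothesis hbeta : forall i, no_square (beta i).

Let s := letters beta.
Let ls := letter_south beta.
Let so : sorted <%R s := letters_sorted hbeta.

Definition tableau_coef (p : intpart) : {poly int} :=
  \sum_(T \in [set T : {ffun seq_sub (diagram p) -> int} |
                 RSST T /\ Wprime beta (sqread T)]%classic)
    ('X : {poly int}) ^+ inv_prime 3 (sqread T).

Let admissible (v : seq int) : bool :=
  all (fun t => (t - 3 \in s) ==> ((index t v < index (t - 3)%R v)%N == ls t)) s.

Lemma Wprime_admissible v : Wprime beta v <-> perm_eq v s /\ admissible v.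
Proof.
rewrite (Wprime_letters hbeta); split=> -[pv h]; split=> //.
  by apply/allP => t ts; apply/implyP => t3; rewrite h.
by move=> t ts t3; have /allP /(_ t ts) /implyP /(_ t3) /eqP := h.
Qed.

Local Notation word N := ((size s).-tuple 'I_N).

Let weight (R : comNzRingType) (q : R) N (c : seq nat) : R :=
  tableau_weight q N (link_plain R s ls) (link_inverted R ls) s c.

Lemma weight_filling (R : comNzRingType) (q : R) N (c : word N) : lattice_word (vals c) ->
  weight q N (vals c) = if admissible (sqread (word_filling (word_shape (vals c)) s (vals c)))
    then q ^+ inv_prime 3 (sqread (word_filling (word_shape (vals c)) s (vals c))) else 0.
Proof.
move=> lc; apply: tableau_weight_filling => //; rewrite ?size_map ?size_tuple ?all_vals //.
by move=> i; rewrite rowlen_shape.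
Qed.

(** [word_filling] and [row_word] are inverse to each other; the bound on the rows makes every row
    index a colour. Words with an inadmissible reading word have weight 0. *)
Lemma tableau_coef_words N p : (size (val p) <= N)%N ->
  tableau_coef p = \sum_(c : word N | lattice_word (vals c) && (word_shape (vals c) == p)) weight 'X N (vals c).
Proof.
move=> pN; pose P (c : word N) := [&& lattice_word (vals c), word_shape (vals c) == p & admissible (sqread (word_filling p s (vals c)))].
have sz (c : word N) : size (vals c) = size s by rewrite size_map size_tuple.
have rl (c : word N) : lattice_word (vals c) -> word_shape (vals c) == p -> forall i, mult (vals c) i = rowlen p i.
  by move=> lc /eqP <- i; rewrite rowlen_shape.
pose r := [seq word_filling p s (vals c) | c : word N <- enum P].
have ur : uniq r.
  rewrite map_inj_in_uniq ?enum_uniq // => c c'; rewrite !mem_enum => /and3P [l1 h1 _] /and3P [l2 h2 _] e.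
  apply/val_inj/(inj_map (@ord_inj N)).
  exact: (word_filling_inj so (sz c) (sz c') (rl c l1 h1) (rl c' l2 h2) e).
have setE : [set T : {ffun seq_sub (diagram p) -> int} | RSST T /\ Wprime beta (sqread T)]%classic = [set` r]%classic.
  apply/seteqP; split=> T /=.
    move=> [T1 /Wprime_admissible [T2 T3]]; have e := word_filling_row_word so T1 T2.
    have [c cE] : exists c : word N, vals c = row_word T.
      apply: vals_surj; first exact: size_row_word T2.
      apply/allP => _ /mapP [z _ ->]; apply: leq_trans pN; rewrite ltnNge; apply/negP => /rowlen_default z0.
      by have := valP z; rewrite mem_diagram z0.
    have lc : lattice_word (vals c) by rewrite cE; apply: (lattice_row_word so).
    apply/mapP; exists c; last by rewrite cE e.
    rewrite mem_enum; apply/and3P; split=> //; last by rewrite cE e.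
    by apply/eqP/intpart_eq => i; rewrite rowlen_shape // cE mult_row_word.
  move=> /mapP [c]; rewrite mem_enum => /and3P [lc hc ac] ->; split.
    exact: (filling_rsst so (sz c) (rl c lc hc) lc).
  by apply/Wprime_admissible; split=> //; exact: (perm_sqread_filling so (sz c) (rl c lc hc)).
rewrite /tableau_coef setE -fsbig_seq // big_map big_enum /= [RHS](bigID (fun c : word N => admissible (sqread (word_filling p s (vals c))))) /=.
rewrite [X in _ + X]big1 ?addr0; last first.
  by move=> c /andP [/andP [lc /eqP hc] na]; rewrite weight_filling // hc (negPf na).
apply: eq_big => [c|c /and3P [lc /eqP hc ac]]; first by rewrite -andbA.
by rewrite weight_filling // hc ac.
Qed.

Lemma alternant_powdet N (lam : nat -> nat) :
  alternant (fun i : 'I_N => 'X_i : {mpoly {poly int}[N]}) lam = powdet (mvar N) N (fun i => lam i + (N - i.+1))%N.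
Proof.
apply: eq_bigr => p _; congr (_ * _); apply: eq_bigr => i _.
by rewrite mxE /mvar valK.
Qed.

Lemma weight_mpoly N (c : word N) : weight (qvar N) N (vals c) = (weight 'X N (vals c))%:MP.
Proof.
have sz : size (vals c) = size s by rewrite size_map size_tuple.
rewrite /weight !tableau_weightE ?all_vals //.
by case: ifP => _; rewrite ?mpolyC0 // rmorphXn.
Qed.

Lemma LLT_lattice_words N :
  LLT beta N = \sum_(c : word N | lattice_word (vals c)) weight 'X N (vals c) *: schur (word_shape (vals c)) N.
Proof.
(* Division by the Vandermonde determinant: the polynomials form a domain. *)
apply: (mulfI (powdet_delta_neq0 N)); rewrite LLT_colour_sum //.
have := @colour_sum_bialternant _ (qvar N) N (link_plain _ s ls) (link_inverted _ ls) s so (fun i : 'I_N => 'X_i : {mpoly {poly int}[N]}).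
rewrite !alternant_powdet => ->; rewrite mulr_sumr [RHS]big_mkcond /=; apply: eq_bigr => c _.
rewrite -/(weight (qvar N) N (vals c)); case: ifP => [lc|/negbT nlc]; last first.
  rewrite /weight tableau_weightE ?all_vals ?size_map ?size_tuple //.
  case: ifP => [/andP [/allP h _]|_]; last by rewrite mul0r.
  case/negP: nlc; apply/allP => k; rewrite size_map size_tuple => /[dup] hk /h.
  by rewrite (set_nth_default N 0%N) // size_map size_tuple; move: hk; rewrite mem_iota.
rewrite weight_mpoly -scalerAr schur_bialternant ?(size_shape lc) ?all_vals // mul_mpolyC alternant_powdet.
by congr (_ *: powdet _ _ _); apply: boolp.funext => i; rewrite rowlen_shape.
Qed.

(** By [lattice_ltn] every lattice word of this length uses only colours below [size s], so one
    finite set of shapes serves for all [N]. *)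
Let support : {fset intpart} := seq_fset tt [seq word_shape (vals c) | c : word (size s) <- enum {: word (size s)}].

Lemma shape_support N (c : word N) : lattice_word (vals c) -> word_shape (vals c) \in support.
Proof.
move=> lc; have sz : size (vals c) = size s by rewrite size_map size_tuple.
have [c' cE] : exists c' : word (size s), vals c' = vals c.
  by apply: vals_surj => //; apply/allP => i /(lattice_ltn lc); rewrite sz.
by rewrite seq_fsetE; apply/mapP; exists c'; rewrite ?mem_enum ?cE.
Qed.

Let coefs : {fsfun intpart -> {poly int} with 0} := [fsfun p in support => tableau_coef p].

Lemma coefsE p : coefs p = tableau_coef p.
Proof.
rewrite fsfunE; case: ifP => // /negbT np; apply/esym.
rewrite (tableau_coef_words (leqnn _)) big1 // => c /andP [lc /eqP e].
by rewrite -e shape_support in np.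
Qed.

Lemma LLT_coefs N : LLT beta N = \sum_(p <- finsupp coefs) coefs p *: schur p N.
Proof.
have sub : (finsupp coefs `<=` support)%fset.
  apply/fsubsetP => p; rewrite mem_finsupp fsfunE; case: ifP => //; by rewrite eqxx.
rewrite (big_fset_incl _ sub); last by move=> p _ /fsfun_dflt ->; rewrite scale0r.
rewrite LLT_lattice_words.
transitivity (\sum_(p <- support) \sum_(c : word N | lattice_word (vals c) && (word_shape (vals c) == p)) weight 'X N (vals c) *: schur p N).
  rewrite (exchange_big_dep (fun c : word N => lattice_word (vals c))) /=; last by move=> p c _ /andP [].
  apply: eq_bigr => c lc; rewrite big_mkcond (bigD1_seq (word_shape (vals c))) ?(fset_uniq support) ?shape_support //.
  by rewrite /= lc eqxx big1 ?addr0 // => p ne; rewrite eq_sym (negPf ne).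
apply: eq_bigr => p _; rewrite -scaler_suml.
(* With too few variables the words miss some tableaux, but then the Schur polynomial is 0. *)
case: (leqP (size (val p)) N) => [pN|Np]; last by rewrite schur_gt_vars ?scaler0.
by rewrite coefsE (tableau_coef_words pN).
Qed.

Lemma LLT_coefE p : LLT_coef beta p = tableau_coef p.
Proof.
rewrite -coefsE; congr (fun_of_fsfun _ p); apply: xget_unique; first exact: LLT_coefs.
by move=> g gE; apply: (@schur_expansion_unique (LLT beta)) => //; apply: LLT_coefs.
Qed.


End Assembly.

Theorem corollary1p2 (beta : 'I_3 -> skew_shape)
    (hbeta : forall i, no_square (beta i)) (lam : intpart) :
  LLT_coef beta lam =
  \sum_(T \in [set T : {ffun seq_sub (diagram lam) -> int} |
                 RSST T /\ Wprime beta (sqread T)]%classic)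
    ('X : {poly int}) ^+ inv_prime 3 (sqread T).
Proof. exact: LLT_coefE. Qed.
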